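(* Let $T$ be a complete first-order theory. (1) $T$ is $\mathrm{NTP}_2$ iff every type (over any set) has $\downarrow^d$ pre-weight $<|T|^+$, iff every type over a model has $\downarrow^f$ pre-weight $<|T|^+$, iff every type over a model has $\downarrow^d$ pre-weight $<|T|^+$. (2) $T$ is dependent iff every type has $\downarrow^s$ pre-weight $<|T|^+$, iff every type over a model has $\downarrow^i$ pre-weight $<|T|^+$, iff every type over a model has $\downarrow^s$ pre-weight $<|T|^+$. (3) $T$ is strongly dependent iff every type has $\downarrow^s$ pre-weight $<\aleph_0$, iff every type over a model has $\downarrow^i$ pre-weight $<\aleph_0$, iff every type over a model has $\downarrow^s$ pre-weight $<\aleph_0$.
   Context: Work in a monster model of $T$. Independence notions for a tuple $a$ and sets $B$, $b$: $a\downarrow^f_B b$ means $\operatorname{tp}(a/Bb)$ does not fork over $B$; $a\downarrow^d_B b$ means it does not divide over $B$. A type $\operatorname{tp}(a/C)$ with $B\subseteq C$ splits strongly over $B$ if there are $c_1,c_2\in C$ and a formula $\varphi(x,y)$ over $B$ with $\varphi(x,c_1)\wedge\neg\varphi(x,c_2)\in\operatorname{tp}(a/C)$ such that $c_1,c_2$ both lie in some $B$-indiscernible sequence. $a\downarrow^s_B b$ means $\operatorname{tp}(a/Bb)$ does not split strongly over $B$; $a\downarrow^i_B b$ means $\operatorname{tp}(a/Bb)$ has a global extension which does not split strongly over $B$. Strict independence: a set $\{a_i:i<\lambda\}$ is strictly independent over $B$ if for every family $\{I_i\}$ of $B$-indiscernible sequences with $I_i$ starting with $a_i$ there are $I'_i\equiv_{Ba_i}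 I_i$ with each $I'_i$ indiscernible over $B\cup\bigcup_{j\neq i}I'_j$. For an independence notion $\downarrow$ and ordinal (cardinal) $\alpha$, $p\in S(B)$ has $\downarrow$ pre-weight at least $\alpha$ if there are a set $\{a_i:i<\alpha\}$ strictly independent over $B$ and $a\models p$ such that $a\not\downarrow_B a_i$ for all $i<\alpha$; $p$ has pre-weight $<\alpha$ otherwise. $T$ has the tree property of the second kind if there are a formula $\varphi(x,y)$, $k<\omega$ and an array $\langle a_{i,j}:i,j<\omega\rangle$ such that each row $\{\varphi(x,a_{i,j}):j<\omega\}$ is $k$-inconsistent and for every $\eta:\omega\to\omega$ the path $\{\varphi(x,a_{i,\eta(i)}):i<\omega\}$ is consistent; $T$ is $\mathrm{NTP}_2$ if it does not. $T$ is dependent if no formula has the independence property. $T$ is strongly dependent if there is no sequence of formulas $\langle\varphi_i(x,y_i):i<\omega\rangle$ and array $\langle a_{i,j}:i,j<\omega\rangle$ such that for every $\eta:\omega\to\omega$ the set $\{\varphi_i(x,a_{i,j})^{\text{if } \eta(i)=j}:i,j<\omega\}$ is consistent, where $\varphi^{\text{true}}=\varphi$ and $\varphi^{\text{false}}=\neg\varphi$. *)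

(* Defs.v *)
From mathcomp Require Import all_boot.
From mathcomp Require Import boolp classical_sets functions cardinality.

Set Implicit Arguments.
Unset Strict Implicit.
Unset Printing Implicit Defensive.

Local Open Scope classical_set_scope.
Local Open Scope card_scope.

(** * First-order logic with equality *)

Record language := Language {
  fsym : Type; far : fsym -> nat;
  rsym : Type; rar : rsym -> nat }.

Inductive term (L : language) (V : Type) : Type :=
| Var of V
| App (f : fsym L) of ('I_(far f) -> term L V).

(* [formula L V]: formulas whose free variables are named by [V]; a quantifier
   adds the variable [None]. *)
Inductive formula (L : language) (V : Type) : Type :=
| Eq of term L V & term L V
| Rel (r : rsym L) of ('I_(rar r) -> term L V)
| Neg of formula L V
| And of formula L V & formula L V
| Ex of formula L (option V).

Fixpoint trename L (V W : Type) (f : V -> W) (t : term L V) : term L W :=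
  match t with
  | Var v => Var L (f v)
  | App g ts => App (fun i => trename f (ts i))
  end.

Fixpoint frename L (V W : Type) (f : V -> W) (phi : formula L V) : formula L W :=
  match phi with
  | Eq s t => Eq (trename f s) (trename f t)
  | Rel r ts => Rel (fun i => trename f (ts i))
  | Neg p => Neg (frename f p)
  | And p q => And (frename f p) (frename f q)
  | Ex p => Ex (frename (omap f) p)
  end.

(* All free variables satisfy [P]. *)
Fixpoint tfree_in L (V : Type) (t : term L V) (P : set V) : Prop :=
  match t with
  | Var v => P v
  | App g ts => forall i, tfree_in (ts i) P
  end.

Fixpoint free_in L (V : Type) (phi : formula L V) (P : set V) : Prop :=
  match phi with
  | Eq s t => tfree_in s P /\ tfree_in t P
  | Rel r ts => forall i, tfree_in (ts i) P
  | Neg p => free_in p P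
  | And p q => free_in p P /\ free_in q P
  | Ex p => free_in p (fun o => if o is Some v then P v else True)
  end.

Record structure (L : language) := Structure {
  carrier :> Type;
  carrier_nonempty : inhabited carrier;
  fint : forall f : fsym L, ('I_(far f) -> carrier) -> carrier;
  rint : forall r : rsym L, ('I_(rar r) -> carrier) -> Prop }.

Fixpoint eval L (M : structure L) (V : Type) (t : term L V) (v : V -> M) : M :=
  match t with
  | Var x => v x
  | App g ts => fint (fun i => eval (ts i) v)
  end.

Fixpoint sat L (M : structure L) (V : Type) (phi : formula L V) (v : V -> M) : Prop :=
  match phi with
  | Eq s t => eval s v = eval t v
  | Rel r ts => rint (fun i => eval (ts i) v)
  | Neg p => ~ sat p v
  | And p q => sat p v /\ sat q v
  | Ex p => exists d : M, sat p (fun o => if o is Some x then v x else d)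
  end.

Definition sentence L := formula L void.

Definition models L (M : structure L) (T : set (sentence L)) : Prop :=
  forall s, T s -> sat s (of_void M).

Definition entails L (T : set (sentence L)) (s : sentence L) : Prop :=
  forall M : structure L, models M T -> sat s (of_void M).

Definition complete_theory L (T : set (sentence L)) : Prop :=
  (exists M : structure L, models M T) /\
  forall s, entails T s \/ entails T (Neg s).

(** * Cardinals *)

Definition card_lt (X Y : Type) (A : set X) (B : set Y) : Prop :=
  (A #<= B) /\ ~ (B #<= A).

Definition strong_limit (K : Type) : Prop :=
  forall X : Type, card_lt [set: X] [set: K] -> card_lt [set: set X] [set: K].

(* [Y] has the cardinality of the successor of the cardinal of [X]. *)
Definition succ_card (X Y : Type) : Prop :=
  card_lt [set: X] [set: Y] /\
  forall Z : Type, card_lt [set: Z] [set: Y] -> [set: Z] #<= [set: X].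

(** * Types *)

(* Concatenation of two tuples. *)
Definition cat_tup (X Y Z : Type) (u : X -> Z) (v : Y -> Z) : X + Y -> Z :=
  fun s => match s with inl x => u x | inr y => v y end.

Section Types.
Context {L : language} {M : structure L}.

(* Formulas in the variables [X] with parameters from [M]. *)
Definition pformula (X : Type) := formula L (X + M).

Definition over (X : Type) (B : set M) (psi : pformula X) : Prop :=
  free_in psi (fun s => match s with inl _ => True | inr m => B m end).

Definition holds (X : Type) (psi : pformula X) (a : X -> M) : Prop :=
  sat psi (cat_tup a id).

(* The instance phi(x,c) of phi(x,y). *)
Definition inst (X Y : Type) (phi : formula L (X + Y)) (c : Y -> M) : pformula X :=
  frename (fun s => match s with inl x => inl x | inr y => inr (c y) end) phi.

Definition consistent (X : Type) (Gamma : set (pformula X)) : Prop :=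
  forall (r : nat) (theta : 'I_r -> pformula X),
    (forall i, Gamma (theta i)) -> exists a : X -> M, forall i, holds (theta i) a.

(* Counted by indices: repeated instances count with their multiplicity. *)
Definition k_inconsistent (X : Type) (k : nat) (Gamma : nat -> pformula X) : Prop :=
  forall s : 'I_k -> nat, injective s ->
    ~ exists a : X -> M, forall i, holds (Gamma (s i)) a.

Definition complete_type (X : Type) (B : set M) (p : set (pformula X)) : Prop :=
  [/\ p `<=` over B,
      consistent p &
      forall psi, over B psi -> p psi \/ p (Neg psi)].

Definition tp (X : Type) (B : set M) (a : X -> M) : set (pformula X) :=
  [set psi | over B psi /\ holds psi a].

Definition realizes (X : Type) (a : X -> M) (p : set (pformula X)) : Prop :=
  forall psi, p psi -> holds psi a.

(* The sequence [s] of [J]-tuples is indiscernible over [B]. *)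
Definition indiscernible (J : Type) (B : set M) (s : nat -> J -> M) : Prop :=
  forall (n : nat) (i j : 'I_n -> nat),
    {homo i : x y / (x < y)%N} -> {homo j : x y / (x < y)%N} ->
    tp B (fun z : 'I_n * J => s (i z.1) z.2) =
    tp B (fun z : 'I_n * J => s (j z.1) z.2).

End Types.

Arguments pformula {L} M X.

(** * The monster model *)

Definition automorphism L (M : structure L) (g : M -> M) : Prop :=
  [/\ bijective g,
      forall (f : fsym L) (v : 'I_(far f) -> M),
        g (fint v) = fint (fun i => g (v i)) &
      forall (r : rsym L) (v : 'I_(rar r) -> M),
        rint v <-> rint (fun i => g (v i))].

Definition small (K X : Type) (A : set X) : Prop := card_lt A [set: K].

Definition saturated L (K : Type) (M : structure L) : Prop :=
  forall (B : set M) (n : nat) (p : set (pformula M 'I_n)),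
    small K B -> complete_type B p -> exists a : 'I_n -> M, realizes a p.

Definition strongly_homogeneous L (K : Type) (M : structure L) : Prop :=
  forall (J : Type) (u v : J -> M),
    small K [set: J] -> tp set0 u = tp set0 v ->
    exists2 g : M -> M, automorphism g & forall j, g (u j) = v j.

(* [K] stands for its cardinality; |T| is the number of L-formulas, i.e.
   |L| + aleph_0. *)
Definition monster L (T : set (sentence L)) (K : Type) (M : structure L) : Prop :=
  [/\ models M T,
      strong_limit K /\ card_lt [set: formula L nat] [set: K],
      saturated K M &
      strongly_homogeneous K M].

Definition elementary_embedding L (N M : structure L) (h : N -> M) : Prop :=
  forall (n : nat) (phi : formula L 'I_n) (v : 'I_n -> N),
    sat phi v <-> sat phi (h \o v).

(* [B] is the universe of an elementary substructure of [M]. *)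
Definition elementary_sub L (M : structure L) (B : set M) : Prop :=
  exists (N : structure L) (h : N -> M), elementary_embedding h /\ range h = B.

(** * Independence notions *)

Section Independence.
Context {L : language} {M : structure L}.

Definition divides (X : Type) (B : set M) (psi : pformula M X) : Prop :=
  exists (m : nat) (phi : formula L (X + 'I_m)) (b : 'I_m -> M),
    psi = inst phi b /\
    exists (k : nat) (s : nat -> 'I_m -> M),
      (forall i, tp B (s i) = tp B b) /\
      k_inconsistent k (fun i => inst phi (s i)).

Definition forks (X : Type) (B : set M) (psi : pformula M X) : Prop :=
  exists (r : nat) (theta : 'I_r -> pformula M X),
    (forall i, divides B (theta i)) /\
    forall a, holds psi a -> exists i, holds (theta i) a.

(* [p] is a type over [C] with [B `<=` C]; the formula phi(x,y) over [B] is
   written phi(x,y,b) with [b] in [B]. *)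
Definition splits_strongly (X : Type) (B C : set M) (p : set (pformula M X)) : Prop :=
  exists (m r : nat) (phi : formula L (X + ('I_m + 'I_r)))
         (b : 'I_r -> M) (c1 c2 : 'I_m -> M),
    [/\ (forall i, B (b i)),
        (forall i, C (c1 i)) /\ (forall i, C (c2 i)),
        p (And (inst phi (cat_tup c1 b)) (Neg (inst phi (cat_tup c2 b)))) &
        exists s : nat -> 'I_m -> M,
          indiscernible B s /\ exists i j, s i = c1 /\ s j = c2].

(* [ind a B b] : a is independent from b over B. *)
Definition indep_notion := forall n : nat, ('I_n -> M) -> set M -> set M -> Prop.

Definition ind_d : indep_notion := fun n a B b =>
  ~ exists2 psi, tp (B `|` b) a psi & divides B psi.

Definition ind_f : indep_notion := fun n a B b =>
  ~ exists2 psi, tp (B `|` b) a psi & forks B psi.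

Definition ind_s : indep_notion := fun n a B b =>
  ~ splits_strongly B (B `|` b) (tp (B `|` b) a).

Definition ind_i : indep_notion := fun n a B b =>
  exists q : set (pformula M 'I_n),
    [/\ complete_type [set: M] q,
        tp (B `|` b) a `<=` q &
        ~ splits_strongly B [set: M] q].

(* Here a_i is a tuple indexed by [J i], and a sequence [I i] of such tuples is
   viewed as one tuple indexed by [nat * J i]. *)
Definition strictly_independent (Lam : Type) (J : Lam -> Type) (B : set M)
    (a : forall i, J i -> M) : Prop :=
  forall I : forall i, nat -> J i -> M,
    (forall i, indiscernible B (I i)) -> (forall i, I i 0%N = a i) ->
    exists I' : forall i, nat -> J i -> M,
      (forall i, let A := B `|` range (a i) in
         tp A (fun z => I' i z.1 z.2) = tp A (fun z => I i z.1 z.2)) /\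
      (forall i, indiscernible
         (B `|` \bigcup_(j in [set j | j <> i]) range (fun z => I' j z.1 z.2))
         (I' i)).

Definition preweight_ge (K : Type) (ind : indep_notion) (n : nat) (B : set M)
    (p : set (pformula M 'I_n)) (Lam : Type) : Prop :=
  exists (J : Lam -> Type) (a : forall i, J i -> M),
    [/\ forall i, small K [set: J i],
        strictly_independent B a &
        exists2 d : 'I_n -> M, realizes d p &
          forall i, ~ ind n d B (range (a i))].

Definition preweight_lt (K : Type) (ind : indep_notion) (n : nat) (B : set M)
    (p : set (pformula M 'I_n)) (Lam : Type) : Prop :=
  ~ preweight_ge K ind B p Lam.

Definition types_preweight_lt (K : Type) (ind : indep_notion) (Lam : Type) :=
  forall (n : nat) (B : set M) (p : set (pformula M 'I_n)),
    small K B -> complete_type B p -> preweight_lt K ind B p Lam.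

Definition model_types_preweight_lt (K : Type) (ind : indep_notion) (Lam : Type) :=
  forall (n : nat) (B : set M) (p : set (pformula M 'I_n)),
    small K B -> elementary_sub B -> complete_type B p ->
    preweight_lt K ind B p Lam.

End Independence.

Arguments indep_notion {L} M.
Arguments ind_d {L} M.
Arguments ind_f {L} M.
Arguments ind_s {L} M.
Arguments ind_i {L} M.

(** * Dividing lines, evaluated in the monster model *)

Definition TP2 L (M : structure L) : Prop :=
  exists (n m : nat) (phi : formula L ('I_n + 'I_m)) (k : nat)
         (a : nat -> nat -> 'I_m -> M),
    (forall i, k_inconsistent k (fun j => inst phi (a i j))) /\
    (forall eta : nat -> nat,
       consistent (range (fun i => inst phi (a i (eta i))))).

Definition NTP2 L (M : structure L) : Prop := ~ TP2 M.

Definition independence_property L (M : structure L) n m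
    (phi : formula L ('I_n + 'I_m)) : Prop :=
  exists (a : nat -> 'I_m -> M) (b : set nat -> 'I_n -> M),
    forall (i : nat) (S : set nat), holds (inst phi (a i)) (b S) <-> S i.

Definition dependent L (M : structure L) : Prop :=
  forall n m (phi : formula L ('I_n + 'I_m)), ~ independence_property M phi.

Definition strongly_dependent L (M : structure L) : Prop :=
  ~ exists (n : nat) (m : nat -> nat)
           (phi : forall i, formula L ('I_n + 'I_(m i)))
           (a : forall i, nat -> 'I_(m i) -> M),
      forall eta : nat -> nat,
        consistent (range (fun z : nat * nat =>
          let psi := inst (phi z.1) (a z.1 z.2) in
          if eta z.1 == z.2 then psi else Neg psi)).

(* Main.v *)
From Stdlib Require List.
Require Import Defs.
From mathcomp Require Import all_boot.
From mathcomp Require Import boolp classical_sets functions cardinality filter.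
From mathcomp Require wochoice.

(** Everything is done with definable subsets of the monster model; dividing is
    expressed through automorphisms, and types are limits of ultrafilters.

    Upper bounds.  A formula over [B a_i] that divides over [B] gives a
    [B]-indiscernible sequence starting with [a_i] along which it is
    k-inconsistent.  Strict independence makes these sequences mutually
    indiscernible, so that paths are consistent as soon as one of them is.  With
    [|T|^+] rows infinitely many carry the same formula and the same k, which is
    TP2; with countably many rows one still gets a failure of strong dependence.
    In a dependent theory a formula witnessing strong splitting divides, by
    alternation along an indiscernible sequence.

    Over models, forking is reduced to dividing in NTP2 theories: a dividing
    formula has a coheir along which it is inconsistent; by the vacuum cleaner
    argument a forking formula has finitely many inconsistent conjugates over the
    model; hence every type over a model has a strictly non-forking coheir; its
    Morley sequences are strictly independent, and so they witness all dividing
    at once.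

    Lower bounds.  A bad array is turned into ultrafilters [W_i] concentrated on a
    small set [A].  Over a small model that is saturated enough relative to [A] the
    limits of the [W_i] are heirs as well as coheirs, so a Morley sequence of them
    is strictly independent over this model and realizes a path of the array. *)

Set Implicit Arguments.
Unset Strict Implicit.
Unset Printing Implicit Defensive.

Local Open Scope classical_set_scope.

(* ssreflect's [over] and [fsym] hide those of Defs. *)
Local Notation over := Defs.over.
Local Notation fsym := Defs.fsym.

(** * Syntax and definable sets *)

(** The obstacle is that strict independence concerns arbitrary indiscernible sequences [I i],
    chosen after the tuples [a i]; that the [a i] form a Morley sequence does not control them. What
    helps is strictness of each tuple: a formula of its ultrafilter does not divide when variables
    and parameters exchange roles. Then every row has a conjugate all of whose entries realize the
    ultrafilter over the earlier rows, so that each path through the rows is again a Morley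
    sequence, with the type of the original family. A second Morley sequence, in lexicographic order
    and following nonprincipal limits of the rows, makes the rows mutually indiscernible. Such
    limits also take the place of Ramsey's theorem. They reverse the order of a sequence, hence rows
    are reversed beforehand. Tuples may be infinite, and may even enumerate the whole universe
    ([M -> M]), because a definable set depends on finitely many coordinates only. *)

Lemma in_filter T (p : pred T) (s : seq T) x :
  List.In x [seq y <- s | p y] <-> List.In x s /\ p x.
Proof.
elim: s => [|y s IH] /=; first by split=> // -[].
case: ifP => py /=; rewrite IH; split.
- by move=> [<-|[? ?]]; split; auto.
- by move=> [[->|?] ?]; [left|right].
- by move=> [? ?]; split; auto.
- by move=> [[E|?] px] //; rewrite -E py in px.
Qed.

Section Syntax.
Context {L : language} {M : structure L}.

Lemma eval_trename V W (f : V -> W) (t : term L V) (v : W -> M) :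
  eval (trename f t) v = eval t (v \o f).
Proof.
by elim: t => [//|g ts IH] /=; congr (fint _); apply: funext => i; apply: IH.
Qed.

Lemma sat_frename V (phi : formula L V) : forall W (f : V -> W) (v : W -> M),
  sat (frename f phi) v <-> sat phi (v \o f).
Proof.
elim: V / phi => [V s t|V r ts|V p IH|V p IHp q IHq|V p IH] W f v /=.
- by rewrite !eval_trename.
- suff -> : (fun i => eval (trename f (ts i)) v) = (fun i => eval (ts i) (v \o f)) by [].
  by apply: funext => i; rewrite eval_trename.
- by rewrite IH.
- by rewrite IHp IHq.
- have E d : (fun o : option W => if o is Some x then v x else d) \o omap f =
      (fun o => if o is Some x then v (f x) else d) by apply: funext => -[].
  by split=> -[d]; rewrite ?IH -?E => Hd; exists d; rewrite ?IH -?E.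
Qed.

Lemma eval_free V (t : term L V) (P : set V) (v w : V -> M) :
  tfree_in t P -> (forall x, P x -> v x = w x) -> eval t v = eval t w.
Proof.
move=> Pt vw; elim: t Pt => [x|g ts IH] /= Pt; first exact: vw.
by congr (fint _); apply: funext => i; apply: IH.
Qed.

Lemma sat_free V (phi : formula L V) : forall (P : set V) (v w : V -> M),
  free_in phi P -> (forall x, P x -> v x = w x) -> sat phi v <-> sat phi w.
Proof.
elim: V / phi => [V s t|V r ts|V p IH|V p IHp q IHq|V p IH] P v w /=.
- by move=> [Ps Pt] vw; rewrite (eval_free Ps vw) (eval_free Pt vw).
- move=> Pts vw; suff -> : (fun i => eval (ts i) v) = (fun i => eval (ts i) w) by [].
  by apply: funext => i; apply: eval_free (Pts i) vw.
- by move=> Pp vw; rewrite (IH _ _ _ Pp vw).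
- by move=> [Pp Pq] vw; rewrite (IHp _ _ _ Pp vw) (IHq _ _ _ Pq vw).
- move=> Pp vw; split=> -[d Hd]; exists d; move: Hd;
    apply: (proj1 (IH _ _ _ Pp _)) => -[x|] // /vw //.
Qed.

Lemma tfree_in_sub V (t : term L V) (P Q : set V) :
  P `<=` Q -> tfree_in t P -> tfree_in t Q.
Proof.
by move=> PQ; elim: t => [x|g ts IH] /=; [exact: PQ|move=> H i; apply: IH].
Qed.

Lemma free_in_sub V (phi : formula L V) : forall P Q : set V,
  P `<=` Q -> free_in phi P -> free_in phi Q.
Proof.
elim: V / phi => [V s t|V r ts|V p IH|V p IHp q IHq|V p IH] P Q PQ /=.
- by move=> [? ?]; split; apply: tfree_in_sub PQ _.
- by move=> H i; apply: tfree_in_sub PQ _.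
- exact: IH.
- by move=> [? ?]; split; [apply: IHp PQ _|apply: IHq PQ _].
- by apply: IH => -[x|] //=; apply: PQ.
Qed.

Lemma tfree_in_rename V W (f : V -> W) (t : term L V) (P : set W) :
  tfree_in (trename f t) P <-> tfree_in t (P \o f).
Proof.
by elim: t => [x|g ts IH] //=; split=> H i; apply/IH.
Qed.

Lemma free_in_rename V (phi : formula L V) : forall W (f : V -> W) (P : set W),
  free_in (frename f phi) P <-> free_in phi (P \o f).
Proof.
elim: V / phi => [V s t|V r ts|V p IH|V p IHp q IHq|V p IH] W f P /=.
- by rewrite !tfree_in_rename.
- by split=> H i; apply/tfree_in_rename.
- exact: IH.
- by rewrite IHp IHq.
- by rewrite IH; split; apply: free_in_sub => -[].
Qed.

Lemma in_flatten_enum V n (F : 'I_n -> seq V) i x :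
  List.In x (F i) -> List.In x (flatten [seq F i | i <- enum 'I_n]).
Proof.
move=> xF; have : i \in enum 'I_n by rewrite mem_enum.
elim: (enum 'I_n) => //= j s IH; rewrite inE => /orP[/eqP <-|/IH H].
  by apply/List.in_app_iff; left.
by apply/List.in_app_iff; right.
Qed.

Lemma tfree_in_finite V (t : term L V) :
  exists F : seq V, tfree_in t (fun x => List.In x F).
Proof.
elim: t => [x|g ts IH]; first by exists [:: x]; left.
have [F HF] := choice IH.
exists (flatten [seq F i | i <- enum 'I_(far g)]) => i /=.
by apply: tfree_in_sub (HF i) => x; apply: in_flatten_enum.
Qed.

Lemma free_in_finite V (phi : formula L V) :
  exists F : seq V, free_in phi (fun x => List.In x F).
Proof.
elim: V / phi => [V s t|V r ts|V p IH|V p [F HF] q [G HG]|V p [F HF]] //=.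
- have [F HF] := tfree_in_finite s; have [G HG] := tfree_in_finite t.
  exists (F ++ G); split; [apply: tfree_in_sub HF|apply: tfree_in_sub HG] => x xF.
    by apply/List.in_app_iff; left.
  by apply/List.in_app_iff; right.
- have [F HF] := choice (fun i => tfree_in_finite (ts i)).
  exists (flatten [seq F i | i <- enum 'I_(rar r)]) => i /=.
  by apply: tfree_in_sub (HF i) => x; apply: in_flatten_enum.
- exists (F ++ G); split; [apply: free_in_sub HF|apply: free_in_sub HG] => x xF.
    by apply/List.in_app_iff; left.
  by apply/List.in_app_iff; right.
- exists (flatten [seq (if o is Some x then [:: x] else [::]) | o <- F]).
  apply: free_in_sub HF => -[x|] //=; elim: F => //= o F IH [->|/IH H].
    by left.
  by apply/List.in_app_iff; right.
Qed.

Lemma trename_free V (t : term L V) (P : set V) (h : V -> V) :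
  tfree_in t P -> (forall x, P x -> h x = x) -> trename h t = t.
Proof.
move=> Pt hP; elim: t Pt => [x /hP /= -> //|g ts IH] /= Pt.
by congr App; apply: funext => i; apply: IH.
Qed.

Lemma frename_free V (phi : formula L V) : forall (P : set V) (h : V -> V),
  free_in phi P -> (forall x, P x -> h x = x) -> frename h phi = phi.
Proof.
elim: V / phi => [V s t|V r ts|V p IH|V p IHp q IHq|V p IH] P h /=.
- by move=> [Ps Pt] hP; rewrite (trename_free Ps hP) (trename_free Pt hP).
- by move=> Pt hP; congr Rel; apply: funext => i; apply: trename_free (Pt i) hP.
- by move=> Pp hP; rewrite (IH _ _ Pp hP).
- by move=> [Pp Pq] hP; rewrite (IHp _ _ Pp hP) (IHq _ _ Pq hP).
- by move=> Pp hP; congr Ex; apply: IH Pp _ => -[x /hP hx|//] /=; rewrite hx.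
Qed.

Lemma trename_comp U V W (f : U -> V) (g : V -> W) (t : term L U) :
  trename g (trename f t) = trename (g \o f) t.
Proof.
by elim: t => [//|h ts IH] /=; congr App; apply: funext => i; apply: IH.
Qed.

Lemma frename_comp U (phi : formula L U) : forall V W (f : U -> V) (g : V -> W),
  frename g (frename f phi) = frename (g \o f) phi.
Proof.
elim: U / phi => [U s t|U r ts|U p IH|U p IHp q IHq|U p IH] V W f g /=.
- by rewrite !trename_comp.
- by congr Rel; apply: funext => i; apply: trename_comp.
- by rewrite IH.
- by rewrite IHp IHq.
- by rewrite IH; congr (Ex (frename _ p)); apply: funext => -[].
Qed.

Lemma aut_eval (g : M -> M) : automorphism g ->
  forall V (t : term L V) v, g (eval t v) = eval t (g \o v).
Proof.
move=> [_ gf _] V t v; elim: t => [//|h ts IH] /=.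
by rewrite gf; congr (fint _); apply: funext => i; apply: IH.
Qed.

Lemma aut_sat (g : M -> M) : automorphism g ->
  forall V (phi : formula L V) v, sat phi (g \o v) <-> sat phi v.
Proof.
move=> ag V phi; have [[h hg gh] _ gr] := ag.
elim: V / phi => [V s t|V r ts|V p IH|V p IHp q IHq|V p IH] v /=.
- rewrite -!(aut_eval ag); split=> [|->//].
  exact: (can_inj hg).
- rewrite [rint (fun i => eval _ v)]gr.
  suff -> : (fun i => eval (ts i) (g \o v)) = (fun i => g (eval (ts i) v)) by [].
  by apply: funext => i; rewrite (aut_eval ag).
- by rewrite IH.
- by rewrite IHp IHq.
- have E d : g \o (fun o : option V => if o is Some x then v x else d) =
      (fun o => if o is Some x then g (v x) else g d) by apply: funext => -[].
  split=> -[d Hd]; last by exists (g d); rewrite -E IH.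
  by exists (h d); rewrite -IH E gh.
Qed.

End Syntax.

(** * Closure properties of definable sets of valuations *)

Section Definable.
Context {L : language} {M : structure L}.
Implicit Types (B : set M).

Definition def B V (S : set (V -> M)) :=
  exists2 psi : pformula M V, over B psi & forall v, S v <-> holds psi v.

Lemma def_ext B V (S S' : set (V -> M)) :
  (forall v, S v <-> S' v) -> def B S -> def B S'.
Proof. by move=> SS' [psi o H]; exists psi => // v; rewrite -SS'. Qed.

Lemma def_mono B B' V (S : set (V -> M)) : B `<=` B' -> def B S -> def B' S.
Proof.
move=> BB [psi o H]; exists psi => //; apply: free_in_sub o => -[x|m] //=.
exact: BB.
Qed.

Lemma defN B V (S : set (V -> M)) : def B S -> def B (fun v => ~ S v).
Proof. by move=> [psi o H]; exists (Neg psi) => // v; rewrite H. Qed.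

Lemma defI B V (S S' : set (V -> M)) :
  def B S -> def B S' -> def B (fun v => S v /\ S' v).
Proof.
by move=> [psi o H] [psi' o' H']; exists (And psi psi') => // v; rewrite H H'.
Qed.

Lemma defU B V (S S' : set (V -> M)) :
  def B S -> def B S' -> def B (fun v => S v \/ S' v).
Proof.
move=> dS dS'; apply: def_ext (defN (defI (defN dS) (defN dS'))) => v; split.
  by move=> /not_andP[/contrapT|/contrapT]; [left|right].
by move=> [Sv [/(_ Sv)]|Sv [_ /(_ Sv)]].
Qed.

Lemma def_ex1 B V (S : set (option V -> M)) : def B S ->
  def B (fun v => exists d, S (fun o => if o is Some x then v x else d)).
Proof.
move=> [psi o H].
pose h (s : option V + M) : option (V + M) :=
  match s with inl (Some x) => Some (inl x) | inl None => None
             | inr m => Some (inr m) end.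
exists (Ex (frename h psi)).
  by rewrite /over /= free_in_rename; apply: free_in_sub o => -[[x|]|m].
move=> v; have E d : (fun o : option (V + M) => if o is Some x then cat_tup v id x else d) \o h =
    cat_tup (fun o => if o is Some x then v x else d) id by apply: funext => -[[x|]|m].
rewrite /holds /=; split=> -[d Hd]; exists d.
  by apply/sat_frename; rewrite E; apply/H.
by apply/H; rewrite /holds -E; apply/sat_frename.
Qed.

Lemma defT B V : def B (fun _ : V -> M => True).
Proof.
have d1 : def B (fun o : option V -> M => o None = o None).
  by exists (Eq (Var L (inl None)) (Var L (inl None))).
by apply: def_ext (def_ex1 d1) => v; split=> // _; case: (carrier_nonempty M) => d; exists d.
Qed.

Lemma def_subst B V W (S : set (V -> M)) (f : V -> W + M) :
  (forall x m, f x = inr m -> B m) -> def B S ->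
  def B (fun w : W -> M => S (cat_tup w id \o f)).
Proof.
move=> fB [psi o H]; exists (frename (cat_tup f inr) psi).
  rewrite /over free_in_rename; apply: free_in_sub o => -[x|m] //= _.
  by case E: (f x) => [//|m]; exact: fB E.
move=> w; have E : cat_tup (cat_tup w id \o f) id = cat_tup w id \o cat_tup f inr.
  by apply: funext => -[].
by rewrite H /holds sat_frename E.
Qed.

Lemma def_comp B V W (S : set (V -> M)) (f : V -> W) :
  def B S -> def B (fun w : W -> M => S (w \o f)).
Proof.
move=> dS; apply: def_ext (@def_subst B V W S (inl \o f) _ dS) => //.
Qed.

Lemma def_exall B V (n : nat) (T : 'I_n -> set (V -> M)) :
  (forall i, def B (T i)) -> def B (fun v => forall i, T i v).
Proof.
elim: n T => [|n IH] T dT.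
  by apply: def_ext (defT B V) => v; split=> // _ [].
apply: def_ext (defI (dT ord0) (IH (fun i => T (lift ord0 i)) (fun i => dT _))) => v.
split=> [[H0 H1] i|H]; last by split=> *; apply: H.
by case: (unliftP ord0 i) => [j ->|->].
Qed.

Lemma def_allseq B V (I : Type) (s : seq I) (T : I -> set (V -> M)) :
  (forall i, def B (T i)) -> def B (fun v => forall i, List.In i s -> T i v).
Proof.
move=> dT; elim: s => [|i s IH].
  by apply: def_ext (defT B V) => v; split=> // _ [].
apply: def_ext (defI (dT i) IH) => v; split=> [[H0 H1] j [<-//|]|H]; first exact: H1.
by split=> [|j js]; apply: H; [left|right].
Qed.

(** Finite support plays the part of the finiteness of formulas in the compactness arguments, while
    the index types of tuples stay arbitrary. *)
Definition supp V (F : seq V) (S : set (V -> M)) :=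
  forall v w, (forall x, List.In x F -> v x = w x) -> S v <-> S w.

Lemma def_supp B V (S : set (V -> M)) : def B S -> exists F, supp F S.
Proof.
move=> [psi _ H]; have [F HF] := free_in_finite psi.
exists (flatten [seq (if o is inl x then [:: x] else [::]) | o <- F]).
move=> v w vw; rewrite !H; apply: sat_free HF _ => -[x|m] //= xF; apply: vw.
elim: F xF => //= o F IH [->|/IH H']; first by left.
by apply/List.in_app_iff; right.
Qed.

Definition upd V (v : V -> M) (x : V) (d : M) : V -> M :=
  fun y => if `[< y = x >] then d else v y.

Lemma def_ex_upd B V (S : set (V -> M)) (x : V) : def B S ->
  def B (fun v => exists d, S (upd v x d)).
Proof.
move=> dS; pose f (y : V) := if `[< y = x >] then None else Some y.
apply: def_ext (def_ex1 (def_comp f dS)) => v.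
suff E d : (fun o => if o is Some y then v y else d) \o f = upd v x d.
  by split=> -[d]; rewrite ?E => ?; exists d; rewrite ?E.
by apply: funext => y; rewrite /f /upd /=; case: asboolP.
Qed.

Lemma def_ex_seq B V (S : set (V -> M)) (s : seq V) : def B S ->
  def B (fun v => exists2 w, (forall x, ~ List.In x s -> w x = v x) & S w).
Proof.
elim: s S => [|x s IH] S dS.
  apply: def_ext dS => v; split=> [Sv|[w wv]]; first by exists v.
  by suff -> : w = v by []; apply: funext => x; apply: wv.
apply: def_ext (IH _ (def_ex_upd x dS)) => v; split=> [[w wv [d Sd]]|[w wv Sw]].
- exists (upd w x d) => // y /= /not_orP[yx ys].
  by rewrite /upd; case: asboolP => [/esym/yx|?] //; apply: wv.
- exists (upd w x (v x)).
    move=> y ys; rewrite /upd; case: asboolP => [->//|yx]; apply: wv.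
    by move=> [/esym|].
  exists (w x); suff -> : upd (upd w x (v x)) x (w x) = w by [].
  by apply: funext => y; rewrite /upd; case: asboolP => [->|].
Qed.

(** The tuple [x] may be infinite: only its coordinates in the support have to be quantified. *)
Lemma def_ex B X V (S : set (X + V -> M)) : def B S ->
  def B (fun v : V -> M => exists x : X -> M, S (cat_tup x v)).
Proof.
move=> dS; have [F HF] := def_supp dS.
pose isl (s : X + V) := if s is inl _ then true else false.
pose FX := [seq s <- F | isl s].
have inFX s : List.In s FX <-> List.In s F /\ isl s.
  exact: in_filter.
have d1 := def_ex_seq FX dS.
(* Coordinates of [x] in the support are requantified by [d1] and the others do not matter, so all
   of them may share the single variable [None]. *)
pose f (s : X + V) : option V := if s is inr y then Some y else None.
apply: def_ext (def_ex1 (def_comp f d1)) => v; split=> [[d [w wv Sw]]|[x Sx]].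
- exists (w \o inl).
  have /HF[H _] : forall s, List.In s F -> w s = cat_tup (w \o inl) v s.
    by case=> [x|y] //= yF; rewrite (wv (inr y)) // => /inFX [_ H]; exact: notF H.
  exact: H.
- case: (carrier_nonempty M) => d; exists d.
  pose w s := if `[< List.In s FX >] then cat_tup x v s else if s is inr y then v y else d.
  exists w; first by move=> s sF; rewrite /w; case: asboolP => // _; case: s sF.
  have /HF[H _] : forall s, List.In s F -> cat_tup x v s = w s.
    move=> s sF; rewrite /w; case: asboolP => // sN.
    by case: s sF sN => //= x' xF []; apply/inFX.
  exact: H.
Qed.

End Definable.

(** * Cardinals *)

Definition tle (X Y : Type) := exists f : X -> Y, injective f.

Lemma tle_refl X : tle X X. Proof. by exists id. Qed.

Lemma tle_trans Y X Z : tle X Y -> tle Y Z -> tle X Z.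
Proof. by move=> [f fi] [g gi]; exists (g \o f); apply: inj_comp. Qed.

Lemma card_le_tle X Y (A : set X) (B : set Y) :
  (A #<= B)%card <-> tle {x | A x} {y | B y}.
Proof.
have toA T (C : set T) (x : C) : C (val x) by have := valP x; rewrite inE.
split=> [/card_leP/injfunPex[f _ fi]|[f fi]].
- exists (fun x => exist _ _ (toA _ _ (f (SigSub (mem_set (proj2_sig x)))))).
  move=> [x Ax] [y Ay] [/val_inj/fi]; rewrite !in_setT => /(_ isT isT) [xy].
  by case: _ / xy Ay => Ay; congr exist; apply: Prop_irrelevance.
- apply/card_leP/injfunPex.
  exists (fun x : A => SigSub (mem_set (proj2_sig (f (exist _ _ (toA _ _ x))))) : B) => //.
  move=> x y _ _ [] H; apply: val_inj.
  have /fi [] // : f (exist _ _ (toA _ _ x)) = f (exist _ _ (toA _ _ y)).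
  move: H; case: (f (exist _ _ (toA _ _ x))) => u Bu; case: (f _) => v Bv /= uv.
  by case: _ / uv Bv => Bv; congr exist; apply: Prop_irrelevance.
Qed.

Lemma card_leT_tle X Y : ([set: X] #<= [set: Y])%card <-> tle X Y.
Proof.
rewrite card_le_tle; split=> -[f fi].
- exists (fun x => proj1_sig (f (exist _ x I))) => x y H.
  have /fi [] // : f (exist _ x I) = f (exist _ y I).
  by case: (f (exist _ x I)) H => u []; case: (f _) => v [] /= ->.
- exists (fun x => exist _ (f (proj1_sig x)) I) => -[x []] [y []] [/fi -> //].
Qed.

(** Zorn's lemma for graphs of partial injections: a maximal one is total on one of the two
    sides. *)
Lemma tle_total X Y : tle X Y \/ tle Y X.
Proof.
pose P (G : set (X * Y)) := forall p q, G p -> G q -> (p.1 = q.1 <-> p.2 = q.2).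
have [|G [PG Gmax]] := @Zorn_bigcup _ P.
  move=> F FP Ftot p q [G1 FG1 Gp] [G2 FG2 Gq].
  by case: (Ftot _ _ FG1 FG2) => H; [apply: (FP _ FG2) => //|apply: (FP _ FG1) => //]; apply: H.
have [/choice[f Hf]|/existsNP[x nx]] := pselect (forall x, exists y, G (x, y)).
  by left; exists f => x y E; apply/(PG _ _ (Hf x) (Hf y)).
have [/choice[f Hf]|/existsNP[y ny]] := pselect (forall y, exists x, G (x, y)).
  by right; exists f => a b E; apply/(PG _ _ (Hf a) (Hf b)).
have [] := Gmax (G `|` [set (x, y)]).
  split; first by move=> p; left.
  by move=> H; apply: nx; exists y; apply: H; right.
move=> p q [Gp|->] [Gq|->] //=; first exact: PG.
- by split=> E; [case: nx; exists p.2|case: ny; exists p.1]; rewrite -E -surjective_pairing.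
- by split=> E; [case: nx; exists q.2|case: ny; exists q.1]; rewrite E -surjective_pairing.
Qed.

Section Small.
Variable K : Type.
Hypothesis Klim : strong_limit K.
Hypothesis natK : ~ tle K nat.

(** By comparability of cardinals this is the same as having fewer elements than [K]; the negative
    form passes to subtypes at once. *)
Definition sm X := ~ tle K X.

Lemma sm_le Y X : tle X Y -> sm Y -> sm X.
Proof. by move=> XY sY KX; apply: sY; apply: tle_trans KX XY. Qed.

Lemma smallE X (A : set X) : small K A <-> sm {x | A x}.
Proof.
have TK : tle {x : K | [set: K] x} K.
  by exists (@proj1_sig _ _) => -[x []] [y []] /= ->.
have KT : tle K {x : K | [set: K] x}.
  by exists (fun x => exist _ x I) => x y [].
rewrite /small /card_lt !card_le_tle; split=> [[_ H] KA|sA].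
  by apply: H; apply: tle_trans TK KA.
split; last by move=> H; apply: sA; apply: tle_trans KT H.
by case: (tle_total {x | A x} K) => // /tle_trans; apply.
Qed.

Lemma smallT X : small K [set: X] <-> sm X.
Proof.
rewrite smallE; split; apply: sm_le.
  by exists (fun x => exist _ x I) => x y [].
by exists (@proj1_sig _ _) => -[x []] [y []] /= ->.
Qed.

Lemma sm_set X : sm X -> sm (set X).
Proof. by rewrite -smallT => /Klim; rewrite -/(small K _) smallT. Qed.

Lemma sm_sum X Y : sm X -> sm Y -> sm (X + Y).
Proof.
wlog: X Y / tle X Y => [H sX sY|[f fi] _ sY].
  have [XY|YX] := tle_total X Y; first exact: H.
  apply: (@sm_le (Y + X)); last exact: H.
  exists (fun s => match s with inl x => inr x | inr y => inl y end).
  by move=> [x|x] [y|y] // [->].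
apply: sm_le (sm_set (sm_set sY)).
(* Two disjoint copies of [Y] inside the double power set, told apart by the element [set0]. *)
exists (fun s => match s with inl x => [set [set f x]] | inr y => [set [set y]; set0] end).
have nE (y : Y) : [set y] <> set0 by move=> /seteqP[/(_ y erefl)].
move=> [x|x] [y|y] E.
- have : [set [set f y]] [set f x] by rewrite -E.
  by move=> /seteqP[/(_ _ erefl) /fi ->].
- have : [set [set f x]] set0 by rewrite E; right.
  by move=> /esym /nE.
- have : [set [set f y]] set0 by rewrite -E; right.
  by move=> /esym /nE.
- have : [set [set y]; set0] [set x] by rewrite -E; left.
  by move=> [/seteqP[/(_ _ erefl) -> //]|/nE].
Qed.

Lemma sm_prod X Y : sm X -> sm Y -> sm (X * Y).
Proof.
move=> sX sY; apply: sm_le (sm_set (sm_sum sX sY)).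
exists (fun p => [set s | match s with inl x => x = p.1 | inr y => y = p.2 end]).
move=> [x y] [x' y'] E; congr pair.
  by have := congr1 (fun S => S (inl x)) E => /= <-.
by have := congr1 (fun S => S (inr y)) E => /= <-.
Qed.

Lemma sm_fun X Y : sm X -> sm Y -> sm (X -> Y).
Proof.
move=> sX sY; apply: sm_le (sm_set (sm_prod sX sY)).
exists (fun f => [set p | p.2 = f p.1]) => f g E; apply: funext => x.
by have := congr1 (fun S => S (x, f x)) E => /= <-.
Qed.

Lemma sm_nat : sm nat. Proof. exact: natK. Qed.

Lemma sm_ord n : sm 'I_n.
Proof. by apply: sm_le sm_nat; exists val; apply: val_inj. Qed.

Lemma tle_surj X Y (f : X -> Y) : (forall y, exists x, f x = y) -> tle Y X.
Proof.
by move=> /choice[g gK]; exists g => a b E; rewrite -(gK a) -(gK b) E.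
Qed.

Lemma sm_cover X Y (A : set X) (f : Y -> X) :
  (forall x, A x -> exists y, f y = x) -> sm Y -> small K A.
Proof.
move=> fA sY; rewrite smallE; apply: sm_le sY.
have /choice[g gK] : forall x : {x | A x}, exists y, f y = proj1_sig x.
  by move=> [x Ax]; apply: fA.
exists g => -[a Aa] [b Ab] E; have := gK (exist _ a Aa); rewrite E gK /= => ab.
by subst b; congr exist; apply: Prop_irrelevance.
Qed.

Lemma smallU X (A B : set X) : small K A -> small K B -> small K (A `|` B).
Proof.
rewrite !(smallE A) !(smallE B) => sA sB.
apply: (@sm_cover _ _ _ (fun s : {x | A x} + {x | B x} => match s with inl x => proj1_sig x | inr x => proj1_sig x end)); last exact: sm_sum.
by move=> x [Ax|Bx]; [exists (inl (exist _ x Ax))|exists (inr (exist _ x Bx))].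
Qed.

Lemma small_range X Y (f : X -> Y) : sm X -> small K (range f).
Proof. by apply: sm_cover (f) _ => y [x _ <-]; exists x. Qed.

(** Since only finitely many variables occur, every formula over [V] is a formula over [nat] renamed
    by some function [nat -> V]. *)
Lemma sm_formula (L : language) V (v0 : V) : sm (formula L nat) -> sm V -> sm (formula L V).
Proof.
move=> sF sV; apply: sm_le (sm_prod sF (sm_fun sm_nat sV)).
apply: (@tle_surj _ _ (fun p => frename p.2 p.1)) => phi.
have [F HF] := free_in_finite phi.
have /choice[g gK] : forall x : V, exists k, List.In x F -> nth v0 F k = x.
  move=> x; have [xF|nF] := pselect (List.In x F); last by exists 0 => /nF.
  suff [k Hk] : exists k, nth v0 F k = x by exists k.
  elim: (F) xF => //= y s IH [->|/IH[k Hk]]; first by exists 0.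
  by exists k.+1.
exists (frename g phi, nth v0 F) => /=; rewrite frename_comp.
by apply: frename_free HF _ => x; apply: gK.
Qed.

End Small.

(** * Ultrafilters and types *)

Section Ultra.

Definition ultra T (W : set (set T)) :=
  [/\ forall A B, W A -> W B -> W (fun x => A x /\ B x),
      forall A B : set T, (forall x, A x -> B x) -> W A -> W B,
      ~ W (fun _ => False) & forall A, W A \/ W (fun x => ~ A x)].

Lemma ultra_exists T (F : set (set T)) :
  (exists A, F A) ->
  (forall A B, F A -> F B -> exists2 C, F C & forall x, C x -> A x /\ B x) ->
  (forall A, F A -> exists x, A x) ->
  exists W, ultra W /\ F `<=` W.
Proof.
move=> [A0 FA0] FI F0; pose G := [set B : set T | exists2 A, F A & A `<=` B].
have PG : ProperFilter G.
  split; first by move=> [A /F0[x Ax] /(_ x Ax)].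
  split; first by exists A0.
  - move=> A B [A1 FA1 A1A] [B1 FB1 B1B]; have [C FC CAB] := FI _ _ FA1 FB1.
    by exists C => // x /CAB[/A1A ? /B1B ?].
  - by move=> A B AB [C FC CA]; exists C => //; apply: subset_trans AB.
have [W [UW GW]] := ultraFilterLemma PG.
exists W; split; last by move=> A FA; apply: GW; exists A.
split.
- by move=> A B WA WB; apply: (@filterI _ W _ A B).
- by move=> A B AB; apply: filterS.
- exact: filter_not_empty.
- by move=> A; case: (in_ultra_setVsetC A UW); [left|right].
Qed.

Variables (T : Type) (W : set (set T)).
Hypothesis uW : ultra W.

Lemma ultraI A B : W (fun x => A x /\ B x) <-> W A /\ W B.
Proof.
have [WI WS _ _] := uW; split=> [H|[? ?]]; last exact: WI.
by split; apply: WS H => x [].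
Qed.

Lemma ultraS (A B : set T) : (forall x, A x -> B x) -> W A -> W B.
Proof. by have [_ WS _ _] := uW; apply: WS. Qed.

Lemma ultraN A : W (fun x => ~ A x) <-> ~ W A.
Proof.
have [WI WS W0 WN] := uW; split=> [WNA WA|nWA].
  by apply: W0; apply: WS (WI _ _ WA WNA) => x [? []].
by case: (WN A).
Qed.

Lemma ultra_ext (A B : set T) : (forall x, A x <-> B x) -> W A <-> W B.
Proof. by move=> AB; split; apply: ultraS => x /AB. Qed.

Lemma ultra_ex A : W A -> exists x, A x.
Proof.
have [_ WS W0 _] := uW; move=> WA; apply: contrapT => /forallNP nA.
by apply: W0; apply: WS WA => x /nA.
Qed.

Lemma ultraT (A : set T) : (forall x, A x) -> W A.
Proof.
have [_ WS _ WN] := uW; move=> AT; case: (WN A) => // /ultra_ex[x []]; exact: AT.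
Qed.

Lemma ultraI2 (A B C : set T) : W A -> W B -> (forall x, A x -> B x -> C x) -> W C.
Proof.
move=> WA WB H; apply: (@ultraS (fun x => A x /\ B x)); first by move=> x []; apply: H.
by apply/ultraI.
Qed.

Lemma ultra_ord n (A : 'I_n -> set T) : (forall i, W (A i)) -> W (fun x => forall i, A i x).
Proof.
elim: n A => [|n IH] A WA; first by apply: ultraT => x [].
apply: ultraI2 (WA ord0) (IH (fun i => A (lift ord0 i)) (fun i => WA _)) _ => x H0 H1 i.
by case: (unliftP ord0 i) => [j ->|->].
Qed.

Definition push U (f : T -> U) : set (set U) := fun A => W (fun x => A (f x)).

Lemma ultra_push U (f : T -> U) : ultra (push f).
Proof.
split=> [A B WA WB|A B AB|H|A]; rewrite /push.
- by apply/ultraI.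
- by apply: ultraS => x; apply: AB.
- by case: (ultra_ex H).
- by have [_ _ _ WN] := uW; apply: WN.
Qed.

End Ultra.

(** * Equality of types, automorphisms over a set, normal forms of formulas *)

Section Types.
Context {L : language} {M : structure L}.
Implicit Types (B : set M).

Definition teq B V (v w : V -> M) := forall S, def B S -> S v <-> S w.

Lemma teq_sym B V (v w : V -> M) : teq B v w -> teq B w v.
Proof. by move=> vw S dS; apply: iff_sym (vw S dS). Qed.

Lemma teq_trans B V (v w u : V -> M) : teq B v w -> teq B w u -> teq B v u.
Proof. by move=> vw wu S dS; apply: iff_trans (vw _ dS) (wu _ dS). Qed.

Lemma teq_imp B V (v w : V -> M) : (forall S, def B S -> S v -> S w) -> teq B v w.
Proof.
move=> H S dS; split; first exact: H.
by move=> Sw; apply: contrapT => /(H _ (defN dS)).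
Qed.

Lemma teq_comp B V W (v w : V -> M) (f : W -> V) : teq B v w -> teq B (v \o f) (w \o f).
Proof. by move=> vw S dS; apply: (vw _ (def_comp f dS)). Qed.

Lemma teq_mono B B' V (v w : V -> M) : B `<=` B' -> teq B' v w -> teq B v w.
Proof. by move=> BB vw S /(def_mono BB); apply: vw. Qed.

Lemma tpE B V (v w : V -> M) : tp B v = tp B w <-> teq B v w.
Proof.
split=> [E S [psi o H]|vw].
  have := congr1 (fun p => p psi) E; rewrite /tp /= => E'.
  by rewrite !H; split=> h; [have : over B psi /\ holds psi v by []; rewrite E'|
    have : over B psi /\ holds psi w by []; rewrite -E'] => -[].
apply/seteqP; split=> psi [o h]; split=> //.
  by apply/(vw (holds psi)); first exists psi.
by apply/(vw (holds psi)); first exists psi.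
Qed.

Definition autB B (g : M -> M) := automorphism g /\ forall x, B x -> g x = x.

Lemma def_aut B V (S : set (V -> M)) g v : autB B g -> def B S -> S (g \o v) <-> S v.
Proof.
move=> [ag gB] [psi o H]; rewrite !H /holds -(aut_sat ag psi (cat_tup v id)).
by apply: sat_free o _ => -[x|m] //= /gB ->.
Qed.

Lemma autB_teq B V (v : V -> M) g : autB B g -> teq B (g \o v) v.
Proof. by move=> ag S dS; apply: (def_aut v ag dS). Qed.

Lemma autB_id B : autB B id.
Proof. by split=> //; split=> //; exists id. Qed.

Lemma autB_comp B g h : autB B g -> autB B h -> autB B (g \o h).
Proof.
move=> [[bg fg rg] gB] [[bh fh rh] hB]; split; last by move=> x Bx /=; rewrite hB // gB.
split; first exact: bij_comp.
  by move=> f v /=; rewrite fh fg.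
by move=> r v; rewrite rh rg.
Qed.

Lemma autB_inv B g : autB B g -> exists h, [/\ autB B h, cancel g h & cancel h g].
Proof.
move=> [[[h gh hg] fg rg] gB]; exists h; split=> //; split.
  split; first by exists g.
    by move=> f v; apply: (can_inj gh); rewrite hg fg; congr (fint _); apply: funext => i; rewrite hg.
  move=> r v; rewrite [X in _ <-> X]rg.
  by have -> : (fun i => g (h (v i))) = v by apply: funext => i; rewrite hg.
by move=> x Bx; rewrite -{1}(gB x Bx) gh.
Qed.

Lemma autB_invs I B (g : I -> M -> M) : (forall i, autB B (g i)) ->
  exists h, forall i, [/\ autB B (h i), cancel (g i) (h i) & cancel (h i) (g i)].
Proof. by move=> ag; have /choice[h hP] := fun i => autB_inv (ag i); exists h. Qed.

Lemma holds_inst X Y (phi : formula L (X + Y)) (c : Y -> M) a :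
  holds (inst phi c) a <-> sat phi (cat_tup a c).
Proof.
have E : cat_tup a id \o
  (fun s => match s with inl x => inl x | inr y => inr (c y) end) = cat_tup a c.
  by apply: funext => -[].
by rewrite /holds /inst sat_frename E.
Qed.

Lemma free_inT V (phi : formula L V) : forall P : set V, (forall x, P x) -> free_in phi P.
Proof.
have tT U (t : term L U) (P : set U) : (forall x, P x) -> tfree_in t P.
  by move=> PT; elim: t => //=.
elim: V / phi => [V s t|V r ts|V p IH|V p IHp q IHq|V p IH] P PT /=.
- by split; apply: tT.
- by move=> i; apply: tT.
- exact: IH.
- by split; [apply: IHp|apply: IHq].
- by apply: IH => -[].
Qed.

Lemma free_inI V (phi : formula L V) : forall P Q : set V,
  free_in phi P -> free_in phi Q -> free_in phi (fun x => P x /\ Q x).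
Proof.
have tI U (t : term L U) (P Q : set U) : tfree_in t P -> tfree_in t Q ->
    tfree_in t (fun x => P x /\ Q x).
  by elim: t => //= g ts IH ? ? i; apply: IH.
elim: V / phi => [V s t|V r ts|V p IH|V p IHp q IHq|V p IH] P Q /=.
- by move=> [? ?] [? ?]; split; apply: tI.
- by move=> ? ? i; apply: tI.
- exact: IH.
- by move=> [? ?] [? ?]; split; [apply: IHp|apply: IHq].
- by move=> Pp Qp; apply: free_in_sub (IH _ _ Pp Qp) => -[x|].
Qed.

Lemma def_sat V (phi : formula L V) : def set0 (fun v : V -> M => sat phi v).
Proof.
exists (frename inl phi); last by move=> v; rewrite /holds sat_frename.
by rewrite /over free_in_rename; apply: free_inT.
Qed.

Lemma def_eqp B V (x : V) m : B m -> def B (fun v : V -> M => v x = m).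
Proof. by move=> Bm; exists (Eq (Var L (inl x)) (Var L (inr m))). Qed.

Lemma def_split B X J (a : J -> M) (S : set (X -> M)) : def (B `|` range a) S ->
  exists2 E : set (X + J -> M), def B E & forall x, S x <-> E (cat_tup x a).
Proof.
move=> [psi o H].
have /choice[h hP] : forall m, exists s : (X + J) + M,
    (B m \/ range a m) -> (if s is inr b then B b else True) /\ forall x : X -> M, cat_tup (cat_tup x a) id s = m.
  move=> m; have [Bm|nB] := pselect (B m); first by exists (inr m).
  have [[j _ jm]|nr] := pselect (range a m); first by exists (inl (inr j)).
  by exists (inr m) => -[].
pose f (s : X + M) : (X + J) + M := match s with inl x => inl (inl x) | inr m => h m end.
exists (holds (frename f psi)).
  exists (frename f psi) => //.
  rewrite /over free_in_rename; apply: free_in_sub o => -[x|m] //= Bm.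
  by have [] := hP m Bm; case: (h m).
move=> x; rewrite H /holds sat_frename; apply: sat_free o _ => -[y|m] //= Bm.
by have [_ ->] := hP m Bm.
Qed.

Lemma def_unsplit B X J (a : J -> M) (E : set (X + J -> M)) : def B E ->
  def (B `|` range a) (fun x => E (cat_tup x a)).
Proof.
move=> dE.
pose f (s : X + J) : X + M := match s with inl x => inl x | inr j => inr (a j) end.
have fB x m : f x = inr m -> (B `|` range a) m.
  by case: x => // j [<-]; right; exists j.
have BB : B `<=` B `|` range a by move=> x; left.
apply: def_ext (def_subst fB (def_mono BB dE)) => v.
suff -> : cat_tup v id \o f = cat_tup v a by [].
by apply: funext => -[].
Qed.

(** Dividing and splitting are defined with finite parameter tuples, hence this reduction to ['I_m].
    The point [v0] heads the enumeration, so that an empty support is no special case. *)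
Lemma nf_right X V (v0 : V) (psi : formula L (X + V)) (P : set V) : P v0 ->
  free_in psi (fun s => if s is inr v then P v else True) ->
  exists m (phi : formula L (X + 'I_m)) (u : 'I_m -> V),
    (forall i, P (u i)) /\ psi = frename (cat_tup inl (inr \o u)) phi.
Proof.
move=> Pv0 Ppsi; have [F HF] := free_in_finite psi.
have FP := free_inI HF Ppsi.
pose pr (s : X + V) : {classic V} := if s is inr v then v else v0.
pose G : seq {classic V} := v0 :: map pr F.
pose g (s : X + V) : X + 'I_(size G) := match s with inl x => inl x
  | inr v => inr (inord (index (v : {classic V}) G)) end.
pose u (i : 'I_(size G)) : V := if `[< P (nth v0 G i) >] then nth v0 G i else v0.
exists (size G), (frename g psi), u; split.
  by move=> i; rewrite /u; case: asboolP.
rewrite frename_comp; apply/esym; apply: frename_free FP _ => -[x|v] //= [vF Pv].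
have vG : (v : {classic V}) \in G.
  rewrite inE; apply/orP; right.
  elim: F vF {HF G g u} => //= s F IH [->|/IH H]; rewrite inE ?eqxx //.
  by rewrite H orbT.
have iG : (index (v : {classic V}) G < size G) by rewrite index_mem.
have nG : nth (v0 : {classic V}) G (index (v : {classic V}) G) = v by apply: nth_index.
by congr inr; rewrite /u inordK // nG; case: asboolP.
Qed.

Lemma over_inst B X (psi : pformula M X) (m0 : M) : B m0 -> over B psi ->
  exists m (phi : formula L (X + 'I_m)) (b : 'I_m -> M),
    (forall i, B (b i)) /\ psi = inst phi b.
Proof.
move=> Bm0 o; have [m [phi [b [Bb E]]]] := nf_right Bm0 o.
by exists m, phi, b; split=> //; rewrite E.
Qed.

(** Duplicates are removed to make [f] injective, so that arbitrary values can be prescribed on the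
    selected variables. *)
Lemma nf_left X V (psi : formula L (X + V)) :
  exists n (f : 'I_n -> X) (phi : formula L ('I_n + V)), injective f /\
    psi = frename (cat_tup (inl \o f) inr) phi.
Proof.
have [F HF] := free_in_finite psi.
have [nX|/contrapT[x0]] := pselect (~ inhabited X).
  pose g (s : X + V) : 'I_0 + V := match s with inl x => False_rect _ (nX (inhabits x)) | inr v => inr v end.
  pose f (i : 'I_0) : X := match i with Ordinal _ lt => False_rect _ (notF lt) end.
  exists 0, f, (frename g psi); split; first by case.
  by rewrite frename_comp; apply/esym; apply: frename_free HF _ => -[x|v] // _; case: (nX (inhabits x)).
pose pr (s : X + V) : {classic X} := if s is inl x then x else x0.
pose G : seq {classic X} := @undup {classic X} (x0 :: map pr F).
have Gx0 : (x0 : {classic X}) \in G by rewrite mem_undup mem_head.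
have G0 : (0 < size G) by case: G Gx0.
pose g (s : X + V) : 'I_(size G) + V := match s with inr v => inr v
  | inl x => inl (insubd (Ordinal G0) (index (x : {classic X}) G)) end.
exists (size G), (fun i => nth x0 G i), (frename g psi); split.
  move=> i j E; apply: val_inj; apply/eqP.
  rewrite -(@nth_uniq _ (x0 : {classic X}) G i j (ltn_ord i) (ltn_ord j) (undup_uniq _)).
  exact/eqP.
rewrite frename_comp; apply/esym; apply: frename_free HF _ => -[x|v] //= xF.
have xG : (x : {classic X}) \in G.
  rewrite mem_undup inE; apply/orP; right.
  elim: F xF {G Gx0 G0 g} => //= s F IH [->|/IH H]; rewrite inE ?eqxx //.
  by rewrite H orbT.
have iG : (index (x : {classic X}) G < size G) by rewrite index_mem.
have nG : nth (x0 : {classic X}) G (index (x : {classic X}) G) = x by apply: nth_index.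
by congr inl; rewrite val_insubd iG nG.
Qed.

End Types.

(** * Automorphisms, saturation, elementary submodels *)

(** Dividing without formulas: the conjugates of [S] by the inverses of the [g i] are
    [k]-inconsistent. By homogeneity they stand for the instances at realizations of the parameter
    type. *)
Definition sdivk {L} {M : structure L} (B : set M) X k (S : set (X -> M)) :=
  exists g : nat -> M -> M, (forall i, autB B (g i)) /\
    forall s : 'I_k -> nat, injective s -> ~ exists x, forall t, S (g (s t) \o x).

Definition sdiv {L} {M : structure L} (B : set M) X (S : set (X -> M)) :=
  exists k, sdivk B k S.

Definition mon (L : language) (K : Type) (M : structure L) :=
  [/\ strong_limit K, sm K nat, sm K (formula L nat), saturated K M &
      strongly_homogeneous K M].

Section Monster.
Context {L : language} {K : Type} {M : structure L}.
Hypothesis hM : mon K M.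
Implicit Types (B N : set M).

(** Homogeneity over parameters, obtained by prefixing an enumeration of [B] to both tuples. *)
Lemma homog B J (u v : J -> M) : small K B -> sm K J -> teq B u v ->
  exists2 g, autB B g & g \o u = v.
Proof.
have [Klim sN _ _ Mhom] := hM; move=> sB sJ uv.
pose i0 (b : {x | B x}) : M := proj1_sig b.
have [||g ag gE] := Mhom ({x | B x} + J)%type (cat_tup i0 u) (cat_tup i0 v).
- by apply/smallT/sm_sum => //; apply/smallE.
- apply/tpE => S dS.
  pose f (s : {x | B x} + J) : J + M := match s with inl b => inr (i0 b) | inr j => inl j end.
  have fB x m : f x = inr m -> B m by case: x => // b [<-]; exact: (proj2_sig b).
  have E w : cat_tup w id \o f = cat_tup i0 w by apply: funext => -[].
  have := uv _ (def_subst fB (def_mono (sub0set B) dS)).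
  by rewrite /= !E.
- exists g; last by apply: funext => j; apply: (gE (inr j)).
  by split=> // x Bx; apply: (gE (inl (exist _ x Bx))).
Qed.

Lemma dividesP B X (psi : pformula M X) : small K B -> divides B psi <-> sdiv B (holds psi).
Proof.
move=> sB; have [Klim sN _ _ _] := hM.
split=> [[m [phi [b [-> [k [s [sb sk]]]]]]]|[k [g [ag gk]]]].
- have /choice[g gP] : forall i, exists g, autB B g /\ g \o s i = b.
    move=> i; have [|g ag gE] := homog sB (@sm_ord K sN m) (u := s i) (v := b).
      by apply/tpE.
    by exists g.
  exists k, g; split=> [i|t tinj [x Hx]]; first by have [] := gP i.
  apply: (sk t tinj); exists x => i; apply/holds_inst.
  have [[ag _] gE] := gP (t i).
  move/holds_inst: (Hx i); rewrite -gE => H.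
  apply/(aut_sat ag); move: H; congr (sat phi _).
  by apply: funext => -[].
- case: (carrier_nonempty M) => m0.
  have oT : over setT psi by apply: free_inT => -[].
  have [m [phi [b [_ E]]]] := over_inst (m0 := m0) I oT.
  have [h hP] := autB_invs ag.
  exists m, phi, b; split=> //; exists k, (fun i => h i \o b); split.
    by move=> i /=; have [ah _ _] := hP i; apply/tpE; apply: (autB_teq b ah).
  move=> s sinj [x Hx]; apply: (gk s sinj); exists x => t.
  have [[ah _] _ hg] := hP (s t); have [ag' _] := ag (s t).
  move/holds_inst: (Hx t) => H; rewrite E; apply/holds_inst.
  move/(aut_sat ag'): H; congr (sat phi _).
  by apply: funext => -[y|i] //=; rewrite hg.
Qed.

(** Saturation only speaks of finitely many variables. A partial assignment compatible with every
    [B]-definable member of [W] is extended by one coordinate, and Zorn's lemma makes it total. *)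
Lemma realize B X (W : set (set (X -> M))) : ultra W -> small K B -> sm K X ->
  exists v, forall S, def B S -> (S v <-> W S).
Proof.
move=> uW sB sX; have [Klim sN _ Msat _] := hM.
pose ext (G : set (X * M)) (u : X -> M) := forall x m, G (x, m) -> u x = m.
pose P (G : set (X * M)) := (forall x m m', G (x, m) -> G (x, m') -> m = m') /\
  forall S, def B S -> W S -> exists u, S u /\ ext G u.
have P0 : P set0.
  by split=> // S _ /(ultra_ex uW)[u Su]; exists u; split.
have [|G [[Gf GP] Gmax]] := @Zorn_bigcup _ P.
  move=> F FP Ftot.
  pose U := \bigcup_(X in F) X.
  have Uf x m m' : U (x, m) -> U (x, m') -> m = m'.
    move=> [G1 FG1 G1x] [G2 FG2 G2x].
    have [H|H] := Ftot _ _ FG1 FG2.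
      by have [+ _] := FP _ FG2 => /(_ x m m'); apply => //; apply: H.
    by have [+ _] := FP _ FG1 => /(_ x m m'); apply => //; apply: H.
  split=> // S dS WS; have [l lS] := def_supp dS.
  (* The support of [S] is finite, so a single member of the chain assigns all the coordinates in it
     that the union assigns. *)
  have [G [PG GU Gl]] : exists G, [/\ (G = set0 \/ F G), G `<=` U &
      forall x m, List.In x l -> U (x, m) -> G (x, m)].
    elim: l {lS} => [|x l [G [FG GU Gl]]]; first by exists set0; split; [left|exact: sub0set|].
    have [[m [G1 FG1 G1x]]|nx] := pselect (exists m, U (x, m)); last first.
      exists G; split=> // y m [<-|] yl; last exact: Gl.
      by case: nx; exists m.
    have G1U : G1 `<=` U by move=> p; exists G1.
    have H1 G' : F G' -> G `<=` G' -> G1 `<=` G' -> exists G0, [/\ (G0 = set0 \/ F G0), G0 `<=` U &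
      forall x' m, List.In x' (x :: l) -> U (x', m) -> G0 (x', m)].
      move=> FG' GG G1G; exists G'; split; [by right|by move=> p; exists G'|].
      move=> y m' [<-|] yl; last by move=> /(Gl _ _ yl)/GG.
      by rewrite (Uf x m' m yl (G1U _ G1x)); apply: G1G.
    case: FG => [G0|FG]; first by apply: (H1 G1) => //; rewrite G0; apply: sub0set.
    by case: (Ftot _ _ FG FG1) => H; [apply: (H1 G1)|apply: (H1 G)].
  have {PG} [Gf GP] : P G by case: PG => [->|/FP].
  have [u [Su uG]] := GP _ dS WS.
  have /choice[w wP] : forall x, exists m, (U (x, m) \/ (~ exists m, U (x, m)) /\ m = u x).
    move=> x; have [[m Um]|nU] := pselect (exists m, U (x, m)); first by exists m; left.
    by exists (u x); right.
  exists w; split; last first.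
    move=> x m Um; case: (wP x) => [Uw|[nU _]]; first exact: Uf Uw Um.
    by case: nU; exists m.
  have /lS[H _] : forall x, List.In x l -> u x = w x; last exact: H.
  move=> x xl; case: (wP x) => [Uw|[_ ->]] //.
  by apply: uG; apply: Gl.
have [/choice[v vG]|/existsNP[x0 nx0]] := pselect (forall x, exists m, G (x, m)).
  exists v; suff H S : def B S -> W S -> S v.
    move=> S dS; split; last exact: H.
    by move=> Sv; apply: contrapT => /(ultraN uW) /(H _ (defN dS)).
  move=> dS WS; have [u [Su uG]] := GP _ dS WS.
  by suff <- : u = v by []; apply: funext => x; apply: uG.
exfalso.
case: (carrier_nonempty M) => m00.
pose D : set M := fun m => exists x, G (x, m).
have sD : small K D.
  have /choice[f fP] : forall x, exists m, forall m', G (x, m') -> m = m'.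
    move=> x; have [[m Gm]|nG] := pselect (exists m, G (x, m)).
      by exists m => m'; apply: Gf.
    by exists m00 => m' Gm'; case: nG; exists m'.
  by apply: (@sm_cover _ _ _ _ f _ sX) => m [x /fP <-]; exists x.
pose B' := B `|` D.
(* The possible values at [x0] of points of [S] extending [G]. These sets are definable over [B] and
   the values of [G], and generate the 1-type to be realized. *)
pose R (S : set (X -> M)) : set M := fun m => exists u, [/\ S u, ext G u & u x0 = m].
have dR S : def B S -> def B' (fun v : 'I_1 -> M => R S (v ord0)).
  move=> dS.
  have /choice[f fP] : forall x, exists s : (X + 'I_1) + M,
      (if s is inr m then D m else True) /\
      forall (w : X -> M) (v : 'I_1 -> M),
        (ext G w /\ w x0 = v ord0 -> cat_tup (cat_tup w v) id s = w x) /\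
        (forall m, G (x, m) -> cat_tup (cat_tup w v) id s = m) /\
        (x = x0 -> cat_tup (cat_tup w v) id s = v ord0).
    move=> x; have [[m Gm]|nG] := pselect (exists m, G (x, m)).
      exists (inr m); split=> [|w v]; first by exists x.
      split=> /=; first by move=> [/(_ _ _ Gm) ->].
      split=> [m' /(Gf _ _ _ Gm)//|xx0]; case: nx0; exists m; by rewrite -xx0.
    have [xx0|nx] := pselect (x = x0).
      exists (inl (inr ord0)); split=> // w v /=; split; first by rewrite xx0 => -[_ ->].
      by split=> // m Gm; case: nG; exists m.
    exists (inl (inl x)); split=> // w v /=; split=> //; split=> // m Gm; case: nG; by exists m.
  have fB x m : f x = inr m -> B' m.
    by move=> fx; right; have [] := fP x; rewrite fx.
  have BB' : B `<=` B' by move=> x; left.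
  apply: def_ext (def_ex (def_subst fB (def_mono BB' dS))) => v; split.
    move=> [w Sw]; exists (cat_tup (cat_tup w v) id \o f); split=> //.
      by move=> x m Gxm /=; have [_ /(_ w v)[_ [H _]]] := fP x; apply: H.
    by have [_ /(_ w v)[_ [_ H]]] := fP x0; apply: H.
  move=> [u [Su uG ux0]]; exists u.
  suff -> : cat_tup (cat_tup u v) id \o f = u by [].
  by apply: funext => x /=; have [_ /(_ u v)[H _]] := fP x; apply: H.
pose F1 : set (set M) := fun A => exists S, [/\ def B S, W S & A = R S].
have [|||W1 [uW1 FW1]] := @ultra_exists _ F1.
- exists (R (fun _ => True)), (fun _ => True); split=> //; first exact: defT.
  exact: ultraT.
- move=> _ _ [S [dS WS ->]] [S' [dS' WS' ->]].
  exists (R (fun v => S v /\ S' v)); last first.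
    by move=> m [u [[Su S'u] uG ux]]; split; exists u.
  by exists (fun v => S v /\ S' v); split=> //; [apply: defI|apply/(ultraI uW)].
- move=> _ [S [dS WS ->]]; have [u [Su uG]] := GP _ dS WS.
  by exists (u x0), u.
pose p : set (pformula M 'I_1) := fun psi => over B' psi /\ W1 (fun m => holds psi (fun _ => m)).
have cp : complete_type B' p.
  split; first by move=> psi [].
    move=> r theta thp.
    have /(ultra_ex uW1)[m Hm] : W1 (fun m => forall i, holds (theta i) (fun _ => m)).
      by apply: (ultra_ord uW1) => i; have [] := thp i.
    by exists (fun _ => m).
  move=> psi o; have [_ _ _ WN] := uW1.
  by case: (WN (fun m => holds psi (fun _ => m))) => H; [left|right].
have [a ap] := Msat _ _ _ (smallU Klim sB sD) cp.
have aR S : def B S -> W S -> R S (a ord0).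
  move=> dS WS; have [psi o H] := dR _ dS.
  apply/H; apply: ap; split=> //.
  apply: (ultraS uW1) (FW1 (R S) _); last by exists S.
  by move=> m RS; apply/H.
have [] := Gmax (G `|` [set (x0, a ord0)]).
  split; first by move=> q; left.
  by move=> H; apply: nx0; exists (a ord0); apply: H; right.
split.
  move=> x m m' [Gx|[xx ->]] [Gx'|[xx' ->]] //; first exact: Gf Gx Gx'.
    by case: nx0; exists m; rewrite -xx'.
  by case: nx0; exists m'; rewrite -xx.
move=> S dS WS; have [u [Su uG ux]] := aR _ dS WS.
by exists u; split=> // x m [/uG|[-> ->]].
Qed.

(** The coordinates in the support are found in [N] one at a time, each being fixed as a parameter
    before the next; the remaining ones take an arbitrary value in [N]. *)
Lemma tarski_vaught N : elementary_sub N -> forall V (S : set (V -> M)),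
  def N S -> (exists v, S v) -> exists2 v, S v & forall x, N (v x).
Proof.
move=> [Ns [h [he hN]]].
have [n0] := carrier_nonempty Ns; have Nn0 : N (h n0) by rewrite -hN; exists n0.
have tv1 (S : set (unit -> M)) : def N S -> (exists v, S v) -> exists2 m, N m & S (fun _ => m).
  move=> [psi o H] [v Sv].
  have [m [phi [b [Nb E]]]] := over_inst Nn0 o.
  have /choice[c hc] : forall i, exists c, h c = b i.
    by move=> i; move: (Nb i); rewrite -hN => -[c _ <-]; exists c.
  have SE w : S w <-> sat phi (cat_tup w b) by rewrite H E holds_inst.
  pose f (s : unit + 'I_m) : option 'I_m := match s with inl _ => None | inr i => Some i end.
  have fE (Q : structure L) (w : 'I_m -> Q) (d : Q) :
      (fun o => if o is Some x then w x else d) \o f = cat_tup (fun _ => d) w.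
    by apply: funext => -[].
  have /he [d] : sat (Ex (frename f phi)) (h \o c).
    exists (v tt); apply/sat_frename; rewrite fE; move/SE: Sv; congr (sat phi _).
    by apply: funext => -[[]|i] //=.
  move=> /sat_frename; rewrite fE => Hd.
  pose f' (s : unit + 'I_m) : 'I_m.+1 := match s with inl _ => ord0 | inr i => lift ord0 i end.
  pose w (i : 'I_m.+1) := if unlift ord0 i is Some j then c j else d.
  have wE : w \o f' = cat_tup (fun _ => d) c.
    by apply: funext => -[[]|i]; rewrite /w /= ?unlift_none ?liftK.
  exists (h d); first by rewrite -hN; exists d.
  have : sat (frename f' phi) w by apply/sat_frename; rewrite wE.
  move=> /he /sat_frename Hs; apply/SE; move: Hs; congr (sat phi _).
  rewrite -compA wE; apply: funext => -[[]|i] //=; exact: hc.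
move=> V S dS [v0 Sv0].
have [l lS] := def_supp dS.
have [v [Sv vl]] : exists v, S v /\ forall x, List.In x l -> N (v x).
  elim: l S dS v0 Sv0 {lS} => [|x l IH] S dS v Sv; first by exists v.
  have d1 : def N (fun y : unit -> M => exists u, S u /\ u x = y tt).
    pose f (s : V) : V + unit := inl s.
    have dS2 : def N (fun w : V + unit -> M => S (w \o inl) /\ w (inl x) = w (inr tt)).
      apply: defI; first exact: def_comp.
      by exists (Eq (Var L (inl (inl x))) (Var L (inl (inr tt)))) => //; split.
    by apply: def_ext (def_ex dS2) => y; split=> -[u [Su ux]]; exists u.
  have [|m Nm [u [Su um]]] := tv1 _ d1; first by exists (fun _ => v x), v.
  have dm := def_eqp x Nm.
  have [w [[Sw wx] wl]] := IH _ (defI dS dm) _ (conj Su um).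
  by exists w; split=> // y [<-|/wl //]; rewrite wx.
exists (fun x => if `[< List.In x l >] then v x else h n0).
  have /lS[H _] : forall x, List.In x l -> v x = if `[< List.In x l >] then v x else h n0.
    by move=> x xl; case: asboolP.
  exact: H.
by move=> x; case: asboolP => // /vl.
Qed.

End Monster.

(** * Well-orders and Morley sequences of ultrafilters *)

Definition wo (Lam : Type) (lt : Lam -> Lam -> Prop) :=
  [/\ well_founded lt, forall x y z, lt x y -> lt y z -> lt x z &
      forall x y, lt x y \/ x = y \/ lt y x].

Lemma wo_irr Lam (lt : Lam -> Lam -> Prop) x : wo lt -> ~ lt x x.
Proof. by move=> [wf _ _]; elim/(well_founded_ind wf): x => x IH xx; apply: (IH x). Qed.

Definition ltn_nat (m n : nat) : Prop := m < n.

Lemma wo_nat : wo ltn_nat.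
Proof.
split; first by move=> n; elim/ltn_ind: n => n IH; constructor => m /IH.
  by move=> x y z; apply: ltn_trans.
by move=> x y; case: (ltngtP x y); auto.
Qed.

Lemma wo_exists (Lam : Type) : exists lt : Lam -> Lam -> Prop, wo lt.
Proof.
have [R woR] := @wochoice.well_ordering_principle {classic Lam}.
pose lt (x y : Lam) := R x y /\ x <> y.
have minR (A : Lam -> Prop) x : A x -> exists z, A z /\ forall y, A y -> R z y.
  move=> Ax; have [|z [[zA zmin] _]] := woR (fun y => `[< A y >]).
    by exists x; apply/asboolP.
  by exists z; split=> [|y /asboolP/zmin//]; apply/asboolP.
have Rxx x : R x x by have [|z [-> H]] := minR (fun y => y = x) x; last exact: H.
have Ranti x y : R x y -> R y x -> x = y.
  move=> Rxy Ryx; have [|z [_ H]] := woR (fun z => `[< z = x \/ z = y >]).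
    by exists x; apply/asboolP; left.
  transitivity z; [apply/esym|]; apply: H; split; try (by apply/asboolP; auto);
  by move=> t /asboolP[->|->].
have Rtot x y : R x y \/ R y x.
  have [|z [[->|->] H]] := minR (fun z => z = x \/ z = y) x; first by left.
    by left; apply: H; right.
  by right; apply: H; left.
have Rtr x y z : R x y -> R y z -> R x z.
  move=> Rxy Ryz.
  have [|w [H1 H]] := minR (fun w => w = x \/ w = y \/ w = z) x; first by left.
  case: H1 H => [->|[->|->]] H; first by apply: H; auto.
    by have -> : x = y; [apply: Ranti => //; apply: H; auto|].
  have zy : z = y by apply: Ranti => //; apply: H; auto.
  by rewrite zy.
exists lt; split.
- move=> x; apply: contrapT => nx.
  have [z [nz zmin]] := minR (fun y => ~ Acc lt y) x nx.
  apply: nz; constructor => y [Ryz yz]; apply: contrapT => /zmin Rzy.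
  by apply: yz; apply: Ranti.
- move=> x y z [Rxy xy] [Ryz yz]; split; first exact: Rtr Rxy Ryz.
  by move=> xz; subst z; apply: xy; apply: Ranti.
- move=> x y; have [->|xy] := pselect (x = y); first by right; left.
  by case: (Rtot x y) => H; [left|right; right; split=> // /esym].
Qed.

Lemma nonprincipal : exists U : set (set nat), ultra U /\ forall n, U (fun k => (n < k)).
Proof.
have [|||U [uU FU]] := @ultra_exists nat (fun A => exists n, A = (fun k => (n < k))).
- by exists (fun k => (0 < k)), 0.
- move=> _ _ [n ->] [m ->]; exists (fun k => (maxn n m < k)); first by eexists.
  by move=> k; rewrite gtn_max => /andP.
- by move=> _ [n ->]; exists n.+1.
by exists U; split=> // n; apply: FU; exists n.
Qed.

(** Allows indiscernibility to be tested by reindexing the whole sequence instead of finite parts of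
    it. *)
Lemma extend_mono n (i : 'I_n -> nat) : {homo i : x y / (x < y)} ->
  exists2 s : nat -> nat, {homo s : x y / (x < y)} & forall t, s (val t) = i t.
Proof.
case: n i => [|n] i ih; first by exists id => // -[].
exists (fun k => if (k <= n) then i (inord k) else (i ord_max + k)); last first.
  by move=> t; rewrite -ltnS ltn_ord inord_val.
move=> x y xy; have [yn|ny] := leqP y n.
  by rewrite (leq_trans (ltnW xy) yn); apply: ih; rewrite !inordK // ltnS // (leq_trans (ltnW xy) yn).
have [xn|nx] := leqP x n; last by rewrite ltn_add2l.
have : (i (inord x) <= i ord_max).
  have [->//|] := eqVneq (inord x) (ord_max : 'I_n.+1).
  by move=> H; apply/ltnW/ih; rewrite ltn_neqAle -ltnS ltn_ord andbT.
by move=> H; apply: leq_ltn_trans H _; rewrite -addn1 leq_add2l; apply: leq_trans ny.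
Qed.

Section Dependent.
Variables (M Lam : Type) (J : Lam -> Type).

(** The tuples have different index types [J i], so replacing one of them needs transport along an
    equality of indices. *)
Definition updd (v : forall i, J i -> M) i (x : J i -> M) : forall j, J j -> M :=
  fun j => match pselect (i = j) with
           | left E => eq_rect i (fun j => J j -> M) x j E
           | right _ => v j end.

Arguments updd v {i} x j : rename.

Lemma updd_eq v i (x : J i -> M) : updd v x i = x.
Proof.
rewrite /updd; case: pselect => // E.
by have -> : E = erefl by apply: Prop_irrelevance.
Qed.

Lemma updd_neq v i (x : J i -> M) j : i <> j -> updd v x j = v j.
Proof. by rewrite /updd; case: pselect. Qed.

Lemma updd_id v i : updd v (v i) = v.
Proof.
apply: functional_extensionality_dep => j.
have [<-|ij] := pselect (i = j); first by rewrite updd_eq.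
by rewrite updd_neq.
Qed.

Lemma updd_comm v i (x : J i -> M) j (y : J j -> M) : i <> j ->
  updd (updd v x) y = updd (updd v y) x.
Proof.
move=> ij; apply: functional_extensionality_dep => k.
have [<-|ik] := pselect (i = k).
  by rewrite updd_eq updd_neq ?updd_eq // => /esym.
have [jk|jk] := pselect (j = k); last by rewrite !updd_neq.
by subst k; rewrite updd_eq (updd_neq _ _ ij) updd_eq.
Qed.

Definition tot (v : forall i, J i -> M) : {i & J i} -> M := fun z => v (projT1 z) (projT2 z).
Definition curry (w : {i & J i} -> M) : forall i, J i -> M := fun i c => w (existT _ i c).

Lemma totK w : tot (curry w) = w. Proof. by apply: funext => -[]. Qed.

Definition isupp (F : seq Lam) (S : set (forall i, J i -> M)) :=
  forall v w : forall i, J i -> M, (forall i, List.In i F -> v i = w i) -> S v <-> S w.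

End Dependent.

Arguments updd {M Lam J} v {i} x j : rename.
Arguments curry {M Lam J} w i c : rename.

Lemma in_map T U (f : T -> U) (s : seq T) x : List.In x s -> List.In (f x) (map f s).
Proof. by elim: s => //= y s IH [->|/IH]; [left|right]. Qed.

Section Dec.
Variables (Lam : Type) (lt : Lam -> Lam -> Prop).
Hypothesis wolt : wo lt.

Fixpoint dec (F : seq Lam) : Prop :=
  if F is i :: F' then (forall j, List.In j F' -> lt j i) /\ dec F' else True.

Lemma dec_exists (l : seq Lam) : exists2 F, dec F & forall x, List.In x l -> List.In x F.
Proof.
have [_ tr tri] := wolt.
have ins x F : dec F -> exists2 F', dec F' & forall y, List.In y F' <-> y = x \/ List.In y F.
  elim: F => [_|i F IH [iF dF]].
    by exists [:: x] => // y /=; split=> -[]; auto.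
  case: (tri x i) => [xi|[->|ix]].
  - have [F' dF' HF'] := IH dF; exists (i :: F').
      by split=> // j /HF'[->|/iF].
    move=> y /=; rewrite HF'; tauto.
  - by exists (i :: F) => // y /=; split=> [|[->|]]; auto.
  - exists [:: x, i & F].
      by split=> // j /= [<-|/iF ji] //; apply: tr ji ix.
    by move=> y /=; split=> -[|]; auto.
elim: l => [|x l [F dF HF]]; first by exists [::].
have [F' dF' HF'] := ins x F dF; exists F' => // y [<-|/HF yF]; apply/HF'; auto.
Qed.

End Dec.

(** * Iterated ultrafilter limits and the types of Morley sequences *)

Section Lim.
Context {L : language} {M : structure L}.
Variables (Lam : Type) (lt : Lam -> Lam -> Prop) (J : Lam -> Type).
Hypothesis wolt : wo lt.
Implicit Types (N : set M) (S : set (forall i, J i -> M)) (v e : forall i, J i -> M).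

Definition ddef N S := def N (fun w => S (curry w)).

Lemma ddef_isupp N S : ddef N S -> exists2 F, dec lt F & isupp F S.
Proof.
move=> /def_supp[l lS]; have [F dF lF] := dec_exists wolt (map (@projT1 _ _) l).
exists F => // v w vw; apply: (lS (tot v) (tot w)) => -[i c] ic.
by rewrite /tot /= vw //; apply: lF; exact: (in_map (@projT1 _ _) ic).
Qed.

Lemma teq_ddef N v w : (forall S, ddef N S -> S v -> S w) -> teq N (tot v) (tot w).
Proof.
move=> H; apply: teq_imp => S dS; apply: (H (fun u => S (tot u))).
by apply: def_ext dS => u; rewrite totK.
Qed.

Lemma ddef_fix N S i (x : J i -> M) : (forall c, N (x c)) -> ddef N S ->
  ddef N (fun v => S (updd v x)).
Proof.
move=> Nx dS.
pose f (z : {i & J i}) : {i & J i} + M := match pselect (projT1 z = i) with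
  | left E => inr (x (eq_rect _ J (projT2 z) _ E)) | right _ => inl z end.
have fN z m : f z = inr m -> N m by rewrite /f; case: pselect => // E [<-].
apply: def_ext (def_subst fN dS) => w.
suff -> : curry (cat_tup w id \o f) = updd (curry w) x by [].
apply: functional_extensionality_dep => j; apply: funext => c.
rewrite /curry /= /f /=; have [E|nE] := pselect (i = j).
  case: _ / E c => c; rewrite updd_eq; case: pselect => //= E'.
  by have -> : E' = erefl by apply: Prop_irrelevance.
by rewrite updd_neq //; case: pselect => // E; case: nE.
Qed.

Variable W : forall i, set (set (J i -> M)).
Hypothesis uW : forall i, ultra (@W i).

Definition below e i : set M := fun m => exists j, lt j i /\ exists c, e j c = m.

Definition morley N e := forall i (S : set (J i -> M)),
  def (N `|` below e i) S -> (S (e i) <-> W S).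

(** For a decreasing list the largest index is outermost: the last tuple of a Morley sequence is
    generic over all the others, so its limit is resolved first. *)
Fixpoint ulim (F : seq Lam) v S : Prop :=
  if F is i :: F' then @W i (fun x => ulim F' (updd v x) S) else S v.

Lemma lim_updd F v S i (x : J i -> M) : ~ List.In i F ->
  ulim F v (fun w => S (updd w x)) <-> ulim F (updd v x) S.
Proof.
elim: F v => //= j F IH v /not_orP[ji iF]; apply: (ultra_ext (uW j)) => y.
by rewrite (IH _ iF) updd_comm // => /esym.
Qed.

Lemma limI F v S S' : ulim F v (fun w => S w /\ S' w) <-> ulim F v S /\ ulim F v S'.
Proof.
elim: F v => //= j F IH v; rewrite -(ultraI (uW j)).
by apply: (ultra_ext (uW j)) => y; apply: IH.
Qed.

Lemma limN F v S : ulim F v (fun w => ~ S w) <-> ~ ulim F v S.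
Proof.
elim: F v => //= j F IH v; rewrite -(ultraN (uW j)).
by apply: (ultra_ext (uW j)) => y; apply: IH.
Qed.

Lemma lim_ext F v S S' : (forall w, S w <-> S' w) -> ulim F v S <-> ulim F v S'.
Proof.
move=> H; elim: F v => //= j F IH v; apply: (ultra_ext (uW j)) => y; exact: IH.
Qed.

Lemma lim_all F v S (R : forall i, set (J i -> M)) : (forall i, W (R i)) ->
  (forall i, R i (v i)) -> (forall w, (forall i, R i (w i)) -> S w) -> ulim F v S.
Proof.
move=> WR + H; elim: F v => [v Rv|j F IH v Rv] /=; first exact: H.
apply: (ultraS (uW j) _ (WR j)) => y Ry; apply: IH => i.
have [E|ji] := pselect (j = i); last by rewrite updd_neq.
by case: _ / E; rewrite updd_eq.
Qed.

(** The last tuple realizes [W i] over the earlier ones, so it may be replaced by almost every [x].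
    As [W i] concentrates on [N], such an [x] consists of parameters in [N], and induction applies
    to the shorter sequence. *)
Lemma morley_limE N e F S v : (forall i, W (fun x : J i -> M => forall c, N (x c))) ->
  morley N e -> dec lt F -> isupp F S -> ddef N S -> S e <-> ulim F v S.
Proof.
move=> WN me; have [wf _ _] := wolt.
elim: F S v => [|i F IH] S v /=; first by move=> _ H _; apply: H.
move=> [iF dF] sS dS.
have niF : ~ List.In i F by move=> /iF; apply: wo_irr.
have E (x : J i -> M) : S (updd e x) <-> exists w : forall j, J j -> M,
    [/\ S w, forall j, lt j i -> w j = e j & w i = x].
  split=> [Sx|[w [Sw we wx]]].
    exists (updd e x); split=> //; last by rewrite updd_eq.
    by move=> j ji; rewrite updd_neq // => ij; subst j; apply: wo_irr ji.
  apply: (proj1 (sS w _ _)) Sw => j [<-|/iF ji]; first by rewrite updd_eq.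
  by rewrite we // updd_neq // => ij; subst j; apply: wo_irr ji.
have d1 : def (N `|` below e i) (fun x : J i -> M => S (updd e x)).
  pose f (z : {i & J i}) : ({i & J i} + J i) + M :=
    match pselect (projT1 z = i) with
    | left E => inl (inr (eq_rect _ J (projT2 z) _ E))
    | right _ => if `[< lt (projT1 z) i >] then inr (e _ (projT2 z)) else inl (inl z) end.
  have fN z m : f z = inr m -> (N `|` below e i) m.
    rewrite /f; case: pselect => // ?; case: asboolP => // ji [<-].
    by right; exists (projT1 z); split=> //; exists (projT2 z).
  have NN : N `<=` N `|` below e i by move=> ?; left.
  apply: def_ext (def_ex (def_subst fN (def_mono NN dS))) => x; rewrite E; split.
    move=> [w Sw]; exists (curry (cat_tup (cat_tup w x) id \o f)); split=> //.
      move=> j ji; apply: funext => c; rewrite /curry /= /f /=.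
      case: pselect => [E'|_]; first by subst j; case: (wo_irr wolt ji).
      by case: asboolP.
    apply: funext => c; rewrite /curry /= /f /=; case: pselect => // E'.
    by have -> : E' = erefl by apply: Prop_irrelevance.
  move=> [w [Sw we wx]]; exists (tot w).
  suff -> : curry (cat_tup (cat_tup (tot w) x) id \o f) = w by [].
  apply: functional_extensionality_dep => j; apply: funext => c; rewrite /curry /= /f /=.
  case: pselect => [E'|nE] /=; first by subst j; rewrite /= wx.
  by case: asboolP => [/we <-|].
rewrite -{1}(updd_id e i) (me _ _ d1).
have H (x : J i -> M) : (forall c, N (x c)) -> S (updd e x) <-> ulim F (updd v x) S.
  move=> Nx; rewrite -lim_updd //; apply: IH => //; last exact: ddef_fix.
  move=> u w uw; apply: sS => j [<-|jF]; first by rewrite !updd_eq.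
  by rewrite !updd_neq ?uw // => ij; subst j.
split=> H1; apply: (ultraI2 (uW i) H1 (WN i)) => x H2 /H H3; exact/H3.
Qed.

End Lim.

(** * Indiscernible sequences and compactness *)

Definition unc {M : Type} J (s : nat -> J -> M) : nat * J -> M := fun z => s z.1 z.2.

(** Indiscernibility as invariance of the whole infinite tuple under increasing reindexing;
    [indiscE] gives the equivalence with the finitary definition. *)
Definition ind {L} {M : structure L} (B : set M) J (s : nat -> J -> M) :=
  forall r : nat -> nat, {homo r : x y / (x < y)} -> teq B (unc (s \o r)) (unc s).

Definition kinc {L} {M : structure L} X J (E : set (X + J -> M)) k (b : nat -> J -> M) :=
  forall s : 'I_k -> nat, injective s -> ~ exists x, forall t, E (cat_tup x (b (s t))).

Section Semantic.
Context {L : language} {M : structure L}.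
Implicit Types (B N D : set M).

Lemma teq_unc B J (s t : nat -> J -> M) :
  (forall n, teq B (fun z : 'I_n * J => s (val z.1) z.2) (fun z => t (val z.1) z.2)) ->
  teq B (unc s) (unc t).
Proof.
move=> H S dS; have [l lS] := def_supp dS.
have [n nl] : exists n, forall z, List.In z l -> (z.1 < n).
  elim: l {lS} => [|z l [n nl]]; first by exists 0.
  exists (maxn z.1.+1 n) => y [<-|/nl yn]; rewrite leq_max ?ltnSn //.
  by rewrite yn orbT.
pose f (z : nat * J) : 'I_n.+1 * J := (inord z.1, z.2).
have E (q : nat -> J -> M) : S (unc q) <-> S ((fun z : 'I_n.+1 * J => q (val z.1) z.2) \o f).
  by apply: lS => -[z c] /nl /= zn; rewrite /unc /= inordK //; exact: ltnW.
apply: iff_trans (E s) _; apply: iff_trans (iff_sym (E t)).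
exact: (H n.+1 _ (def_comp f dS)).
Qed.

Lemma indiscE B J (s : nat -> J -> M) : indiscernible B s <-> ind B s.
Proof.
split=> [H r rh|H n i j ih jh].
- apply: teq_unc => n; apply/tpE.
  exact: (H n (r \o val) val (fun x y => rh _ _) (fun x y => id)).
- apply/tpE.
  have [r rh ri] := extend_mono ih; have [q qh qj] := extend_mono jh.
  pose f (z : 'I_n * J) : nat * J := (val z.1, z.2).
  have E1 : (fun z : 'I_n * J => s (i z.1) z.2) = unc (s \o r) \o f.
    by apply: funext => -[z c]; rewrite /unc /= ri.
  have E2 : (fun z : 'I_n * J => s (j z.1) z.2) = unc (s \o q) \o f.
    by apply: funext => -[z c]; rewrite /unc /= qj.
  rewrite E1 E2; apply: teq_comp.
  exact: teq_trans (H r rh) (teq_sym (H q qh)).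
Qed.

Lemma def_exI B X V n (J : 'I_n -> Type) (E : forall i, set (X + J i -> M))
    (r : forall i, J i -> V) : (forall i, def B (E i)) ->
  def B (fun w : V -> M => exists x : X -> M, forall i, E i (cat_tup x (w \o r i))).
Proof.
move=> dE.
pose h i (s : X + J i) : X + V := match s with inl x => inl x | inr j => inr (r i j) end.
have d1 : def B (fun u : X + V -> M => forall i, E i (u \o h i)).
  by apply: (@def_exall _ _ B _ n (fun i u => E i (u \o h i))) => i; apply: (def_comp (h i) (dE i)).
apply: def_ext (def_ex d1) => w.
have Eq x i : cat_tup x w \o h i = cat_tup x (w \o r i) by apply: funext => -[].
by split=> -[x Hx]; exists x => i; have := Hx i; rewrite Eq.
Qed.

Lemma def_sum_aut B X J (E : set (X + J -> M)) g x y : autB B g -> def B E ->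
  E (cat_tup (g \o x) (g \o y)) <-> E (cat_tup x y).
Proof.
move=> ag dE; rewrite -(def_aut (cat_tup x y) ag dE).
suff -> : cat_tup (g \o x) (g \o y) = g \o cat_tup x y by [].
by apply: funext => -[].
Qed.

Lemma ddef_unc B J (S : set (nat * J -> M)) : def B S ->
  ddef (J := fun _ : nat => J) B (fun v => S (unc v)).
Proof.
by move=> dS; apply: (def_comp (fun z : nat * J => existT (fun _ : nat => J) z.1 z.2) dS).
Qed.

Lemma ddef_slice Lam (J : Lam -> Type) B D (S : set (forall i, J i -> M)) (v : forall i, J i -> M) i :
  ddef B S -> (forall j c, j <> i -> D (v j c)) ->
  def (B `|` D) (fun x : J i -> M => S (updd v x)).
Proof.
move=> dS vD.
pose f (z : {i & J i}) : J i + M := match pselect (projT1 z = i) with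
  | left E => inl (eq_rect _ J (projT2 z) _ E) | right _ => inr (tot v z) end.
have fN z m : f z = inr m -> (B `|` D) m.
  by rewrite /f; case: pselect => // E [<-]; right; apply: vD.
have BB : B `<=` B `|` D by left.
apply: def_ext (def_subst fN (def_mono BB dS)) => x.
suff -> : curry (cat_tup x id \o f) = updd v x by [].
apply: functional_extensionality_dep => j; apply: funext => c.
rewrite /curry /= /f /=; have [E|nE] := pselect (i = j).
  subst j; rewrite updd_eq; case: pselect => //= E'.
  by have -> : E' = erefl by apply: Prop_irrelevance.
by rewrite updd_neq //; case: pselect => // E; case: nE.
Qed.

(** Each row is indiscernible over the other ones, so rows can be reindexed one after the other; by
    finite support only finitely many have to be. *)
Lemma mutual Lam (J : Lam -> Type) B (I : forall i, nat -> J i -> M) :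
  (forall i, indiscernible (B `|` \bigcup_(j in [set j | j <> i]) range (unc (I j))) (I i)) ->
  forall r : Lam -> nat -> nat, (forall i, {homo r i : x y / (x < y)}) ->
  forall S : set (forall i, nat * J i -> M), ddef B S ->
  S (fun i => unc (I i \o r i)) <-> S (fun i => unc (I i)).
Proof.
move=> mI r rh S dS; have [l lS] := def_supp dS.
pose v F (i : Lam) : nat * J i -> M := if `[< List.In i F >] then unc (I i \o r i) else unc (I i).
have vD F j c : range (unc (I j)) (v F j c).
  by rewrite /v; case: asboolP => _; [exists (r j c.1, c.2)|exists c].
have step F : S (v F) <-> S (fun i => unc (I i)).
  elim: F => [|i F IH].
    suff -> : v [::] = (fun i => unc (I i)) by [].
    by apply: functional_extensionality_dep => j; rewrite /v; case: asboolP.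
  rewrite -IH; have [iF|niF] := pselect (List.In i F).
    suff -> : v (i :: F) = v F by [].
    apply: functional_extensionality_dep => j; rewrite /v.
    by do 2 case: asboolP => //=; [move=> nF [E|//]; case: nF; rewrite -E|move=> jF []; right].
  have dx := @ddef_slice _ _ B (\bigcup_(j in [set j | j <> i]) range (unc (I j))) S (v F) i dS
    (fun j c ji => ex_intro2 _ _ j ji (vD F j c)).
  have := (proj1 (indiscE _ _) (mI i)) _ (rh i) _ dx.
  have -> : updd (v F) (unc (I i \o r i)) = v (i :: F).
    apply: functional_extensionality_dep => j; rewrite /v.
    have [E|ij] := pselect (i = j).
      by subst j; rewrite updd_eq; case: asboolP => // -[]; left.
    rewrite updd_neq //; do 2 case: asboolP => //=; first by move=> nF jF; case: nF; right.
    by move=> [//|].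
  suff -> : updd (v F) (unc (I i)) = v F by [].
  apply: functional_extensionality_dep => j; rewrite /v.
  have [E|ij] := pselect (i = j); last by rewrite updd_neq.
  by subst j; rewrite updd_eq; case: asboolP.
rewrite -(step (map (@projT1 _ _) l)).
apply: (lS (tot (fun i => unc (I i \o r i))) (tot (v (map (@projT1 _ _) l)))) => -[i c] ic.
by rewrite /tot /v /=; case: asboolP => // -[]; apply: (in_map (@projT1 _ _) ic).
Qed.

(** Parameters of [E] become fixed entries of a finite tuple, through [u]; thus any definable set
    fits the finite tuples in the definition of TP2. *)
Lemma nfE B X J (E : set (X + J -> M)) : def B E ->
  exists n (f : 'I_n -> X) m (phi : formula L ('I_n + 'I_m)) (u : 'I_m -> J + M),
  injective f /\ forall x y, E (cat_tup x y) <-> sat phi (cat_tup (x \o f) (cat_tup y id \o u)).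
Proof.
move=> [psi _ H]; case: (carrier_nonempty M) => m0.
pose as_ (s : (X + J) + M) : X + (J + M) := match s with
  | inl (inl x) => inl x | inl (inr j) => inr (inl j) | inr m => inr (inr m) end.
have [n [f [phi1 [fi E1]]]] := nf_left (frename as_ psi).
have oT : free_in phi1 (fun s => if s is inr v then [set: J + M] v else True).
  by apply: free_inT => -[].
have [m [phi [u [_ E2]]]] := nf_right (v0 := inr m0) I oT.
exists n, f, m, phi, u; split=> // x y.
rewrite H /holds; have -> : cat_tup (cat_tup x y) id = cat_tup x (cat_tup y id) \o as_.
  by apply: funext => -[[]|].
rewrite -sat_frename E1 sat_frename E2 sat_frename.
suff -> : cat_tup x (cat_tup y id) \o cat_tup (inl \o f) inr \o cat_tup inl (inr \o u) =
   cat_tup (x \o f) (cat_tup y id \o u) by [].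
by apply: funext => -[].
Qed.

Lemma nfE_ord B n J (E : set ('I_n + J -> M)) : def B E ->
  exists m (phi : formula L ('I_n + 'I_m)) (u : 'I_m -> J + M),
  forall x y, E (cat_tup x y) <-> sat phi (cat_tup x (cat_tup y id \o u)).
Proof.
move=> [psi o H]; case: (carrier_nonempty M) => m0.
pose as_ (s : ('I_n + J) + M) : 'I_n + (J + M) := match s with
  | inl (inl x) => inl x | inl (inr j) => inr (inl j) | inr m => inr (inr m) end.
have oT : free_in (frename as_ psi) (fun s => if s is inr v then [set: J + M] v else True).
  by apply: free_inT => -[].
have [m [phi [u [_ E2]]]] := nf_right (v0 := inr m0) I oT.
exists m, phi, u => x y.
rewrite H /holds; have -> : cat_tup (cat_tup x y) id = cat_tup x (cat_tup y id) \o as_.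
  by apply: funext => -[[]|].
rewrite -sat_frename E2 sat_frename.
suff -> : cat_tup x (cat_tup y id) \o cat_tup inl (inr \o u) =
   cat_tup x (cat_tup y id \o u) by [].
by apply: funext => -[].
Qed.

End Semantic.

Section Monster.
Context {L : language} {K : Type} {M : structure L}.
Hypothesis hM : mon K M.
Implicit Types (B N D : set M).

Lemma sm_dep Lam (J : Lam -> Type) i : sm K {i & J i} -> sm K (J i).
Proof.
apply: sm_le; exists (fun c => existT _ i c) => c c' E.
pose g (z : {i & J i}) : option (J i) := match pselect (projT1 z = i) with
  | left E => Some (eq_rect _ J (projT2 z) _ E) | right _ => None end.
have gE d : g (existT _ i d) = Some d.
  rewrite /g; case: pselect => //= E'.
  by have -> : E' = erefl by apply: Prop_irrelevance.
by have := congr1 g E; rewrite !gE => -[].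
Qed.

Lemma sm_dep_prod Lam (J : Lam -> Type) X : (forall i, tle (J i) X) ->
  sm K Lam -> sm K X -> sm K {i & J i}.
Proof.
have [Klim sN _ _ _] := hM.
move=> JX sL sX; apply: sm_le (sm_prod Klim sL sX).
pose f i := projT1 (cid (JX i)).
have fi i : injective (f i) by rewrite /f; case: cid.
exists (fun z => (projT1 z, f _ (projT2 z))) => -[i c] [j d] /= [ij]; subst j.
by move=> /fi ->.
Qed.

(** Transfinite recursion; the set of parameters met at each stage is small because the total index
    set is. *)
Lemma rec_exists Lam (lt : Lam -> Lam -> Prop) (J : Lam -> Type) N
    (P : forall i, set M -> (J i -> M) -> Prop) :
  wo lt -> small K N -> sm K {i & J i} ->
  (forall i D, small K D -> exists x, P i D x) ->
  exists e : forall i, J i -> M, forall i, P i (N `|` below lt e i) (e i).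
Proof.
move=> [wf _ _] sN sJ HP; have [Klim sNat _ _ _] := hM.
case: (carrier_nonempty M) => m0.
pose D i (f : forall j, lt j i -> J j -> M) : set M := N `|` (fun m => exists j (h : lt j i) c, f j h c = m).
have sD i f : small K (@D i f).
  apply: (smallU Klim) => //.
  pose h (z : {i & J i}) := match pselect (lt (projT1 z) i) with
    | left H => f _ H (projT2 z) | right _ => m0 end.
  apply: (@sm_cover _ _ _ _ h _ sJ) => m [j [hj [c <-]]]; exists (existT _ j c).
  rewrite /h /=; case: pselect => // hj'.
  by have -> : hj' = hj by apply: Prop_irrelevance.
pose F i f : J i -> M := projT1 (cid (HP i _ (sD i f))).
have FP i f : P i (D i f) (F i f) by rewrite /F; case: cid.
pose e : forall i, J i -> M := Fix wf (fun i => J i -> M) F.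
exists e => i.
have -> : e i = F i (fun j _ => e j).
  apply: (Fix_eq wf (fun i => J i -> M) F) => x f g fg.
  by congr (F x _); apply: functional_extensionality_dep => y;
    apply: functional_extensionality_dep.
have -> : N `|` below lt e i = D i (fun j _ => e j).
  congr (_ `|` _); apply/seteqP; split=> m; first by move=> [j [ji [c <-]]]; exists j, ji, c.
  by move=> [j [ji [c <-]]]; exists j; split=> //; exists c.
exact: FP.
Qed.

Lemma morley_exists Lam (lt : Lam -> Lam -> Prop) (J : Lam -> Type) N
    (W : forall i, set (set (J i -> M))) :
  wo lt -> small K N -> sm K {i & J i} -> (forall i, ultra (@W i)) ->
  exists e : forall i, J i -> M, morley lt W N e.
Proof.
move=> wolt sN sJ uW.
apply: (rec_exists (P := fun i D x => forall S, def D S -> (S x <-> W i S)) wolt sN sJ).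
by move=> i D sD; apply: (realize hM (uW i) sD (sm_dep (i := i) sJ)).
Qed.

Lemma morley_unique Lam (lt : Lam -> Lam -> Prop) (J : Lam -> Type) N
    (W : forall i, set (set (J i -> M))) e e' :
  wo lt -> (forall i, ultra (@W i)) ->
  (forall i, W i (fun x : J i -> M => forall c, N (x c))) ->
  morley lt W N e -> morley lt W N e' -> teq N (tot e) (tot e').
Proof.
move=> wolt uW WN me me'; apply: teq_ddef => S dS.
have [F dF sF] := ddef_isupp wolt dS.
by rewrite (morley_limE wolt uW e WN me dF sF dS) (morley_limE wolt uW e WN me' dF sF dS).
Qed.

Lemma morley_all Lam (lt : Lam -> Lam -> Prop) (J : Lam -> Type) N
    (W : forall i, set (set (J i -> M))) e (R : forall i, set (J i -> M))
    (S : set (forall i, J i -> M)) :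
  wo lt -> (forall i, ultra (@W i)) ->
  (forall i, W i (fun x : J i -> M => forall c, N (x c))) ->
  morley lt W N e -> (forall i, W i (R i)) -> ddef N S ->
  (forall w, (forall i, R i (w i)) -> S w) -> S e.
Proof.
move=> wolt uW WN me WR dS RS.
have [F dF sF] := ddef_isupp wolt dS.
pose v i : J i -> M := projT1 (cid (ultra_ex (uW i) (WR i))).
apply/(morley_limE wolt uW v WN me dF sF dS).
by apply: (lim_all uW F WR) => // i; rewrite /v; case: cid.
Qed.

Lemma morley_sub Lam Lam' (lt : Lam -> Lam -> Prop) (lt' : Lam' -> Lam' -> Prop)
    (J : Lam -> Type) N (W : forall i, set (set (J i -> M))) e (r : Lam' -> Lam) :
  (forall x y, lt' x y -> lt (r x) (r y)) -> morley lt W N e ->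
  morley lt' (fun i => W (r i)) N (fun i => e (r i)).
Proof.
move=> rh me i S dS; apply: me; apply: def_mono dS => m [|[j [ji [c <-]]]]; first by left.
by right; exists (r j); split; [exact: rh|exists c].
Qed.

(** A subsequence is again a Morley sequence of the same ultrafilter, and the type of such a
    sequence is unique. *)
Lemma morley_ind J N (W : set (set (J -> M))) (e : nat -> J -> M) :
  ultra W -> W (fun x => forall c, N (x c)) ->
  morley ltn_nat (fun _ => W) N e -> ind N e.
Proof.
move=> uW WN me r rh S dS.
have mr := morley_sub (lt' := ltn_nat) rh me.
exact: (morley_unique wo_nat (fun _ => uW) (fun _ => WN) mr me (ddef_unc dS)).
Qed.

Fixpoint downto n := if n is n'.+1 then n' :: downto n' else [::].

Lemma in_downto n i : List.In i (downto n) <-> (i < n).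
Proof.
elim: n => //= n IH; rewrite IH ltnS (leq_eqVlt i n); split.
  by move=> [->|H]; rewrite ?eqxx ?H ?orbT.
by move=> /orP[/eqP|]; [left|right].
Qed.

Lemma dec_downto n : dec ltn_nat (downto n).
Proof. by elim: n => //= n IH; split=> // j /in_downto. Qed.

(** A Morley sequence of a nonprincipal limit of [s] looks like the decreasing selections from [s]:
    the last entry is resolved first, and the earlier ones are then taken beyond it. *)
Lemma morley_row J N (U : set (set nat)) (s : nat -> J -> M) (e : nat -> J -> M) n
    (S : set (nat -> J -> M)) :
  ultra U -> (forall n, U (fun k => (n < k))) -> (forall i c, N (s i c)) ->
  morley ltn_nat (fun _ => push U s) N e ->
  ddef N S -> (forall v w : nat -> J -> M, (forall i, (i < n) -> v i = w i) -> S v <-> S w) ->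
  (forall x : nat -> nat, (forall i j, (i < j < n) -> (x j < x i)) -> S (fun i => s (x i))) ->
  S e.
Proof.
move=> uU nU Ns me dS sS HS.
have uW := ultra_push uU s.
have sF : isupp (downto n) S by move=> v w vw; apply: sS => i /in_downto; apply: vw.
apply/(morley_limE wo_nat (fun _ : nat => uW) e _ me (dec_downto n) sF dS).
  by move=> _; apply: (ultraT uU) => i c; apply: Ns.
(* [b] bounds from below the indices still to be chosen; the entries from [n] on are already fixed
   in [v]. *)
suff H b v : (forall x : nat -> nat, (forall i j, (i < j < n) -> (x j < x i)) ->
    (forall i, (i < n) -> (b < x i)) -> S (fun i => if (i < n) then s (x i) else v i)) ->
    ulim (fun _ => push U s) (downto n) v S.
  apply: (H 0) => x xh _.
  have /sS[Q _] : forall i, (i < n) -> s (x i) = if (i < n) then s (x i) else e i by move=> i ->.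
  exact: Q (HS x xh).
elim: n b v {sS HS sF} => [|n IH] b v H /=.
  by apply: (H id) => [i j|i]; rewrite ltn0 ?andbF.
apply: (ultraS uU _ (nU b)) => a ba; apply: (IH a) => x xh xa.
have := H (fun i => if (i < n) then x i else a).
have -> : (fun i => if (i < n.+1) then s (if (i < n) then x i else a) else v i) =
   (fun i => if (i < n) then s (x i) else updd (J := fun _ => J) v (i := n) (s a) i).
  apply: funext => i; rewrite ltnS (leq_eqVlt i n); case: (ltngtP i n) => [//|ni|->] /=.
    by rewrite updd_neq // => E; rewrite E ltnn in ni.
  by rewrite updd_eq.
apply.
  move=> i j /andP[ij]; rewrite ltnS (leq_eqVlt j n) => /orP[/eqP E|jn].
    by rewrite -E ij ltnn; apply: xa; rewrite -E.
  by rewrite jn (ltn_trans ij jn); apply: xh; rewrite ij.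
move=> i; rewrite ltnS (leq_eqVlt i n) => /orP[/eqP ->|i_n]; first by rewrite ltnn.
by rewrite i_n; apply: ltn_trans ba _; apply: xa.
Qed.

Lemma def_kinc B X J (E : set (X + J -> M)) k (t : 'I_k -> nat) : def B E ->
  ddef (J := fun _ : nat => J) B (fun v => ~ exists x, forall i, E (cat_tup x (v (t i)))).
Proof.
move=> dE; apply: defN.
exact: (def_exI (fun i (c : J) => existT (fun _ : nat => J) (t i) c) (fun _ => dE)).
Qed.

Lemma morley_kinc X J N (U : set (set nat)) (s e : nat -> J -> M) (E : set (X + J -> M)) k :
  ultra U -> (forall n, U (fun k => (n < k))) -> (forall i c, N (s i c)) ->
  morley ltn_nat (fun _ => push U s) N e -> def N E ->
  kinc E k s -> kinc E k e.
Proof.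
move=> uU nU Ns me dE sk t ti.
pose S (v : nat -> J -> M) := ~ exists x, forall i, E (cat_tup x (v (t i))).
apply: (morley_row (S := S) (n := (\max_i t i).+1) uU nU Ns me).
- exact: (def_kinc t dE).
- move=> v w vw; have E' i : v (t i) = w (t i) by apply: vw; rewrite ltnS leq_bigmax.
  by split=> H [y Hy]; apply: H; exists y => i; move: (Hy i); rewrite E'.
move=> r rh; apply: (sk (r \o t)) => i j /= E'; apply: ti; apply/eqP; case: ltngtP => // H.
  by have := rh (t i) (t j); rewrite H ltnS leq_bigmax E' ltnn => /(_ isT).
by have := rh (t j) (t i); rewrite H ltnS leq_bigmax E' ltnn => /(_ isT).
Qed.

Lemma ind_aut B J (s : nat -> J -> M) g : autB B g -> ind B s -> ind B (fun i => g \o s i).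
Proof.
move=> ag si r rh; apply: (@teq_trans _ _ _ _ _ (unc (s \o r))).
  exact: (autB_teq (unc (s \o r)) ag).
apply: (teq_trans (si r rh)); apply: teq_sym; exact: (autB_teq (unc s) ag).
Qed.

(** The conjugates [h i \o a] need not be indiscernible, but a Morley sequence of a nonprincipal
    limit of them is, and it inherits [k]-inconsistency. An automorphism brings its first entry to
    [a]. *)
Lemma div_ind B X J (a : J -> M) (E : set (X + J -> M)) k :
  small K B -> sm K J -> def B E -> sdivk B k (fun x => E (cat_tup x a)) ->
  exists I : nat -> J -> M, [/\ ind B I, I 0 = a & kinc E k I].
Proof.
move=> sB sJ dE [g [ag gk]]; have [Klim sNat _ _ _] := hM.
have [h hP] := autB_invs ag.
pose s i := h i \o a.
pose N := B `|` range (unc s).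
have BN : B `<=` N by left.
have sN : small K N by apply: (smallU Klim) => //; apply: small_range; apply: sm_prod.
have Ns i c : N (s i c) by right; exists (i, c).
have [U [uU nU]] := nonprincipal.
have [e me] := morley_exists (lt := ltn_nat) (J := fun _ => J)
  wo_nat sN (sm_dep_prod (fun _ => tle_refl _) sNat sJ) (fun _ => ultra_push uU s).
have WN : push U s (fun x => forall c, N (x c)) by apply: (ultraT uU).
have ei : ind B e.
  by move=> r rh; apply: teq_mono BN (morley_ind (ultra_push uU s) WN me rh).
have sa i : teq B (s i) a.
  by have [ah _ _] := hP i; apply: (autB_teq a ah).
have e0 : teq B (e 0) a.
  move=> S dS; have dS' : def (N `|` below ltn_nat e 0) S.
    by apply: def_mono dS => m /BN; left.
  rewrite (me 0 S dS'); split=> [/(ultra_ex uU)[i]|Sa]; first by move/(sa i _ dS).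
  by apply: (ultraT uU) => i; apply/(sa i _ dS).
have [g0 ag0 g0e] := homog hM sB sJ e0.
have [h0 [ah0 gh0 hg0]] := autB_inv ag0.
exists (fun i => g0 \o e i); split=> //; first exact: ind_aut.
have sk : kinc E k s.
  move=> t ti [y Hy]; apply: (gk t ti); exists y => i.
  have [ah hh1 hh2] := hP (t i); have := Hy i; rewrite -(def_sum_aut y _ (ag (t i)) dE).
  suff -> : g (t i) \o s (t i) = a by [].
  by apply: funext => c; rewrite /s /= hh2.
move=> t ti [x Hx]; apply: (morley_kinc uU nU Ns me (def_mono BN dE) sk ti).
exists (h0 \o x) => i.
have := Hx i; rewrite -(def_sum_aut x _ ah0 dE).
suff -> : h0 \o (g0 \o e (t i)) = e (t i) by [].
by apply: funext => c /=; rewrite gh0.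
Qed.

(** Compactness from squares of every finite size, combined with the passage to finite tuples. *)
Lemma TP2_finite B X J (E : set (X + J -> M)) k : def B E ->
  (forall l, exists b : nat -> nat -> J -> M,
    (forall i (s : 'I_k -> nat), (i < l) -> (forall t, (s t < l)) -> injective s ->
       ~ exists x, forall t, E (cat_tup x (b i (s t)))) /\
    (forall eta : nat -> nat, (forall i, (eta i < l)) ->
       exists x, forall i, (i < l) -> E (cat_tup x (b i (eta i))))) -> TP2 M.
Proof.
move=> dE Hl; have [Klim sNat _ _ _] := hM.
have [n [f [m [phi [u [fi EE]]]]]] := nfE dE.
case: (carrier_nonempty M) => m0.
(* Every finite tuple can be completed to one indexed by [X], as [f] is injective; this transfers
   inconsistency to finite tuples. *)
have /choice[ext extP] : forall x' : 'I_n -> M, exists x : X -> M, x \o f = x'.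
  move=> x'; have /choice[x xP] : forall z, exists d, forall i, f i = z -> d = x' i.
    move=> z; have [[i iz]|nz] := pselect (exists i, f i = z).
      by exists (x' i) => j; rewrite -iz => /fi ->.
    by exists m0 => i iz; case: nz; exists i.
  by exists x; apply: funext => i; apply: xP.
pose V := (nat * nat * 'I_m)%type.
pose A l : set (V -> M) := fun w =>
    (forall i (s : 'I_k -> nat), (i < l) -> (forall t, (s t < l)) -> injective s ->
       ~ exists x, forall t, sat phi (cat_tup x (fun c => w (i, s t, c)))) /\
    (forall eta : nat -> nat, (forall i, (eta i < l)) ->
       exists x, forall i, (i < l) -> sat phi (cat_tup x (fun c => w (i, eta i, c)))).
have A0 l : exists w, A l w.
  have [b [b1 b2]] := Hl l.
  exists (fun z => cat_tup (b z.1.1 z.1.2) id (u z.2)); split.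
    move=> i s il sl si [x Hx]; apply: (b1 i s il sl si); exists (ext x) => t.
    by apply/EE; rewrite extP; apply: Hx.
  move=> eta el; have [x Hx] := b2 eta el; exists (x \o f) => i il.
  by have /EE := Hx i il.
have Ale l l' : (0 < l) -> (l <= l') -> A l' `<=` A l.
  move=> l0 ll w [w1 w2]; split=> [i s il sl|eta el].
    apply: w1; first exact: leq_trans il ll.
    by move=> t; apply: leq_trans (sl t) ll.
  have [|x Hx] := w2 eta; first by move=> i; apply: leq_trans (el i) ll.
  by exists x => i il; apply: Hx; apply: leq_trans il ll.
have [|||W [uW FW]] := @ultra_exists _ (fun C => exists l, C = A l.+1).
- by exists (A 1), 0.
- move=> _ _ [l ->] [l' ->]; exists (A (maxn l l').+1); first by eexists.
  by move=> w Aw; split; apply: Ale Aw; rewrite // ltnS ?leq_maxl ?leq_maxr.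
- by move=> _ [l ->]; apply: A0.
have WA l : W (A l.+1) by apply: FW; exists l.
have sV : sm K V.
  by apply: (sm_prod Klim (sm_prod Klim sNat sNat)); apply: (@sm_ord K sNat m).
have s0 : small K (@set0 M).
  by apply: (@sm_cover _ _ _ _ (fun _ : nat => m0) _ sNat).
have [v vW] := realize hM uW s0 sV.
exists n, m, phi, k, (fun i j c => v (i, j, c)); split.
  move=> i s si; set S := fun w : V -> M => exists x, forall t : 'I_k, sat phi (cat_tup x (fun c => w (i, s t, c))).
  have dS : def set0 S.
    exact: (@def_exI _ _ set0 'I_n V k (fun _ => 'I_m) (fun _ v => sat phi v) (fun t c => (i, s t, c)) (fun _ => def_sat phi)).
  move=> [x Hx]; have /(vW _ dS) : S v by exists x => t; apply/holds_inst; apply: Hx.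
  apply/(ultraN uW); apply: (ultraS uW _ (WA (maxn i (\max_t s t)))) => w [w1 _].
  apply: w1 => //; first by rewrite ltnS leq_maxl.
  by move=> t; rewrite ltnS leq_max; apply/orP; right; apply: leq_bigmax.
move=> eta r theta Hth.
have /choice[i iP] : forall t, exists i, inst phi (fun c => v (i, eta i, c)) = theta t.
  by move=> t; have [i _ <-] := Hth t; exists i.
pose S := fun w : V -> M => exists x, forall t : 'I_r, sat phi (cat_tup x (fun c => w (i t, eta (i t), c))).
have dS : def set0 S.
  exact: (@def_exI _ _ set0 'I_n V r (fun _ => 'I_m) (fun _ v => sat phi v) (fun t c => (i t, eta (i t), c)) (fun _ => def_sat phi)).
have [x Hx] : S v; last by exists x => t; rewrite -iP; apply/holds_inst.
apply/(vW _ dS).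
pose b := maxn (\max_t i t) (\max_t eta (i t)).
apply: (ultraS uW _ (WA b)) => w [_ w2].
(* Capping [eta] at [b] keeps the path inside the square and leaves the entries in question
   unchanged. *)
have [|x Hx] := w2 (fun j => minn (eta j) b); first by move=> j; rewrite ltnS geq_minr.
exists x => t; have := Hx (i t).
have -> : minn (eta (i t)) b = eta (i t).
  by apply/minn_idPl; rewrite leq_max; apply/orP; right; exact: (@leq_bigmax _ (fun t => eta (i t)) t).
by apply; rewrite ltnS leq_max; apply/orP; left; apply: leq_bigmax.
Qed.

Lemma IP_finite B n J (E : set ('I_n + J -> M)) : def B E ->
  (forall l, exists b : nat -> J -> M, forall P : set nat,
     exists x, forall i, (i < l) -> (E (cat_tup x (b i)) <-> P i)) -> ~ dependent M.
Proof.
move=> dE Hl dep; have [Klim sNat _ _ _] := hM.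
have [m [phi [u EE]]] := nfE_ord dE.
case: (carrier_nonempty M) => m0.
(* One tuple of variables for each subset of [nat]; this index set is small since [K] is a strong
   limit. *)
pose V := (nat * 'I_m + set nat * 'I_n)%type.
pose A l : set (V -> M) := fun w => forall i (P : set nat), (i < l) ->
  sat phi (cat_tup (fun c => w (inr (P, c))) (fun c => w (inl (i, c)))) <-> P i.
have A0 l : exists w, A l w.
  have [b /choice[x xP]] := Hl l.
  exists (cat_tup (fun z => cat_tup (b z.1) id (u z.2)) (fun z => x z.1 z.2)) => i P il /=.
  by rewrite -(xP P i il) EE.
have [|||W [uW FW]] := @ultra_exists _ (fun C => exists l, C = A l).
- by exists (A 0), 0.
- move=> _ _ [l ->] [l' ->]; exists (A (maxn l l')); first by eexists.
  by move=> w Aw; split=> i P il; apply: Aw; rewrite leq_max il ?orbT.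
- by move=> _ [l ->]; apply: A0.
have sV : sm K V.
  apply: (sm_sum Klim (sm_prod Klim sNat (@sm_ord K sNat m))).
  exact: (sm_prod Klim (sm_set Klim sNat) (@sm_ord K sNat n)).
have s0 : small K (@set0 M).
  by apply: (@sm_cover _ _ _ _ (fun _ : nat => m0) _ sNat).
have [v vW] := realize hM uW s0 sV.
apply: (dep n m phi); exists (fun i c => v (inl (i, c))), (fun P c => v (inr (P, c))) => i P.
rewrite holds_inst.
pose h (z : 'I_n + 'I_m) : V := match z with inl c => inr (P, c) | inr c => inl (i, c) end.
have dS := def_comp h (def_sat (M := M) phi).
have E1 w : w \o h = cat_tup (fun c => w (inr (P, c))) (fun c => w (inl (i, c))).
  by apply: funext => -[].
have := vW _ dS; rewrite E1 => ->.
have WA : W (A i.+1) by apply: FW; exists i.+1.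
split=> [H|Pi].
  have [w] := ultra_ex uW (proj2 (ultraI uW _ _) (conj H WA)).
  by rewrite E1 => -[Hw Aw]; apply/(Aw i P).
by apply: (ultraS uW _ WA) => w Aw; rewrite E1; apply/(Aw i P).
Qed.

End Monster.

(** * Strict Morley sequences are strictly independent *)

(** [q] is a global coheir of the type of [a] over [N]. In the last clause the universe, enumerated
    by [id], is replaced by a variable tuple [w]: what [q] says about the universe does not divide
    over [N] when read as a condition on [w]. *)
Definition strict {L} {M : structure L} (N : set M) J (q : set (set (J -> M))) (a : J -> M) :=
  [/\ ultra q, q (fun x => forall c, N (x c)),
      forall S, def N S -> (S a <-> q S) &
      forall th : set (J + M -> M), def N th -> q (fun x => th (cat_tup x id)) ->
        ~ sdiv N (fun w : M -> M => th (cat_tup a w))].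

(** Initial segments of [I] read backwards: this is the effect of [morley_row] on an indiscernible
    sequence. *)
Definition revrow {L} {M : structure L} (N : set M) J (I B : nat -> J -> M) :=
  forall n (S : set ('I_n * J -> M)), def N S ->
    S (fun z => B (val z.1) z.2) <-> S (fun z => I (val (rev_ord z.1)) z.2).

(** Instances chosen by an injection are put in increasing order, so that indiscernibility applies
    to them. *)
Lemma sort_inj k (s : 'I_k -> nat) : injective s ->
  exists2 r : nat -> nat, {homo r : x y / (x < y)} & forall j : 'I_k, exists t, r (val j) = s t.
Proof.
move=> si; pose l := sort leq (codom s).
have ul : uniq l by rewrite sort_uniq map_inj_uniq ?enum_uniq.
have sl : sorted ltn l.
  by rewrite ltn_sorted_uniq_leq ul sort_sorted //; apply: leq_total.
have zl : size l = k by rewrite size_sort size_codom card_ord.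
have [r rh rE] : exists2 r : nat -> nat, {homo r : x y / (x < y)} &
    forall t : 'I_k, r (val t) = nth 0 l (val t).
  apply: (@extend_mono k (fun t : 'I_k => nth 0 l (val t))) => x y xy.
  by apply: (sorted_ltn_nth ltn_trans 0 sl) => //; rewrite inE zl ltn_ord.
exists r => // j; rewrite rE.
have : nth 0 l (val j) \in l by rewrite mem_nth // zl ltn_ord.
by rewrite mem_sort => /codomP[t ->]; exists t.
Qed.

Section Strict.
Context {L : language} {K : Type} {M : structure L}.
Hypothesis hM : mon K M.
Implicit Types (B N D : set M).

Lemma ind_teq B J (s t : nat -> J -> M) : teq B (unc s) (unc t) -> ind B t -> ind B s.
Proof.
move=> st ti r rh.
have E (q : nat -> J -> M) : unc (q \o r) = unc q \o (fun z : nat * J => (r z.1, z.2)) by [].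
apply: (@teq_trans _ _ _ _ _ (unc (t \o r))); first by rewrite !E; apply: teq_comp.
exact: teq_trans (ti r rh) (teq_sym st).
Qed.

Lemma ind_elt B J (s : nat -> J -> M) j : ind B s -> teq B (s j) (s 0).
Proof.
move=> si; have sh : {homo (fun x => x + j) : x y / (x < y)} by move=> x y; rewrite ltn_add2r.
exact: (teq_comp (fun c : J => (0, c)) (si _ sh)).
Qed.

Lemma morley_rev J N N' (U : set (set nat)) (s e : nat -> J -> M) :
  ultra U -> (forall n, U (fun k => (n < k))) -> N `<=` N' -> (forall i c, N' (s i c)) ->
  morley ltn_nat (fun _ => push U s) N' e -> ind N s -> revrow N s e.
Proof.
move=> uU nU NN Ns me si n.
suff H (S : set ('I_n * J -> M)) : def N S -> S (fun z => s (val (rev_ord z.1)) z.2) ->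
    S (fun z => e (val z.1) z.2).
  move=> S dS; split; last exact: H.
  by move=> Se; apply: contrapT => /(H _ (defN dS)).
move=> dS Ss.
apply: (morley_row (n := n) (S := fun v => S (fun z => v (val z.1) z.2)) uU nU Ns me).
- apply: def_mono NN _.
  exact: (def_comp (fun z : 'I_n * J => existT (fun _ : nat => J) (val z.1) z.2) dS).
- move=> v w vw; suff -> : (fun z : 'I_n * J => v (val z.1) z.2) = (fun z => w (val z.1) z.2) by [].
  by apply: funext => z; rewrite vw // ltn_ord.
move=> x xh.
pose T (v : 'I_n * J -> M) := S (v \o (fun z => (rev_ord z.1, z.2))).
have dT : def N T by apply: (def_comp (fun z : 'I_n * J => (rev_ord z.1, z.2)) dS).
have xr : {homo (fun i : 'I_n => x (val (rev_ord i))) : i j / (i < j)}.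
  move=> i j ij; apply: xh; rewrite (ltn_ord (rev_ord i)) andbT /=.
  by apply: ltn_sub2l => //; apply: leq_ltn_trans ij (ltn_ord j).
have vh : {homo (val : 'I_n -> nat) : i j / (i < j)} by [].
have /indiscE/(_ n _ _ xr vh)/tpE/(_ T dT) := si.
rewrite /T /= => H.
have {}H := proj2 H Ss.
move: H; congr (S _); apply: funext => z /=.
by rewrite -[in RHS](rev_ordK z.1).
Qed.

Lemma rev_exists J N (s : nat -> J -> M) : small K N -> sm K J -> ind N s ->
  exists e, [/\ ind N e, revrow N s e & forall j, teq N (e j) (s 0)].
Proof.
move=> sN sJ si; have [Klim sNat _ _ _] := hM.
have [U [uU nU]] := nonprincipal.
pose N' := N `|` range (unc s).
have NN : N `<=` N' by left.
have sN' : small K N' by apply: (smallU Klim) => //; apply: small_range; apply: (sm_prod Klim).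
have Ns i c : N' (s i c) by right; exists (i, c).
have [e me] := morley_exists hM (lt := ltn_nat) (J := fun _ => J)
  wo_nat sN' (sm_dep_prod hM (fun _ => tle_refl _) sNat sJ) (fun _ => ultra_push uU s).
have WN : push U s (fun x => forall c, N' (x c)) by apply: (ultraT uU).
have ei : ind N e.
  by move=> r rh; apply: teq_mono NN (morley_ind (ultra_push uU s) WN me rh).
have er := morley_rev uU nU NN Ns me si.
exists e; split=> // j; apply: (teq_trans (ind_elt j ei)) => S dS.
have := er 1 _ (def_comp (fun c : J => (ord0 : 'I_1, c)) dS); exact.
Qed.

(** By compactness one [R] in [q], on finitely many entries, has to be compatible with one property
    [chi] of the row. If no row fitted the universe, this defect could be added to [R]. Read as a
    condition on [w] it does not divide, so some [w] satisfies it at enough entries of [I]; by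
    indiscernibility these entries begin a row of the kind said not to exist for [w]. *)
Lemma row_strict J N D (q : set (set (J -> M))) (a : J -> M) (I : nat -> J -> M) :
  small K N -> small K D -> sm K J -> strict N q a -> ind N I -> (forall j, teq N (I j) a) ->
  exists I', teq N (unc I') (unc I) /\ forall j S, def (N `|` D) S -> (S (I' j) <-> q S).
Proof.
move=> sN sD sJ [uq qN qa qs] iI Ia; have [Klim sNat _ _ _] := hM.
pose A (chi : set (nat * J -> M)) (R : set (J -> M)) l : set (nat * J -> M) :=
  fun z => chi z /\ forall j, (j < l) -> R (fun c => z (j, c)).
pose F (C : set (nat * J -> M)) := exists chi R l,
  [/\ def N chi, chi (unc I), def (N `|` D) R, q R & C = A chi R l].
have F0 chi R l : def N chi -> chi (unc I) -> def (N `|` D) R -> q R -> exists z, A chi R l.+1 z.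
  move=> dchi chiI dR qR.
  have [th dth Eth] : exists2 th : set (J + M -> M), def N th & forall y, R y <-> th (cat_tup y id).
    by apply: def_split; apply: def_mono dR => m [|_]; [left|right; exists m].
  pose h (j : 'I_l.+1) (s : J + M) : nat * J + M := match s with inl c => inl (val j, c) | inr m => inr m end.
  pose rho (w : M -> M) := exists z : nat * J -> M, chi z /\ forall j : 'I_l.+1, th (cat_tup (fun c => z (val j, c)) w).
  have drho : def N rho.
    have d1 : def N (fun u : nat * J + M -> M => chi (u \o inl) /\ forall j, th (u \o h j)).
      apply: defI; first exact: (def_comp inl dchi).
      apply: (@def_exall _ _ N _ l.+1 (fun j u => th (u \o h j))) => j; exact: (def_comp (h j) dth).
    apply: def_ext (def_ex d1) => w; split=> -[z [cz H]]; exists z; split=> // j; have := H j;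
      (have -> : cat_tup z w \o h j = cat_tup (fun c => z (val j, c)) w by apply: funext => -[]); by [].
  have [[z [cz zR]]|nrho] := pselect (rho id).
    by exists z; split=> // j jl; apply/Eth; apply: (zR (Ordinal jl)).
  exfalso; pose th' (u : J + M -> M) := th u /\ ~ rho (u \o inr).
  have dth' : def N th' by apply: defI => //; apply: defN; apply: (def_comp inr drho).
  apply: (qs th' dth').
    apply: (ultraS uq _ qR) => y /Eth Ry; split=> //.
  have /choice[g gP] : forall j, exists g, autB N g /\ g \o I j = a.
    by move=> j; have [g ag gE] := homog hM sN sJ (Ia j); exists g.
  exists l.+1, g; split=> [i|s si [x Hx]]; first by have [] := gP i.
  have Hx' t : th' (cat_tup (I (s t)) x).
    have [ag gE] := gP (s t); apply/(def_sum_aut _ _ ag dth').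
    rewrite gE; exact: Hx.
  have [_ ] := Hx' ord0; apply.
  have [r rh rE] := sort_inj si.
  exists (unc (I \o r)); split; first by apply/(iI r rh).
  move=> j; have [t rt] := rE j; have [] := Hx' t.
  by rewrite -rt.
have [|||W [uW FW]] := @ultra_exists _ F.
- exists (A (fun _ => True) (fun _ => True) 0), (fun _ => True), (fun _ => True), 0.
  by split=> //; [exact: defT|exact: defT|exact: ultraT].
- move=> _ _ [c [R [l [dc cI dR qR ->]]]] [c' [R' [l' [dc' cI' dR' qR' ->]]]].
  exists (A (fun z => c z /\ c' z) (fun y => R y /\ R' y) (maxn l l')).
    exists (fun z => c z /\ c' z), (fun y => R y /\ R' y), (maxn l l'); split=> //; try exact: defI.
    exact: (proj2 (ultraI uq _ _)).
  move=> z [[cz cz'] H]; split; split=> // j jl.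
    by case: (H j (leq_trans jl (leq_maxl l l'))).
  by case: (H j (leq_trans jl (leq_maxr l l'))).
- move=> _ [c [R [l [dc cI dR qR ->]]]]; have [z [cz H]] := F0 _ _ l dc cI dR qR.
  by exists z; split=> // j jl; apply: H; apply: ltnW.
have [v vW] := realize hM uW (smallU Klim sN sD) (sm_prod Klim sNat sJ).
have uncE : unc (fun j c => v (j, c)) = v by apply: funext => -[].
exists (fun j c => v (j, c)); rewrite uncE; split.
  apply: teq_sym; apply: teq_imp => S dS SI.
  have dS' : def (N `|` D) S by apply: def_mono dS; left.
  apply/(vW _ dS'); apply: (ultraS uW _ (FW (A S (fun _ => True) 0) _)); first by move=> z [].
  by exists S, (fun _ => True), 0; split=> //; [exact: defT|exact: ultraT].
move=> j.
have H S : def (N `|` D) S -> q S -> S (fun c => v (j, c)).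
  move=> dS qS; apply/(vW _ (def_comp (fun c : J => (j, c)) dS)).
  apply: (ultraS uW _ (FW (A (fun _ => True) S j.+1) _)); first by move=> z [_ /(_ j (leqnn _))].
  by exists (fun _ => True), S, j.+1; split=> //; exact: defT.
move=> S dS; split; last exact: H.
by move=> Sv; apply: contrapT => /(ultraN uq) /(H _ (defN dS)).
Qed.

Definition lex Lam (lt : Lam -> Lam -> Prop) (p p' : Lam * nat) :=
  lt p.1 p'.1 \/ p.1 = p'.1 /\ (p.2 < p'.2).

Lemma wo_lex Lam (lt : Lam -> Lam -> Prop) : wo lt -> wo (lex lt).
Proof.
move=> [wf tr tri]; split.
- move=> [i l]; elim/(well_founded_ind wf): i l => i IH l.
  elim/ltn_ind: l => l IHl; constructor => -[j m] [/= ji|/= [-> ml]]; first exact: IH.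
  exact: IHl.
- move=> [i l] [j m] [k n] [/= ij|/= [<- lm]] [/= jk|/= [<- mn]].
  + by left; apply: tr ij jk.
  + by left.
  + by left.
  + by right; split=> //; apply: ltn_trans lm mn.
- move=> [i l] [j m]; case: (tri i j) => [ij|[->|ji]]; first by left; left.
    case: (ltngtP l m) => H; [by left; right| |by right; left; rewrite H].
    by right; right; right.
  by right; right; left.
Qed.

Lemma strict_morley Lam (lt : Lam -> Lam -> Prop) (J : Lam -> Type) N
    (W : forall i, set (set (J i -> M))) (a : forall i, J i -> M) :
  wo lt -> small K N -> sm K {i & J i} -> (forall i, strict N (W i) (a i)) ->
  morley lt W N a -> strictly_independent N a.
Proof.
move=> wolt sN sJ sW ma I indI I0; have [Klim sNat _ _ _] := hM.
have [U [uU nU]] := nonprincipal.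
have iI i : ind N (I i) by apply/indiscE.
have sJi i : sm K (J i) := sm_dep (i := i) sJ.
have uW i : ultra (W i) by have [] := sW i.
have WN i : W i (fun x : J i -> M => forall c, N (x c)) by have [] := sW i.
(* The limits taken below reverse each row once more. *)
have [B BP] : exists B : forall i, nat -> J i -> M, forall i,
    [/\ ind N (B i), revrow N (I i) (B i) & forall j, teq N (B i j) (I i 0)].
  exists (fun i => projT1 (cid (rev_exists sN (sJi i) (iI i)))) => i; by case: cid.
have sNJ : sm K {i & (nat * J i)%type}.
  apply: sm_le (sm_prod Klim sNat sJ).
  exists (fun z => ((projT2 z).1, existT J (projT1 z) (projT2 z).2)) => -[i [l c]] [j [m d]] /= E.
  have E1 : l = m := congr1 fst E; have E2 := congr1 snd E; rewrite {}E1.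
  pose f (z : {i & J i}) := existT (fun i => (nat * J i)%type) (projT1 z) (m, projT2 z).
  exact: (congr1 f E2).
(* Every entry of row [i] is made to realize [W i] over [N] and the earlier rows, so that all paths
   are Morley sequences. *)
have [|e eP] := @rec_exists _ K _ hM _ lt (fun i => (nat * J i)%type) N
  (fun i D x => teq N x (unc (B i)) /\ forall j S, def (N `|` D) S -> (S (fun c => x (j, c)) <-> W i S))
  wolt sN sNJ.
  move=> i D sD; have [iB rB Ba] := BP i.
  have [|I' [H1 H2]] := row_strict sN sD (sJi i) (sW i) iB; first by move=> j; rewrite -I0.
  by exists (unc I').
pose I' i l c := e i (l, c).
have uncI' i : unc (I' i) = e i by apply: funext => -[].
have paths (eta : Lam -> nat) : teq N (tot (fun i => I' i (eta i))) (tot a).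
  apply: (morley_unique wolt uW WN _ ma) => i S dS.
  have [_ /(_ (eta i) S)] := eP i; apply; apply: def_mono dS => m [|[j [ji [c <-]]]]; first by left.
  by right; right; exists j; split=> //; exists (eta j, c).
have iI' i : ind N (I' i).
  have [iB _ _] := BP i; have [H _] := eP i.
  by apply: ind_teq iB; rewrite uncI'.
pose N2 := N `|` range (tot e).
have NN2 : N `<=` N2 by left.
have sN2 : small K N2 by apply: (smallU Klim) => //; apply: small_range.
have I'N i l c : N2 (I' i l c) by right; exists (existT _ i (l, c)).
(* All places of row [i] follow the same limit of [I' i]. Reindexing rows is monotone for the
   lexicographic order, so it yields a Morley sequence of the same ultrafilters; this is the source
   of mutual indiscernibility. *)
pose W2 (p : Lam * nat) : set (set (J p.1 -> M)) := push U (I' p.1).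
have uW2 p : ultra (W2 p) by apply: ultra_push.
have W2N p : W2 p (fun x : J p.1 -> M => forall c, N2 (x c)).
  by apply: (ultraT uU) => l c; apply: I'N.
have sJ2 : sm K {p : Lam * nat & J p.1}.
  apply: sm_le (sm_prod Klim sNat sJ).
  exists (fun z => ((projT1 z).2, existT J (projT1 z).1 (projT2 z))) => -[[i l] c] [[j m] d] /= E.
  have E1 : l = m := congr1 fst E; have E2 := congr1 snd E; rewrite {}E1.
  pose f (z : {i & J i}) := existT (fun p : Lam * nat => J p.1) (projT1 z, m) (projT2 z).
  exact: (congr1 f E2).
have [e2 me2] := morley_exists hM (wo_lex wolt) sN2 sJ2 uW2.
(* The first column is a limit of paths, and all paths have the type of [a]. *)
have col : teq N (tot (fun i => e2 (i, 0))) (tot a).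
  have mc : morley lt (fun i => W2 (i, 0)) N2 (fun i => e2 (i, 0)).
    by apply: (morley_sub (r := fun i => (i, 0)) _ me2) => x y; left.
  apply: teq_sym; apply: teq_ddef => S dS Sa.
  apply: (morley_all (R := fun i x => exists l, x = I' i l) wolt (fun i => uW2 (i, 0)) (fun i => W2N (i, 0)) mc).
  - by move=> i; apply: (ultraT uU) => l; exists l.
  - exact: def_mono NN2 dS.
  - move=> w /choice[eta wE].
    have -> : w = (fun i => I' i (eta i)) by apply: functional_extensionality_dep.
    by apply/(paths eta _ (def_comp id dS)).
have [g ag gE] := homog hM sN sJ col.
pose row2 i (l : nat) : J i -> M := e2 (i, l).
pose I3 i (l : nat) : J i -> M := fun c => g (row2 i l c).
have I30 i : I3 i 0 = a i.
  by apply: funext => c; have := congr1 (fun f => f (existT _ i c)) gE.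
have I3I i : teq N (unc (I3 i)) (unc (I i)).
  apply: (@teq_trans _ _ _ _ _ (unc (row2 i))).
    exact: (autB_teq (unc (row2 i)) ag).
  apply: teq_unc => n S dS.
  have me2i : morley ltn_nat (fun _ => push U (I' i)) N2 (row2 i).
    by apply: (morley_sub (r := fun l => (i, l)) _ me2) => x y; right.
  have r2 := morley_rev uU nU NN2 (I'N i) me2i (iI' i).
  have [iB rB _] := BP i; have [H _] := eP i.
  have dR := def_comp (fun z : 'I_n * J i => (rev_ord z.1, z.2)) dS.
  apply: iff_trans (r2 n S dS) _.
  have H1 := H _ (def_comp (fun z : 'I_n * J i => (val (rev_ord z.1), z.2)) dS).
  apply: iff_trans H1 _.
  apply: iff_trans (rB n _ dR) _.
  have E : (fun z : 'I_n * J i => I i (val (rev_ord z.1)) z.2) \o (fun z => (rev_ord z.1, z.2)) =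
      (fun z => I i (val z.1) z.2) by apply: funext => z; rewrite /= -[in RHS](rev_ordK z.1).
  change (S ((fun z : 'I_n * J i => I i (val (rev_ord z.1)) z.2) \o (fun z => (rev_ord z.1, z.2)))
    <-> S (fun z => I i (val z.1) z.2)).
  by rewrite E.
have shift (r : Lam -> nat -> nat) : (forall i, {homo r i : x y / (x < y)}) ->
    teq N (fun z : {i & (nat * J i)%type} => I3 (projT1 z) (r (projT1 z) (projT2 z).1) (projT2 z).2)
          (fun z => I3 (projT1 z) (projT2 z).1 (projT2 z).2).
  move=> rh.
  have mr : morley (lex lt) W2 N2 (fun p => e2 (p.1, r p.1 p.2)).
    apply: (morley_sub (r := fun p => (p.1, r p.1 p.2)) _ me2) => -[i l] [j m] [/= ij|/= [-> lm]].
      by left.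
    by right; split=> //; apply: rh.
  have H := teq_mono NN2 (morley_unique (wo_lex wolt) uW2 W2N mr me2).
  pose f (z : {i & (nat * J i)%type}) : {p : Lam * nat & J p.1} :=
    existT (fun p : Lam * nat => J p.1) (projT1 z, (projT2 z).1) (projT2 z).2.
  have Hf := teq_comp f H.
  have t1 v : teq N (g \o v) v := autB_teq (V := {i & (nat * J i)%type}) v ag.
  exact: teq_trans (t1 _) (teq_trans Hf (teq_sym (t1 _))).
exists I3; split.
  (* Both rows begin with [a i], so equal types over [N] are already equal over [N] and [a i]. *)
  move=> i; apply/tpE => S dS.
  have [E dE EE] := def_split dS.
  pose h (s : nat * J i + J i) : nat * J i := match s with inl z => z | inr c => (0, c) end.
  have Eh (s : nat -> J i -> M) : s 0 = a i -> cat_tup (unc s) (a i) = unc s \o h.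
    by move=> s0; apply: funext => -[z|c] //=; rewrite /unc /= s0.
  apply: iff_trans (EE _) _; apply: iff_trans (iff_sym (EE _)).
  rewrite -/(unc (I3 i)) -/(unc (I i)) (Eh _ (I30 i)) (Eh _ (I0 i)).
  exact: (I3I i _ (def_comp h dE)).
move=> i; apply/indiscE => r rh S dS.
pose Z := {z : {i & (nat * J i)%type} | projT1 z <> i}.
pose b (z : Z) : M := let y := proj1_sig z in I3 (projT1 y) (projT2 y).1 (projT2 y).2.
have [E dE EE] : exists2 E : set (nat * J i + Z -> M), def N E & forall x, S x <-> E (cat_tup x b).
  apply: def_split; apply: def_mono dS => m [|[j ji [[l c] _ <-]]]; first by left.
  by right; exists (exist _ (existT (fun i => (nat * J i)%type) j (l, c)) ji).
pose h (s : nat * J i + Z) : {i & (nat * J i)%type} :=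
  match s with inl z => existT _ i z | inr z => proj1_sig z end.
(* Only row [i] is reindexed, and the parameters from the other rows stay in place. *)
pose r' j := if `[< j = i >] then r else id.
have r'h j : {homo r' j : x y / (x < y)}.
  by move=> x y xy; rewrite /r'; case: asboolP => // _; apply: rh.
have := shift r' r'h _ (def_comp h dE).
move=> H.
have E1 : S (unc (I3 i \o r)) <-> E ((fun z : {i & (nat * J i)%type} =>
    I3 (projT1 z) (r' (projT1 z) (projT2 z).1) (projT2 z).2) \o h).
  apply: iff_trans (EE _) _; set u := cat_tup _ _; set u' := (_ \o _).
  suff -> : u = u' by [].
  apply: funext => -[[l c]|[z zi]]; rewrite /u /u' /= /r'; first by case: asboolP.
  by case: asboolP => // zi'; case: zi.
have E2 : S (unc (I3 i)) <-> E ((fun z : {i & (nat * J i)%type} =>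
    I3 (projT1 z) (projT2 z).1 (projT2 z).2) \o h).
  apply: iff_trans (EE _) _; set u := cat_tup _ _; set u' := (_ \o _).
  by suff -> : u = u' by []; apply: funext => -[].
exact: iff_trans E1 (iff_trans H (iff_sym E2)).
Qed.

End Strict.

(** * From bounds on the theory to bounds on the pre-weight *)

Lemma inf_fiber X Y (f : X -> Y) : ~ tle X (Y * nat) ->
  exists y (g : nat -> X), injective g /\ forall i, f (g i) = y.
Proof.
move=> nXY; apply: contrapT => H; apply: nXY.
have /choice[g gP] : forall y, exists g : X -> nat, forall a b, f a = y -> f b = y -> g a = g b -> a = b.
  move=> y; case: (tle_total nat {x | f x = y}) => -[h hi].
    case: H; exists y, (fun i => proj1_sig (h i)); split=> [i j E|i]; last exact: proj2_sig (h i).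
    apply: hi; move: E; case: (h i) => a ay; case: (h j) => b bY /= ab; subst b.
    by congr exist; apply: Prop_irrelevance.
  exists (fun x => if pselect (f x = y) is left E then h (exist _ x E) else 0) => a b fa fb.
  case: pselect => // Ea; case: pselect => // Eb /hi ab.
  exact: (congr1 (@proj1_sig _ _) ab).
by exists (fun x => (f x, g (f x) x)) => a b [E1 E2]; apply: (gP (f a)) => //; rewrite E2 E1.
Qed.

(** Fewer than [k] numbers below [eta + k] lie in [P], so at least [eta] of them can precede
    position [eta]; the later positions are taken beyond the last point of [P]. *)
Lemma sparse_pattern (P : set nat) k eta :
  (forall s : 'I_k -> nat, injective s -> ~ forall t, P (s t)) ->
  exists r : nat -> nat, [/\ {homo r : x y / (x < y)}, r eta = (eta + k) &
    forall j, j <> eta -> ~ P (r j)].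
Proof.
move=> Pk.
have [l0 lP] : exists l0, forall p, (l0 <= p) -> ~ P p.
  apply: contrapT => H.
  have /choice[f fP] : forall l, exists p, (l <= p) /\ P p.
    move=> l; apply: contrapT => nl; apply: H; exists l => p lp Pp; apply: nl; by exists p.
  pose s t := iter t (fun x => f x.+1) (f 0).
  have sh : {homo s : x y / (x < y)}.
    apply: homo_ltn; first exact: ltn_trans.
    by move=> i /=; have [] := fP (s i).+1.
  apply: (Pk (fun t => s (val t))) => [i j E|t].
    by apply/val_inj/eqP; case: ltngtP => // /sh; rewrite E ltnn.
  by rewrite /s; case: (val t) => [|q] /=; apply: (proj2 (fP _)).
pose fl := [seq p <- iota 0 (eta + k) | ~~ `[< P p >]].
pose tl := [seq p <- iota 0 (eta + k) | `[< P p >]].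
have ut : uniq tl by rewrite filter_uniq ?iota_uniq.
have tk : (size tl < k).
  rewrite ltnNge; apply/negP => kt.
  have lt_t (t : 'I_k) : (t < size tl) := leq_trans (ltn_ord t) kt.
  apply: (Pk (fun t => nth 0 tl (val t))) => [i j /eqP|t].
    by rewrite nth_uniq ?lt_t // => /eqP/val_inj.
  have : nth 0 tl (val t) \in tl by rewrite mem_nth ?lt_t.
  by rewrite mem_filter => /andP[/asboolP].
have ef : (eta <= size fl).
  have : (size tl + size fl = eta + k) by rewrite !size_filter count_predC size_iota.
  move=> E; rewrite -(leq_add2l (size tl)) E addnC leq_add2l; exact: ltnW.
have sf : sorted ltn fl by apply: sorted_filter (iota_ltn_sorted _ _); apply: ltn_trans.
have fl_in j : (j < eta) -> nth 0 fl j \in fl by move=> je; rewrite mem_nth // (leq_trans je).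
have flb j : (j < eta) -> (nth 0 fl j < eta + k) /\ ~ P (nth 0 fl j).
  by move/fl_in; rewrite mem_filter mem_iota add0n => /andP[/asboolP nP /andP[_ H]].
exists (fun j => if (j < eta) then nth 0 fl j else if j == eta then (eta + k) else (eta + k + l0 + j)).
split; last 1 first.
- move=> j /eqP je; case: ifP => [/flb[]//|_]; rewrite (negbTE je).
  by apply: lP; rewrite addnAC leq_addl.
- move=> x y xy; case: (ltngtP x eta) => [xe|ex|xe].
  + have [H _] := flb x xe.
    case: (ltngtP y eta) => [ye|ey|ye].
    * by apply: (sorted_ltn_nth ltn_trans 0 sf) => //; rewrite inE; apply: leq_trans ef.
    * by apply: leq_trans H _; rewrite -addnA leq_addr.
    * exact: H.
  + by rewrite (leq_gtF (ltnW (ltn_trans ex xy))) (gtn_eqF (ltn_trans ex xy)) ltn_add2l.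
  + subst x; rewrite (leq_gtF (ltnW xy)) (gtn_eqF xy).
    rewrite -addnA -[X in (X < _)]addn0 ltn_add2l.
    by apply: leq_ltn_trans (leq0n eta) _; apply: leq_trans xy (leq_addl _ _).
- by rewrite ltnn eqxx.
Qed.

Section Rows.
Context {L : language} {K : Type} {M : structure L}.
Hypothesis hM : mon K M.
Implicit Types (B N D : set M).

Definition mut Lam (J : Lam -> Type) B (I : forall i, nat -> J i -> M) :=
  forall r : Lam -> nat -> nat, (forall i, {homo r i : x y / (x < y)}) ->
  forall S : set (forall i, nat * J i -> M), ddef B S ->
  S (fun i => unc (I i \o r i)) <-> S (fun i => unc (I i)).

(** The way strict independence is used: sequences witnessing dividing for each [a i] separately
    become mutually indiscernible without moving the [a i]. *)
Lemma strict_rows Lam (J : Lam -> Type) B (a : forall i, J i -> M) X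
    (E : forall i, set (X + J i -> M)) (k : Lam -> nat) :
  small K B -> (forall i, sm K (J i)) -> strictly_independent B a ->
  (forall i, def B (E i)) -> (forall i, sdivk B (k i) (fun x => E i (cat_tup x (a i)))) ->
  exists I : forall i, nat -> J i -> M,
    [/\ forall i, I i 0 = a i, mut B I &
      forall i, kinc (E i) (k i) (I i)].
Proof.
move=> sB sJ sa dE dvE.
pose c i := cid (div_ind hM sB (sJ i) (dE i) (dvE i)).
pose I0 i := projT1 (c i).
have I0P i : [/\ ind B (I0 i), I0 i 0 = a i &
    kinc (E i) (k i) (I0 i)].
  exact: (projT2 (c i)).
have [||I [IP mI]] := sa I0.
- by move=> i; apply/indiscE; have [] := I0P i.
- by move=> i; have [] := I0P i.
have tI i : teq (B `|` range (a i)) (unc (I i)) (unc (I0 i)) by apply/tpE; apply: IP.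
exists I; split.
- move=> i; apply: funext => j; have [_ a0 _] := I0P i.
  have Ba : (B `|` range (a i)) (a i j) by right; exists j.
  by have [_] := tI i _ (def_eqp (0, j) Ba); apply; rewrite /unc /= a0.
- exact: (mutual mI).
- move=> i s si; have [_ _ /(_ s si)] := I0P i.
  have dS := defN (@def_exI _ _ B X (nat * J i)%type (k i) (fun _ => J i) (fun _ => E i) (fun t c => (s t, c)) (fun _ => dE i)).
  have BB : B `<=` B `|` range (a i) by left.
  by have [_] := tI i _ (def_mono BB dS).
Qed.

(** Mutual indiscernibility carries consistency of the first column over to every path. *)
Lemma rows_TP2 Lam (J : Lam -> Type) B n m (E : forall i, set ('I_n + J i -> M))
    (I : forall i, nat -> J i -> M) (f : nat -> Lam) k
    (phi : formula L ('I_n + 'I_m)) (u : forall i, 'I_m -> J (f i) + M) :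
  (forall i, def B (E i)) -> mut B I -> injective f ->
  (forall i x y, E (f i) (cat_tup x y) <-> sat phi (cat_tup x (cat_tup y id \o u i))) ->
  (forall i, kinc (E (f i)) k (I (f i))) ->
  (forall l, exists x, forall i, (i < l) -> E (f i) (cat_tup x (I (f i) 0))) -> TP2 M.
Proof.
move=> dE mI fi EE Ik I0; apply: (TP2_finite hM (k := k) (def_sat (M := M) phi)) => l.
exists (fun i j => cat_tup (I (f i) j) id \o u i); split.
  by move=> i s _ _ si [x Hx]; apply: (Ik i s si); exists x => t; apply/EE.
move=> eta _.
pose S (v : forall i, nat * J i -> M) :=
  exists x, forall i : 'I_l, E (f i) (cat_tup x (fun c => v (f i) (0, c))).
have dS : ddef B S.
  exact: (def_exI (fun (i : 'I_l) (c : J (f i)) => existT (fun i => (nat * J i)%type) (f i) (0, c)) (fun i => dE (f i))).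
have /choice[eta' etaP] : forall j, exists e, forall i, f i = j -> e = eta i.
  move=> j; have [[i ij]|ni] := pselect (exists i, f i = j).
    by exists (eta i) => i'; rewrite -ij => /fi ->.
  by exists 0 => i ij; case: ni; exists i.
have [x Hx] : S (fun i => unc (I i \o (addn (eta' i)))).
  apply/mI => //; first by move=> i x y; rewrite ltn_add2l.
  by have [x Hx] := I0 l; exists x => i; apply: Hx.
exists x => i il; apply/EE; have := Hx (Ordinal il).
by rewrite /unc /= addn0 (etaP _ i).
Qed.

(** By inconsistency row [i] has an entry that fails at [d]. Starting the row there negates the
    condition on its first entry, so [d] shows every sign pattern on the first column. *)
Lemma rows_IP B n m (E : set ('I_n + 'I_m -> M)) (I : nat -> nat -> 'I_m -> M) (k : nat -> nat) d :
  def B E -> mut (J := fun _ : nat => 'I_m) B I ->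
  (forall i, kinc E (k i) (I i)) ->
  (forall i, E (cat_tup d (I i 0))) -> ~ dependent M.
Proof.
move=> dE mI Ik Id; apply: (IP_finite hM dE) => l; exists (fun i => I i 0) => P.
have /choice[j jP] : forall i, exists j, ~ E (cat_tup d (I i j)).
  move=> i; apply: contrapT => H; apply: (Ik i val val_inj); exists d => t.
  by apply: contrapT => Hn; apply: H; exists (val t).
pose S (v : forall i : nat, nat * 'I_m -> M) :=
  exists x, forall i : 'I_l, E (cat_tup x (fun c => v i (0, c))) <-> P i.
have dS : ddef (J := fun _ : nat => (nat * 'I_m)%type) B S.
  apply: (@def_exI _ _ B 'I_n _ l (fun _ => 'I_m) (fun i u => E u <-> P i)
    (fun i c => existT (fun _ : nat => (nat * 'I_m)%type) (val i) (0, c))) => i.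
  have [Pi|nPi] := pselect (P i).
    by apply: def_ext dE => v; tauto.
  by apply: def_ext (defN dE) => v; tauto.
pose r i := addn (if `[< P i >] then 0 else j i).
have [x Hx] : S (fun i => unc (I i)).
  apply/(mI r _ S dS); first by move=> i x y; rewrite ltn_add2l.
  exists d => i; rewrite /unc /r /= addn0; case: asboolP => Pi; first by split.
  by split=> // /jP.
by exists x => i il; apply: (Hx (Ordinal il)).
Qed.

(** Shifting the rows gives an [x] that satisfies row [i] at position [eta i + k i]. This leaves
    [sparse_pattern] enough room to thin the row out until only position [eta i] is satisfied. *)
Lemma rows_not_sd B n (J : nat -> Type) (E : forall i, set ('I_n + J i -> M))
    (I : forall i, nat -> J i -> M) (k : nat -> nat) d :
  (forall i, def B (E i)) -> mut B I ->
  (forall i, kinc (E i) (k i) (I i)) ->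
  (forall i, E i (cat_tup d (I i 0))) -> ~ strongly_dependent M.
Proof.
move=> dE mI Ik Id; apply.
pose c1 i := cid (nfE_ord (dE i)); pose c2 i := cid (projT2 (c1 i)); pose c3 i := cid (projT2 (c2 i)).
pose m i := projT1 (c1 i); pose phi i : formula L ('I_n + 'I_(m i)) := projT1 (c2 i).
pose u i : 'I_(m i) -> J i + M := projT1 (c3 i).
have EE i x y : E i (cat_tup x y) <-> sat (phi i) (cat_tup x (cat_tup y id \o u i)) := projT2 (c3 i) x y.
exists n, m, phi, (fun i j => cat_tup (I i j) id \o u i) => eta r theta Hth.
pose b i j := cat_tup (I i j) id \o u i.
have /choice[z zP] : forall t, exists z, theta t =
    (if eta z.1 == z.2 then inst (phi z.1) (b z.1 z.2) else Neg (inst (phi z.1) (b z.1 z.2))).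
  by move=> t; have [z _ <-] := Hth t; exists z.
pose l := (maxn (\max_t (z t).1) (\max_t (z t).2)).+1.
pose S1 (v : forall i, nat * J i -> M) := exists x, forall i : 'I_l, E i (cat_tup x (fun c => v i (0, c))).
have dS1 : ddef B S1.
  exact: (def_exI (fun (i : 'I_l) (c : J i) => existT (fun i => (nat * J i)%type) (val i) (0, c)) (fun i => dE (val i))).
have [x Hx] : S1 (fun i => unc (I i \o (addn (eta i + k i)))).
  apply/mI => //; first by move=> i x y; rewrite ltn_add2l.
  by exists d => i; apply: Id.
have /choice[q qP] : forall i, exists q : nat -> nat, {homo q : x y / (x < y)} /\
    ((i < l) -> q (eta i) = (eta i + k i) /\ forall j, j <> eta i -> ~ E i (cat_tup x (I i (q j)))).
  move=> i; have [|q [qh q1 q2]] := @sparse_pattern (fun j => E i (cat_tup x (I i j))) (k i) (eta i).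
    by move=> s si Hs; apply: (Ik i s si); exists x.
  by exists q.
pose S (v : forall i, nat * J i -> M) :=
  exists x, forall i : 'I_l, forall j : 'I_l, E i (cat_tup x (fun c => v i (val j, c))) <-> val j = eta i.
have dS : ddef B S.
  pose h i (j : 'I_l) (s : 'I_n + J i) : 'I_n + nat * J i := match s with inl x => inl x | inr c => inr (val j, c) end.
  have dE' (i : 'I_l) : def B (fun w : 'I_n + nat * J i -> M => forall j : 'I_l, E i (w \o h i j) <-> val j = eta i).
    apply: (@def_exall _ _ B _ l (fun j w => E i (w \o h i j) <-> val j = eta i)) => j.
    have dj := def_comp (h i j) (dE i).
    have [je|nje] := pselect (val j = eta i); first by apply: def_ext dj => v; tauto.
    by apply: def_ext (defN dj) => v; tauto.
  apply: def_ext (def_exI (fun (i : 'I_l) (s : nat * J i) => existT (fun i => (nat * J i)%type) (val i) s) dE') => w.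
  have Eh y (i j : 'I_l) (v : nat * J i -> M) : cat_tup y v \o h i j = cat_tup y (fun c => v (val j, c)).
    by apply: funext => -[].
  by split=> -[y Hy]; exists y => i j; have := Hy i j; rewrite Eh.
have [y Hy] : S (fun i => unc (I i)).
  apply/(mI q _ S dS); first by move=> i; have [] := qP i.
  exists x => i j; have [_ /(_ (ltn_ord i))[q1 q2]] := qP i.
  split=> [Ex|jE]; first by apply: contrapT => /q2; apply.
  by have := Hx i; rewrite /unc /= addn0 jE q1.
exists y => t; rewrite zP.
have z1 : ((z t).1 < l) by rewrite ltnS leq_max (@leq_bigmax _ (fun t => (z t).1)).
have z2 : ((z t).2 < l) by rewrite ltnS leq_max (@leq_bigmax _ (fun t => (z t).2)) orbT.
have := Hy (Ordinal z1) (Ordinal z2); rewrite /= EE => H.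
case: eqP => [E1|nE1]; first by apply/holds_inst/H.
by move=> /holds_inst/H E1; apply: nE1.
Qed.

Lemma preweight_rows Lam n B (p : set (pformula M 'I_n)) : small K B ->
  preweight_ge K (ind_d M) B p Lam ->
  exists (J : Lam -> Type) (E : forall i, set ('I_n + J i -> M)) (k : Lam -> nat)
    (I : forall i, nat -> J i -> M) d,
    [/\ forall i, def B (E i), mut B I, forall i, kinc (E i) (k i) (I i) & forall i, E i (cat_tup d (I i 0))].
Proof.
move=> sB [J [a [sJ sa [d _ da]]]].
have sJ' i : sm K (J i) by apply/smallT.
have /choice[psi psiP] : forall i, exists psi, tp (B `|` range (a i)) d psi /\ divides B psi.
  by move=> i; have /contrapT[psi ? ?] := da i; exists psi.
have H1 i : exists E : set ('I_n + J i -> M), def B E /\ holds (psi i) = (fun x => E (cat_tup x (a i))).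
  have [[o _] _] := psiP i.
  have dh : def (B `|` range (a i)) (holds (psi i)) by exists (psi i).
  have [E dE EE] := def_split dh; exists E; split=> //.
  by apply: funext => x; apply/propext.
pose E i := projT1 (cid (H1 i)).
have [dE EP] : (forall i, def B (E i)) /\ forall i, holds (psi i) = (fun x => E i (cat_tup x (a i))).
  by split=> i; rewrite /E; case: cid => E' /= [].
have /choice[k dvk] : forall i, sdiv B (fun x => E i (cat_tup x (a i))).
  by move=> i; have [_ /(dividesP hM _ sB)] := psiP i; rewrite EP.
have [I [I0 mI Ik]] := strict_rows sB sJ' sa dE dvk.
exists J, E, k, I, d; split=> // i.
by rewrite I0; have [[_]] := psiP i; rewrite EP.
Qed.

Lemma ntp2_preweight Tplus : succ_card (formula L nat) Tplus -> NTP2 M ->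
  types_preweight_lt K (ind_d M) Tplus.
Proof.
move=> [[_ nTF] _] ntp n B p sB _ /(preweight_rows sB)[J [E [k [I [d [dE mI Ik Id]]]]]].
pose c1 i := cid (nfE_ord (dE i)); pose c2 i := cid (projT2 (c1 i)); pose c3 i := cid (projT2 (c2 i)).
pose m i := projT1 (c1 i); pose phi i : formula L ('I_n + 'I_(m i)) := projT1 (c2 i).
pose u i : 'I_(m i) -> J i + M := projT1 (c3 i).
have EE i x y : E i (cat_tup x y) <-> sat (phi i) (cat_tup x (cat_tup y id \o u i)) := projT2 (c3 i) x y.
pose e m (s : 'I_n + 'I_m) : nat := match s with inl i => val i | inr j => (n + j) end.
have ei m' : injective (e m').
  move=> [i|i] [j|j] /= E'.
  - by congr inl; apply: val_inj.
  - by have := ltn_ord i; rewrite /= E' -ltn_subRL subnn.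
  - by have := ltn_ord j; rewrite /= -E' -ltn_subRL subnn.
  - by congr inr; apply/val_inj/eqP; rewrite -(eqn_add2l n) E'.
pose tag (i : nat) : formula L nat := Eq (Var L i) (Var L i).
(* The formula, the length of its parameter tuple and the number [k] are packed into one formula, so
   that there are at most |T| codes. *)
pose code i : formula L nat := And (frename (e (m i)) (phi i)) (And (tag (m i)) (tag (k i))).
have [|y [f [fi fy]]] := @inf_fiber Tplus (formula L nat) code.
  move=> TF; apply: nTF; apply/card_leT_tle; apply: tle_trans TF _.
  by exists (fun q => And q.1 (tag q.2)) => -[q1 i] [q2 j] [-> ->].
apply: ntp.
have codeE i : code (f i) = code (f 0) by rewrite !fy.
have H2 i : k (f i) = k (f 0) /\ exists u' : 'I_(m (f 0)) -> J (f i) + M,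
    forall x y, E (f i) (cat_tup x y) <-> sat (phi (f 0)) (cat_tup x (cat_tup y id \o u')).
  have := codeE i; rewrite /code => -[E1 E2 _ E3 _]; split=> //.
  (* Once the lengths are identified, equality of the renamed formulas suffices, because the
     renaming is injective and any valuation factors through it. *)
  have EEi := EE (f i); move: (phi (f i)) (u (f i)) E1 EEi; rewrite E2 => phi' u' E1 EEi.
  exists u' => x z; rewrite EEi; set w := cat_tup _ _.
  case: (carrier_nonempty M) => m0.
  have /choice[w' w'P] : forall j, exists y0, forall s, e (m (f 0)) s = j -> y0 = w s.
    move=> j; have [[s sj]|ns] := pselect (exists s, e (m (f 0)) s = j).
      by exists (w s) => s'; rewrite -sj => /ei ->.
    by exists m0 => s sj; case: ns; exists s.
  have <- : w' \o e (m (f 0)) = w by apply: funext => s; apply: w'P.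
  apply: iff_trans (iff_sym (sat_frename phi' (e (m (f 0))) w')) _.
  by rewrite E1; apply: sat_frename.
pose u' i := projT1 (cid (proj2 (H2 i))).
have u'P i : forall x y, E (f i) (cat_tup x y) <-> sat (phi (f 0)) (cat_tup x (cat_tup y id \o u' i)) := projT2 (cid (proj2 (H2 i))).
apply: (rows_TP2 (f := f) (k := k (f 0)) dE mI fi u'P).
  by move=> i; rewrite -(proj1 (H2 i)); apply: Ik.
by move=> l; exists d => i _.
Qed.

Lemma sd_preweight : strongly_dependent M -> types_preweight_lt K (ind_d M) nat.
Proof.
move=> sd n B p sB _ /(preweight_rows sB)[J [E [k [I [d [dE mI Ik Id]]]]]].
exact: (rows_not_sd dE mI Ik Id sd).
Qed.

Lemma sd_dependent : strongly_dependent M -> dependent M.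
Proof.
move=> sd n m phi [a [b ab]]; apply: sd.
(* The shattered sequence is arranged as an array by a pairing code. *)
exists n, (fun _ => m), (fun _ => phi), (fun i j => a (pickle (i, j))) => eta r theta Hth.
exists (b (fun q => exists i, q = pickle (i, eta i))) => t.
have [z _ <-] := Hth t; case: eqP => E /=.
  by apply/ab; exists z.1; rewrite E.
move=> /ab[i /(pcan_inj pickleK)[E1 E2]]; apply: E; by rewrite E1 E2.
Qed.

Lemma ind_pair B J (s : nat -> J -> M) i j : ind B s -> (i < j) ->
  teq B (cat_tup (s i) (s j)) (cat_tup (s 0) (s 1)).
Proof.
move=> si ij.
have [|r rh rE] := @extend_mono 2 (fun t => if val t == 0 then i else j).
  by move=> [[|[|x]] hx] [[|[|y]] hy].
have r0 : r 0 = i := rE ord0.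
have r1 : r 1 = j := rE (lift ord0 ord0).
pose h (z : J + J) : nat * J := match z with inl c => (0, c) | inr c => (1, c) end.
have := teq_comp h (si r rh).
have E (q : nat -> nat) : unc (s \o q) \o h = cat_tup (s (q 0)) (s (q 1)) by apply: funext => -[].
by rewrite E r0 r1 (E id).
Qed.

(** If the formula did not divide, some [x] would satisfy arbitrarily many of its conjugates along
    disjoint consecutive pairs of [s], hence take both truth values in each pair. Choosing one entry
    per pair according to [P] gives an increasing selection on which [x] shows the pattern [P]. *)
Lemma split_div n m r (phi : formula L ('I_n + ('I_m + 'I_r))) B (b0 : 'I_r -> M)
    (s : nat -> 'I_m -> M) i j : dependent M -> small K B -> (forall c, B (b0 c)) -> ind B s ->
  sdiv B (holds (And (inst phi (cat_tup (s i) b0)) (Neg (inst phi (cat_tup (s j) b0))))).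
Proof.
move=> dep sB Bb si; have [Klim sNat _ _ _] := hM.
have [ij|ij] := pselect (i = j).
  exists 1, (fun _ => id); split=> [_|u _ [x /(_ ord0)]]; first exact: autB_id.
  by rewrite ij => -[? ?].
pose c1 := s i; pose c2 := s j.
have si1 : s i = c1 by []. have sj2 : s j = c2 by [].
rewrite -/c1 -/c2; apply: contrapT => nd.
pose f (z : 'I_n + ('I_m + 'I_r)) : ('I_n + 'I_m) + M := match z with
  | inl x => inl (inl x) | inr (inl y) => inl (inr y) | inr (inr w) => inr (b0 w) end.
have fB z m0 : f z = inr m0 -> B m0 by case: z => // -[] // w [<-].
pose E (v : 'I_n + 'I_m -> M) := sat phi (cat_tup v id \o f).
have dE : def B E := def_subst fB (def_mono (sub0set B) (def_sat phi)).
have EE x y : holds (inst phi (cat_tup y b0)) x <-> E (cat_tup x y).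
  rewrite holds_inst /E; have -> // : cat_tup (cat_tup x y) id \o f = cat_tup x (cat_tup y b0).
  by apply: funext => -[|[]].
(* Inside pair [t] the entries [p t] and [q t] are ordered as [i] and [j] are, so that the pair is
   conjugate to the given one. *)
have [p [q [pq pqE]]] : exists p q : nat -> nat,
    (forall t, (t.*2 <= p t <= t.*2.+1) /\ (t.*2 <= q t <= t.*2.+1)) /\
    forall t, teq B (cat_tup (s (p t)) (s (q t))) (cat_tup c1 c2).
  have H t : teq B (cat_tup (s t.*2) (s t.*2.+1)) (cat_tup (s 0) (s 1)) by apply: ind_pair.
  have b1 t : (t.*2 <= t.*2 <= t.*2.+1) by rewrite leqnn leqnSn.
  have b2 t : (t.*2 <= t.*2.+1 <= t.*2.+1) by rewrite leqnn leqnSn.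
  case: (ltngtP i j) => // lij.
    exists double, (fun t => t.*2.+1); split=> // t.
    by rewrite -si1 -sj2; apply: teq_trans (H t) (teq_sym (ind_pair si lij)).
  exists (fun t => t.*2.+1), double; split=> // t.
  pose h (z : 'I_m + 'I_m) : 'I_m + 'I_m := match z with inl c => inr c | inr c => inl c end.
  have := teq_comp h (teq_trans (H t) (teq_sym (ind_pair si lij))); rewrite si1 sj2.
  have Eh (u v : 'I_m -> M) : cat_tup u v \o h = cat_tup v u by apply: funext => -[].
  by rewrite !Eh.
have /choice[g gP] : forall t, exists g, [/\ autB B g, g \o s (p t) = c1 & g \o s (q t) = c2].
  move=> t; have [g ag gE] := homog hM sB (sm_sum Klim (@sm_ord K sNat m) (@sm_ord K sNat m)) (pqE t).
  exists g; split=> //; apply: funext => c.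
    exact: (congr1 (fun v => v (inl c)) gE).
  exact: (congr1 (fun v => v (inr c)) gE).
apply: (IP_finite hM dE) dep => l; exists s => P.
have [u [x [ui Hx]]] : exists (u : 'I_l -> nat) x, injective u /\
    forall t, E (cat_tup x (s (p (u t)))) /\ ~ E (cat_tup x (s (q (u t)))).
  apply: contrapT => H; apply: nd; exists l, g; split=> [t|u ui [x Hx]]; first by have [] := gP t.
  apply: H; exists u, x; split=> // t; have [ag g1 g2] := gP (u t).
  have [/EE h1 /= h2] := Hx t; split.
    by apply/(def_sum_aut _ _ ag dE); rewrite g1.
  by move=> /(def_sum_aut _ _ ag dE); rewrite g2 => /EE.
have [r0 rh rE] := sort_inj ui.
pose pi t := if `[< P t >] then p (r0 t) else q (r0 t).
have pib t : ((r0 t).*2 <= pi t <= (r0 t).*2.+1).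
  by have [? ?] := pq (r0 t); rewrite /pi; case: asboolP.
have pih : {homo pi : x y / (x < y)}.
  move=> t t' tt'; have /andP[_ h1] := pib t; have /andP[h2 _] := pib t'.
  apply: leq_ltn_trans h1 _; apply: leq_trans h2.
  by rewrite -doubleS leq_double; apply: rh.
pose S (v : nat * 'I_m -> M) := exists x, forall i : 'I_l, E (cat_tup x (fun c => v (val i, c))) <-> P i.
have dS : def B S.
  apply: (@def_exI _ _ B 'I_n _ l (fun _ => 'I_m) (fun i u => E u <-> P i) (fun i c => (val i, c))) => t.
  have [Pi|nPi] := pselect (P t); first by apply: def_ext dE => v; tauto.
  by apply: def_ext (defN dE) => v; tauto.
have [y Hy] : S (unc s); last by exists y => t tl; apply: (Hy (Ordinal tl)).
apply/(si pi pih S dS); exists x => t; rewrite /unc /pi /=.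
have [t' rt] := rE t; have [h1 h2] := Hx t'.
by case: asboolP => Pt; rewrite -/(r0 t) rt; split.
Qed.

Lemma dependent_split n (d : 'I_n -> M) B b : dependent M -> small K B ->
  ~ ind_s M n d B b -> ~ ind_d M n d B b.
Proof.
move=> dep sB /contrapT [m [r [phi [b0 [c1 [c2 [Bb _ pd [s [/indiscE si [i [j [si1 sj2]]]]]]]]]]]].
apply; exists (And (inst phi (cat_tup c1 b0)) (Neg (inst phi (cat_tup c2 b0)))) => //.
by apply/(dividesP hM _ sB); rewrite -si1 -sj2; apply: split_div.
Qed.

End Rows.

(** * Forking and dividing over models *)

Definition sforks {L} {M : structure L} (N : set M) X (S : set (X -> M)) :=
  exists r (T : 'I_r -> set (X -> M)), (forall i, def setT (T i) /\ sdiv N (T i)) /\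
    forall x, S x -> exists i, T i x.

(** Implication up to conjugation, stable under conjunction and automorphisms. That [S] proves
    falsity means that it quasi-divides over [N]. *)
Definition pproves {L} {M : structure L} (N : set M) X (S Z : set (X -> M)) :=
  exists m (g : 'I_m -> M -> M), (forall i, autB N (g i)) /\
    forall x, (forall i, S (g i \o x)) -> Z x.

(** A finitary trace of dividing inside [P]. The sets that are not rich form an ideal, which leads
    to an ultrafilter of rich sets. *)
Definition rich {L} {M : structure L} X J (E : set (X + J -> M)) k (P : set (J -> M)) :=
  forall l, exists b : nat -> J -> M, (forall t, (t < l) -> P (b t)) /\
    forall s : 'I_k -> nat, (forall t, (s t < l)) -> injective s ->
      ~ exists x, forall t, E (cat_tup x (b (s t))).

Section Forking.
Context {L : language} {K : Type} {M : structure L}.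
Hypothesis hM : mon K M.
Implicit Types (B N D : set M).

Lemma sdivk_aut N X k (S : set (X -> M)) h :
  autB N h -> sdivk N k S -> sdivk N k (fun x => S (h \o x)).
Proof.
move=> ah [g [ag gk]]; have [h' [ah' hh' h'h]] := autB_inv ah.
exists (fun i => h' \o (g i \o h)); split=> [i|s si [x Hx]].
  exact: autB_comp ah' (autB_comp (ag i) ah).
apply: (gk s si); exists (h \o x) => t; have := Hx t.
suff -> : h \o (h' \o (g (s t) \o h) \o x) = g (s t) \o (h \o x) by [].
by apply: funext => y /=; rewrite h'h.
Qed.

Lemma sdivk_teq N X J k (E : set (X + J -> M)) (c c' : J -> M) : small K N -> sm K J ->
  def N E -> teq N c' c ->
  sdivk N k (fun x => E (cat_tup x c)) -> sdivk N k (fun x => E (cat_tup x c')).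
Proof.
move=> sN sJ dE /(homog hM sN sJ)[h ah hc] /(sdivk_aut ah) H.
suff -> : (fun x => E (cat_tup x c')) = (fun x => E (cat_tup (h \o x) c)) by [].
by apply: funext => x; apply/propext; rewrite -hc (def_sum_aut _ _ ah dE).
Qed.

Lemma pproves_sub N X (S Z Z' : set (X -> M)) : pproves N S Z -> (forall x, Z x -> Z' x) -> pproves N S Z'.
Proof. by move=> [m [g [ag gS]]] ZZ; exists m, g; split=> // x /gS /ZZ. Qed.

Lemma pprovesI N X (S Z Z' : set (X -> M)) : pproves N S Z -> pproves N S Z' ->
  pproves N S (fun x => Z x /\ Z' x).
Proof.
move=> [m [g [ag gS]]] [m' [g' [ag' gS']]].
exists (m + m'), (fun i => match fintype.split i with inl j => g j | inr j => g' j end); split.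
  by move=> i; case: fintype.split.
move=> x Hx; split; [apply: gS|apply: gS'] => i.
  by have := Hx (lshift m' i); rewrite (unsplitK (inl _ i : 'I_m + 'I_m')).
by have := Hx (rshift m i); rewrite (unsplitK (inr _ i : 'I_m + 'I_m')).
Qed.

Lemma pproves_ord N X (S : set (X -> M)) n (Z : 'I_n -> set (X -> M)) : (forall i, pproves N S (Z i)) ->
  pproves N S (fun x => forall i, Z i x).
Proof.
elim: n Z => [|n IH] Z HZ.
  by exists 0, (fun _ => id); split=> [|x _] [].
apply: pproves_sub (pprovesI (HZ ord0) (IH (fun i => Z (lift ord0 i)) (fun i => HZ _))) _ => x [H0 H1] i.
by case: (unliftP ord0 i) => [j ->|->].
Qed.

Lemma pproves_aut N X (S Z : set (X -> M)) h : autB N h -> pproves N S Z ->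
  pproves N S (fun x => Z (h \o x)).
Proof.
move=> ah [m [g [ag gS]]]; exists m, (fun i => g i \o h); split=> [i|x Hx]; first exact: autB_comp.
by apply: gS => i; apply: Hx.
Qed.

Lemma def_common X r (T : 'I_r -> set (X -> M)) : (forall i, def setT (T i)) ->
  exists J (c : J -> M) (E : 'I_r -> set (X + J -> M)),
    [/\ sm K J, forall i, def set0 (E i) & forall i x, T i x <-> E i (cat_tup x c)].
Proof.
move=> dT; have [Klim sNat _ _ _] := hM; case: (carrier_nonempty M) => m0.
have /choice[p pP] : forall i, exists p : {m & (formula L (X + 'I_m) * ('I_m -> M))%type},
    forall x, T i x <-> sat (projT2 p).1 (cat_tup x (projT2 p).2).
  move=> i; have [psi o H] := dT i.
  have [m [phi [b [_ E]]]] := over_inst (m0 := m0) I o.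
  exists (existT (fun m => (formula L (X + 'I_m) * ('I_m -> M))%type) m (phi, b)) => x /=.
  by rewrite H E holds_inst.
pose J := {i : 'I_r & 'I_(projT1 (p i))}.
pose h i (s : X + 'I_(projT1 (p i))) : X + J := match s with inl x => inl x | inr j => inr (existT _ i j) end.
exists J, (fun z => (projT2 (p (projT1 z))).2 (projT2 z)), (fun i u => sat (projT2 (p i)).1 (u \o h i)).
split.
- apply: (sm_dep_prod hM (X := nat)) => // [i|]; last exact: sm_ord.
  by exists val; apply: val_inj.
- by move=> i; apply: (def_comp (h i) (def_sat _)).
- move=> i x; rewrite pP; set u := cat_tup _ _; set v := (_ \o _).
  by suff -> : u = v by []; apply: funext => -[].
Qed.

Lemma def_set0 N V (S : set (V -> M)) : def set0 S -> def N S.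
Proof. exact: def_mono (sub0set N). Qed.

(** A finite witnessing sequence inside an [N]-definable set containing [c] exists among the
    conjugates of [c]; its existence is first-order over [N], so one lies in the model. Hence the
    trace on [N] of such a set is never in the ideal of non-rich sets. *)
Lemma rich_coheir N X J (E : set (X + J -> M)) k (c : J -> M) :
  elementary_sub N -> def N E -> sdivk N k (fun x => E (cat_tup x c)) ->
  exists q, [/\ ultra q, q (fun x => forall j, N (x j)), forall S, def N S -> (S c <-> q S) &
    forall P, q P -> rich E k P].
Proof.
move=> eN dE [g [ag gk]].
have richS (P Q : set (J -> M)) : (forall x, P x -> Q x) -> rich E k P -> rich E k Q.
  by move=> PQ rP l; have [b [b1 b2]] := rP l; exists b; split=> // t /b1/PQ.
have rich0 : ~ rich E k (fun _ => False) by move=> /(_ 1)[b [/(_ 0 isT)]].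
have richU (P Q : set (J -> M)) : rich E k (fun x => P x \/ Q x) -> rich E k P \/ rich E k Q.
  move=> rPQ; apply: contrapT => /not_orP[/existsNP[l1 n1] /existsNP[l2 n2]].
  (* Of [l1 + l2] witnesses, [l1] lie in [P] or [l2] lie in [Q]. *)
  have [b [b1 b2]] := rPQ (l1 + l2).
  pose l1' := [seq t <- iota 0 (l1 + l2) | `[< P (b t) >]].
  pose l2' := [seq t <- iota 0 (l1 + l2) | ~~ `[< P (b t) >]].
  have sub (l : seq nat) l0 (R : set (J -> M)) : uniq l -> (l0 <= size l) ->
      (forall t, t \in l -> (t < l1 + l2) /\ R (b t)) ->
      exists b : nat -> J -> M, (forall t, (t < l0) -> R (b t)) /\
        forall s : 'I_k -> nat, (forall t, (s t < l0)) -> injective s ->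
        ~ exists x, forall t, E (cat_tup x (b (s t))).
    move=> ul l0l lR; have inl t : (t < l0) -> nth 0 l t \in l.
      by move=> tl; rewrite mem_nth // (leq_trans tl).
    exists (fun t => b (nth 0 l t)); split=> [t /inl/lR[]//|s sl si].
    apply: (b2 (fun t => nth 0 l (s t))) => [t|i j /eqP]; first by have [] := lR _ (inl _ (sl t)).
    by rewrite nth_uniq ?(leq_trans (sl _) l0l) // => /eqP/si.
  case: (leqP l1 (size l1')) => h1.
    apply: n1; apply: sub h1 _; first by rewrite filter_uniq ?iota_uniq.
    by move=> t; rewrite mem_filter mem_iota => /andP[/asboolP ? /andP[_ ?]].
  apply: n2; apply: (sub l2'); first by rewrite filter_uniq ?iota_uniq.
    have : (size l1' + size l2' = l1 + l2) by rewrite !size_filter count_predC size_iota.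
    move=> Es; rewrite -(leq_add2l (size l1')) Es leq_add2r; exact: ltnW.
  move=> t; rewrite mem_filter mem_iota => /andP[/asboolP nP /andP[_ tl]]; split=> //.
  by have [] := b1 t tl.
have richN chi : def N chi -> chi c -> rich E k (fun x => chi x /\ forall j, N (x j)).
  move=> dchi chic l.
  (* Index maps are enumerated as finite functions, which makes this a finite conjunction and so
     definable. *)
  pose S (w : nat * J -> M) := (forall t : 'I_l, chi (fun j => w (val t, j))) /\
    forall i : 'I_#|{ffun 'I_k -> 'I_l}|, injective (enum_val i : {ffun 'I_k -> 'I_l}) ->
      ~ exists x, forall t, E (cat_tup x (fun j => w (val ((enum_val i : {ffun 'I_k -> 'I_l}) t), j))).
  have dS : def N S.
    apply: defI.
      apply: (@def_exall _ _ N _ l (fun t w => chi (fun j => w (val t, j)))) => t.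
      exact: (def_comp (fun j : J => (val t, j)) dchi).
    apply: (@def_exall _ _ N _ _ (fun (i : 'I_#|{ffun 'I_k -> 'I_l}|) w => injective (enum_val i : {ffun 'I_k -> 'I_l}) ->
      ~ exists x, forall t, E (cat_tup x (fun j => w (val ((enum_val i : {ffun 'I_k -> 'I_l}) t), j))))) => i.
    have [si|nsi] := pselect (injective (enum_val i : {ffun 'I_k -> 'I_l})); last first.
      by apply: def_ext (defT N _) => v; split.
    apply: def_ext (defN (@def_exI _ _ N X (nat * J)%type k (fun _ => J) (fun _ => E)
      (fun t j => (val ((enum_val i : {ffun 'I_k -> 'I_l}) t), j)) (fun _ => dE))) => v.
    by split=> // H; apply: H.
  have [h hP] := autB_invs ag.
  have [|w [w1 w2] wN] := tarski_vaught eN dS.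
    exists (fun z => h z.1 (c z.2)); split.
      by move=> t; have [ah _ _] := hP (val t); apply/(def_aut c ah dchi).
    move=> i si [x Hx]; apply: (gk (fun t => val ((enum_val i : {ffun 'I_k -> 'I_l}) t))).
      by move=> a b /val_inj/si.
    exists x => t; set e := val _; have [ah hh1 hh2] := hP e; have := Hx t; rewrite -/e.
    rewrite -(def_sum_aut x _ (ag e) dE); suff -> : g e \o (fun j => h (e, j).1 (c (e, j).2)) = c by [].
    by apply: funext => j /=; rewrite hh2.
  exists (fun t j => w (t, j)); split=> [t tl|s sl si].
    by split=> [|j]; [exact: (w1 (Ordinal tl))|exact: wN].
  pose f : {ffun 'I_k -> 'I_l} := [ffun t => Ordinal (sl t)].
  have := w2 (enum_rank f); rewrite enum_rankK => H.
  have fE t : val (f t) = s t by rewrite ffunE.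
  have fi : injective f by move=> a b /(congr1 val); rewrite !fE => /si.
  move=> [x Hx]; apply: (H fi); exists x => t; rewrite fE; exact: Hx.
pose F (P : set (J -> M)) := exists chi, [/\ def N chi, chi c &
  ~ rich E k (fun x => (chi x /\ forall j, N (x j)) /\ ~ P x)].
have [|||q [uq Fq]] := @ultra_exists _ F.
- exists (fun _ => True), (fun _ => True); split=> //; first exact: defT.
  by move=> H; apply: rich0; apply: richS H => x [_ []].
- move=> A C [chi [d1 c1 n1]] [chi' [d2 c2 n2]]; exists (fun x => A x /\ C x) => //.
  exists (fun x => chi x /\ chi' x); split=> //; first exact: defI.
  move=> H; have [] : rich E k (fun x => (chi x /\ forall j, N (x j)) /\ ~ A x) \/
     rich E k (fun x => (chi' x /\ forall j, N (x j)) /\ ~ C x) by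
    apply: richU; apply: richS H => x [[[? ?] ?]] /not_andP[?|?]; [left|right]; split.
  + exact: n1.
  + exact: n2.
- move=> A [chi [d1 c1 n1]]; apply: contrapT => /forallNP nA; apply: n1.
  by apply: richS (richN chi d1 c1) => x; split.
have qchi S : def N S -> S c -> q S.
  move=> dS Sc; apply: Fq; exists S; split=> // H; apply: rich0; apply: richS H => x [[? ?] ?] //.
exists q; split=> //.
- apply: Fq; exists (fun _ => True); split=> //; first exact: defT.
  by move=> H; apply: rich0; apply: richS H => x [[? ?] ?].
- move=> S dS; split; first exact: qchi.
  by move=> qS; apply: contrapT => /(qchi _ (defN dS)) /(ultraN uq).
- move=> P qP; apply: contrapT => nP.
  suff /(ultraN uq) : q (fun x => ~ P x) by [].
  apply: Fq; exists (fun _ => True); split=> //; first exact: defT.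
  by move=> H; apply: nP; apply: richS H => x [_ /contrapT].
Qed.

Lemma ulim_forall J (q : set (set (J -> M))) F v l (S : nat -> set (nat -> J -> M)) : ultra q ->
  (forall t, (t < l) -> ulim (fun _ : nat => q) F v (S t)) ->
  ulim (fun _ : nat => q) F v (fun w => forall t, (t < l) -> S t w).
Proof.
move=> uq; elim: l => [|l IH] H.
  have u1 := lim_all (J := fun _ : nat => J) (fun _ => uq) F (R := fun _ _ => True) (v := v)
    (S := fun w => forall t, (t < 0) -> S t w).
  by apply: u1 => // i; apply: (ultraT uq).
apply: (proj1 (lim_ext (fun _ => uq) F v (S := fun w => (forall t, (t < l) -> S t w) /\ S l w) _)).
  move=> w; split=> [[H1 H2] t|H1]; last by split=> [t tl|]; apply: H1 => //; apply: ltnW.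
  by rewrite ltnS leq_eqVlt => /orP[/eqP ->|/H1].
apply/limI; first by move=> _; exact: uq.
by split; [apply: IH => t tl; apply: H; apply: ltnW|apply: H].
Qed.

(** Rows are built from the last index down: the outermost limit holds on a set of [q], so a whole
    row fits into it, and the inner limit then holds for the finitely many entries of this row at
    once. *)
Lemma rich_array X J (E : set (X + J -> M)) k (q : set (set (J -> M))) l :
  ultra q -> (forall P, q P -> rich E k P) ->
  forall n (S : set (nat -> J -> M)) v, ulim (fun _ : nat => q) (downto n) v S ->
  exists b : nat -> nat -> J -> M,
    (forall i (s : 'I_k -> nat), (i < n) -> (forall t, (s t < l)) -> injective s ->
      ~ exists x, forall t, E (cat_tup x (b i (s t)))) /\
    forall eta : nat -> nat, (forall i, (eta i < l)) ->
      S (fun i => if (i < n) then b i (eta i) else v i).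
Proof.
move=> uq qr; elim=> [|n IH] S v H.
  by exists (fun _ => v); split.
have [b0 [b1 b2]] := qr _ H l.
have H' : ulim (fun _ : nat => q) (downto n) v
    (fun w => forall t, (t < l) -> S (updd (J := fun _ => J) w (i := n) (b0 t))).
  apply: ulim_forall => // t tl; apply/lim_updd.
  - by move=> _; exact: uq.
  - by move=> /in_downto; rewrite ltnn.
  - exact: b1.
have [b [b3 b4]] := IH _ _ H'.
exists (fun i => if i == n then b0 else b i); split.
  move=> i s; rewrite ltnS leq_eqVlt; case: eqP => [_ _|_ /= il]; first exact: b2.
  exact: b3.
move=> eta el; have := b4 eta el (eta n) (el n); set w := updd _ _; set w' := (fun i => _).
suff -> : w = w' by [].
apply: funext => i; rewrite /w /w' ltnS leq_eqVlt; have [->|ni] := eqVneq i n.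
  by rewrite updd_eq.
by rewrite updd_neq // => E1; rewrite E1 eqxx in ni.
Qed.

(** If [E] stayed consistent along limits of every length, rich rows would give TP2 squares of every
    size. *)
Lemma ntp2_rich N X J (E : set (X + J -> M)) k (q : set (set (J -> M))) v : NTP2 M -> def N E ->
  ultra q -> (forall P, q P -> rich E k P) ->
  exists m, ulim (fun _ : nat => q) (downto m) v
    (fun w => ~ exists x, forall i : 'I_m, E (cat_tup x (w (val i)))).
Proof.
move=> ntp dE uq qr; apply: contrapT => /forallNP H; apply: ntp.
apply: (TP2_finite hM (k := k) dE) => l.
have Hl : ulim (fun _ : nat => q) (downto l) v (fun w => exists x, forall i : 'I_l, E (cat_tup x (w (val i)))).
  by apply: contrapT => nH; apply: (H l); apply/limN => // _.
have [b [b1 b2]] := rich_array l uq qr Hl.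
exists b; split=> // eta el; have [x Hx] := b2 eta el.
by exists x => i il; have := Hx (Ordinal il); rewrite /= il.
Qed.

Lemma coheir_exists N D J (b : J -> M) : N `<=` D ->
  (forall R : set (J -> M), def D R -> R b -> exists x, R x /\ forall j, N (x j)) ->
  exists r, [/\ ultra r, r (fun x : J -> M => forall j, N (x j)) & forall R, def D R -> (R b <-> r R)].
Proof.
move=> ND fsb.
have [|||r [ur Fr]] := @ultra_exists _ (fun C : set (J -> M) => exists R, [/\ def D R, R b & C = (fun x => R x /\ forall j, N (x j))]).
- by exists (fun x => True /\ forall j, N (x j)), (fun _ => True); split=> //; apply: defT.
- move=> _ _ [R [dR Rb ->]] [R' [dR' Rb' ->]].
  exists (fun x => (R x /\ R' x) /\ forall j, N (x j)); last by move=> x [[? ?] ?].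
  by exists (fun x => R x /\ R' x); split=> //; apply: defI.
- by move=> _ [R [dR Rb ->]]; apply: fsb.
have H R : def D R -> R b -> r R.
  by move=> dR Rb; apply: (ultraS ur _ (Fr (fun x => R x /\ forall j, N (x j)) _)); [move=> x []|exists R].
exists r; split=> //.
  by apply: (ultraS ur _ (Fr (fun x => True /\ forall j, N (x j)) _)); [move=> x []|exists (fun _ => True); split=> //; apply: defT].
move=> R dR; split; first exact: H.
by move=> rR; apply: contrapT => /(H _ (defN dR)) /(ultraN ur).
Qed.

Lemma def_fixl N X J (E : set (X + J -> M)) (x : X -> M) : (forall i, N (x i)) -> def N E ->
  def N (fun y => E (cat_tup x y)).
Proof.
move=> Nx dE; pose f (s : X + J) : J + M := match s with inl i => inr (x i) | inr j => inl j end.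
have fN z m : f z = inr m -> N m by case: z => // i [<-].
apply: def_ext (def_subst fN dE) => y.
by suff -> : cat_tup y id \o f = cat_tup x y by []; apply: funext => -[].
Qed.

(** Induction on the dividing disjuncts. Along a Morley sequence [c'] of a rich coheir the disjunct
    [E0] is inconsistent after [m] steps, and [b'] is chosen so that every pair of [b'] and [c' k]
    is conjugate to [b], [c]. Conjugating the hypothesis [m] times removes [E0] at the price of
    copies of the other disjuncts at each [c' k]. These are swept away one [k] at a time by
    induction, with the later copies moved into [Psi]; this is why [Psi] is an arbitrary invariant
    relation and [b] an arbitrary small tuple. *)
Lemma vacuum N X J (S : set (X -> M)) (c : J -> M) (Es : seq (set (X + J -> M))) :
  NTP2 M -> small K N -> elementary_sub N -> sm K J ->
  (forall E, List.In E Es -> def N E /\ sdiv N (fun x => E (cat_tup x c))) ->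
  forall Be (b : Be -> M) (Psi : (X -> M) -> (Be -> M) -> Prop), sm K Be ->
  (forall g x y, autB N g -> Psi (g \o x) (g \o y) <-> Psi x y) ->
  (forall R : set (Be + J -> M), def N R -> R (cat_tup b c) ->
     exists y, R (cat_tup y c) /\ forall j, N (y j)) ->
  pproves N S (fun x => Psi x b \/ exists2 E, List.In E Es & E (cat_tup x c)) ->
  pproves N S (fun x => Psi x b).
Proof.
move=> ntp sN eN sJ; have [Klim sNat _ _ _] := hM.
elim: Es c => [|E0 Es IH] c HEs Be b Psi sBe Psi_aut fsb HS.
  by apply: pproves_sub HS _ => x [//|[]].
have [dE0 [k dv0]] := HEs E0 (or_introl erefl).
have [q [uq qN qc qr]] := rich_coheir eN dE0 dv0.
have [c' mc] := morley_exists hM (lt := ltn_nat) (J := fun _ => J)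
  wo_nat sN (sm_dep_prod hM (fun _ => tle_refl _) sNat sJ) (fun _ => uq).
have [m Hm] := ntp2_rich c' ntp dE0 uq qr.
have cc k' : teq N (c' k') c.
  move=> R dR; rewrite (qc R dR); apply: mc; apply: def_mono dR; by left.
have E0inc : ~ exists x, forall i : 'I_m, E0 (cat_tup x (c' (val i))).
  apply/(morley_limE (S := fun w : nat -> J -> M => ~ exists x, forall i : 'I_m, E0 (cat_tup x (w (val i)))) wo_nat (fun _ => uq) c' (fun _ => qN) mc (dec_downto m)) => //.
    move=> w w' ww; have ww' (i : 'I_m) : w (val i) = w' (val i) by apply: ww; apply/in_downto; exact: ltn_ord.
    by split=> H [x Hx]; apply: H; exists x => i; move: (Hx i); rewrite ww'.
  exact: def_kinc.
have [r [ur rN rb]] : exists r, [/\ ultra r, r (fun y : Be -> M => forall j, N (y j)) &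
    forall R, def (N `|` range c) R -> (R b <-> r R)].
  apply: coheir_exists; first by left.
  by move=> R /def_split[E dE EE] /EE /(fsb _ dE)[y [Ey yN]]; exists y; split=> //; apply/EE.
pose N' := N `|` range (unc c').
have sN' : small K N' by apply: (smallU Klim) => //; apply: small_range; apply: (sm_prod Klim).
have [b' b'P] := realize hM ur sN' sBe.
have ck k' : N `|` range (c' k') `<=` N'.
  by move=> y [|[j _ <-]]; [left|right; exists (k', j)].
(* [b'] follows an ultrafilter living on [N], and with parameters in [N] the tuples [c' k'] and [c]
   cannot be distinguished. *)
have bc k' : teq N (cat_tup b' (c' k')) (cat_tup b c).
  move=> R dR.
  have d1 : def N' (fun y : Be -> M => R (cat_tup y (c' k'))) by exact: (def_mono (@ck k') (def_unsplit (c' k') dR)).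
  apply: iff_trans (b'P _ d1) _; apply: iff_trans (iff_sym (rb _ (def_unsplit (c) dR))).
  have H y : (forall j, N (y j)) -> R (cat_tup y (c' k')) <-> R (cat_tup y c).
    by move=> Ny; apply: (cc k' _ (def_fixl Ny dR)).
  by split=> H1; apply: (ultraI2 ur H1 rN) => y H2 /H H3; apply/H3.
have sBJ : sm K (Be + J) by apply: (sm_sum Klim).
pose Z k' x := Psi x b' \/ exists2 E, List.In E (E0 :: Es) & E (cat_tup x (c' k')).
have HZ k' : pproves N S (Z k').
  have [g ag gE] := homog hM sN sBJ (bc k').
  have gb : g \o b' = b by apply: funext => j; exact: (congr1 (fun f => f (inl j)) gE).
  have gc : g \o c' k' = c by apply: funext => j; exact: (congr1 (fun f => f (inr j)) gE).
  apply: pproves_sub (pproves_aut ag HS) _ => x [Px|[E Ein Ex]]; [left|right].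
    by apply/(Psi_aut _ _ _ ag); rewrite gb.
  exists E => //; have [dE _] := HEs E Ein.
  by apply/(def_sum_aut _ _ ag dE); rewrite gc.
pose Y j x := Psi x b' \/ exists k', [/\ (j <= k'), (k' < m) & exists2 E, List.In E Es & E (cat_tup x (c' k'))].
(* [E0] cannot hold at all of the first [m] entries of [c'], so another disjunct holds at one of
   them. *)
have HY0 : pproves N S (Y 0).
  apply: pproves_sub (pproves_ord (fun i : 'I_m => HZ (val i))) _; move=> x Hx.
  have [?|nP] := pselect (Psi x b'); first by left.
  apply: contrapT => /not_orP[_ nY]; case: E0inc; exists x => i.
  case: (Hx i) => [//|[E [E0E|Ein] Ex]]; first by rewrite E0E.
  by case: nY; exists (val i); split=> //; [exact: ltn_ord|exists E].
have HY j : pproves N S (Y j).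
  elim: j => // j IHj; have [jm|mj] := ltnP j m; last first.
    by apply: pproves_sub IHj _ => x [Px|[k' [jk km _]]]; [left|have := leq_ltn_trans jk km; rewrite ltnNge mj].
  pose Be2 := (Be + nat * J)%type.
  pose cs t := c' (j.+1 + t).
  pose b2 : Be2 -> M := cat_tup b' (unc cs).
  pose Psi2 (x : X -> M) (y : Be2 -> M) := Psi x (y \o inl) \/ exists t, (j.+1 + t < m) /\
     exists2 E, List.In E Es & E (cat_tup x (fun i => y (inr (t, i)))).
  have sBe2 : sm K Be2 by apply: (sm_sum Klim) => //; apply: (sm_prod Klim).
  have Psi2E x : Psi2 x b2 <-> Y j.+1 x.
    split=> [[Px|[t [tm HE]]]|[Px|[k' [jk km HE]]]]; [by left| |by left|].
      by right; exists (j.+1 + t); split=> //; rewrite leq_addr.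
    by right; exists (k' - j.+1); rewrite /b2 /unc /cs /= subnKC.
  have HEs' E : List.In E Es -> def N E /\ sdiv N (fun x => E (cat_tup x (c' j))).
    move=> Ein; have [dE [k' dv]] := HEs E (or_intror Ein); split=> //.
    by exists k'; apply: sdivk_teq (cc j) dv.
  apply: pproves_sub _ (fun x => proj1 (Psi2E x)).
  apply: (IH (c' j) HEs' Be2 b2 Psi2 sBe2).
  - move=> g x y ag; rewrite /Psi2; have -> : (g \o y) \o inl = g \o (y \o inl) by [].
    rewrite (Psi_aut _ _ _ ag).
    have H E t : List.In E Es -> E (cat_tup (g \o x) (fun i => (g \o y) (inr (t, i)))) <-> E (cat_tup x (fun i => y (inr (t, i)))).
      by move=> /HEs'[dE _]; exact: (def_sum_aut x (fun i => y (inr (t, i))) ag dE).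
    by split=> -[?|[t [tm [E Ein HE]]]]; [left|right; exists t; split=> //; exists E => //; apply/H
      |left|right; exists t; split=> //; exists E => //; apply/H].
  (* Finite satisfiability for the next round: [b'] is moved into [N] first, being a coheir over all
     of [c']; then the later entries of [c'], a Morley sequence over [N] and [c' j], follow. *)
  - move=> R dR Rb2.
    pose h (s : Be + (nat * J + J)) : Be2 + J := match s with
      | inl y => inl (inl y) | inr (inl z) => inl (inr z) | inr (inr i) => inr i end.
    have hE y z u : cat_tup (cat_tup y z) u = cat_tup y (cat_tup z u) \o
        (fun s : Be2 + J => match s with inl (inl y) => inl y | inl (inr z) => inr (inl z) | inr i => inr (inr i) end) :> (Be2 + J -> M).
      by apply: funext => -[[]|].
    pose R' (w : Be + (nat * J + J) -> M) := R (w \o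
       (fun s : Be2 + J => match s with inl (inl y) => inl y | inl (inr z) => inr (inl z) | inr i => inr (inr i) end)).
    have dR' : def N R' by apply: (def_comp _ dR).
    have d1 : def N' (fun y : Be -> M => R' (cat_tup y (cat_tup (unc cs) (c' j)))).
      apply: def_mono (def_unsplit (cat_tup (unc cs) (c' j)) dR') => y [|[[[t i]|i] _ <-]]; first by left.
        by right; exists (j.+1 + t, i).
      by right; exists (j, i).
    have : R' (cat_tup b' (cat_tup (unc cs) (c' j))) by move: Rb2; rewrite /b2 hE.
    move=> /(b'P _ d1) H; have [y [Ry yN]] := ultra_ex ur (proj2 (ultraI ur _ _) (conj H rN)).
    pose S1 (w : nat -> J -> M) := R' (cat_tup y (cat_tup (unc w) (c' j))).
    have dS1 : ddef (J := fun _ : nat => J) (N `|` range (c' j)) S1.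
      apply: (ddef_unc (S := fun w : nat * J -> M => R' (cat_tup y (cat_tup w (c' j))))).
      exact: (def_unsplit (c' j) (def_fixl yN dR')).
    have mcs : morley ltn_nat (fun _ : nat => q) (N `|` range (c' j)) cs.
      move=> t S0 dS0; apply: mc; apply: def_mono dS0 => z [[|[i _ <-]]|[t' [tt' [i <-]]]]; first by left.
        by right; exists j; split; [rewrite /ltn_nat addSn ltnS leq_addr|exists i].
      by right; exists (j.+1 + t'); split; [rewrite /ltn_nat ltn_add2l|exists i].
    have [w [S1w wN]] : exists w, S1 w /\ forall t i, N (w t i).
      apply: contrapT => nw.
      suff : ~ S1 cs by apply.
      apply: (morley_all (S := fun w : nat -> J -> M => ~ S1 w) (R := fun _ x => forall i, N (x i)) wo_nat (fun _ => uq) _ mcs (fun _ => qN) (defN dS1)).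
        by move=> _; apply: (ultraS uq _ qN) => z Nz i; left.
      by move=> w Nw S1w; apply: nw; exists w.
    exists (cat_tup y (unc w)); split; first by rewrite hE.
    by move=> [i|[t i]] /=; [apply: yN|apply: wN].
  - apply: pproves_sub IHj _ => x [Px|[k' [jk km HE]]]; first by left; left.
    move: jk; rewrite leq_eqVlt => /orP[/eqP jk|jk]; first by right; rewrite jk.
    by left; apply/Psi2E; right; exists k'.
have Hb' : pproves N S (fun x => Psi x b').
  apply: pproves_sub (HY m) _ => x [//|[k' [mk km _]]].
  by have := leq_ltn_trans mk km; rewrite ltnn.
have [g ag gE] := homog hM sN sBJ (bc 0); have [h [ah gh hg]] := autB_inv ag.
have gb : g \o b' = b by apply: funext => j; exact: (congr1 (fun f => f (inl j)) gE).
apply: pproves_sub (pproves_aut ah Hb') _ => x /(Psi_aut _ _ _ ag); rewrite gb.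
by have -> : g \o (h \o x) = x by apply: funext => y /=; rewrite hg.
Qed.

(** [vacuum] with an empty tuple [b] and a false [Psi]. *)
Lemma forks_quasi N X (S : set (X -> M)) : NTP2 M -> small K N -> elementary_sub N ->
  sforks N S -> exists m (g : 'I_m -> M -> M), (forall i, autB N (g i)) /\ ~ exists x, forall i, S (g i \o x).
Proof.
move=> ntp sN eN [r [T [dT ST]]]; have [Klim sNat _ _ _] := hM.
have [J [c [E [sJ dE TE]]]] := def_common (fun i => proj1 (dT i)).
pose Es := [seq E i | i <- enum 'I_r].
have EsP A : List.In A Es <-> exists i, A = E i.
  split.
    rewrite /Es; elim: (enum 'I_r) => //= i s IH [<-|/IH//]; by exists i.
  move=> [i ->]; rewrite /Es; have : i \in enum 'I_r by rewrite mem_enum.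
  by elim: (enum 'I_r) => //= j s IH; rewrite inE => /orP[/eqP->|/IH]; [left|right].
have [|||||m [g [ag gS]]] := @vacuum N X J S c Es ntp sN eN sJ _ void (of_void M) (fun _ _ => False).
- move=> A /EsP[i ->]; split; first exact: def_set0.
  have [_ dv] := dT i.
  by have <- : T i = (fun x => E i (cat_tup x c)) by apply: funext => x; apply/propext.
- by apply: sm_le sNat; exists (of_void nat) => -[].
- by [].
- by move=> R dR Rc; exists (of_void M); split=> // -[].
- exists 1, (fun _ => id); split=> [_|x /(_ ord0) Sx]; first exact: autB_id.
  have [i Ti] := ST _ Sx; right; exists (E i); last exact/TE.
  by apply/EsP; exists i.
exists m, g; split=> // -[x Hx]; exact: gS Hx.
Qed.

Lemma sforksU N X (S S' : set (X -> M)) : sforks N S -> sforks N S' -> sforks N (fun x => S x \/ S' x).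
Proof.
move=> [r [T [dT ST]]] [r' [T' [dT' ST']]].
exists (r + r'), (fun i => match fintype.split i with inl j => T j | inr j => T' j end); split.
  by move=> i; case: fintype.split.
move=> x [/ST[i Ti]|/ST'[i Ti]].
  by exists (lshift r' i); rewrite (unsplitK (inl _ i : 'I_r + 'I_r')).
by exists (rshift r i); rewrite (unsplitK (inr _ i : 'I_r + 'I_r')).
Qed.

(** The ultrafilter must avoid each [th] that forks as a condition on [w]; forking is closed under
    disjunction, so this is a filter condition. By quasi-dividing, finitely many conjugates of [a]
    admit no common [w]. Such tuples exist in the model, and [w = id] then fails at one of them. *)
Lemma strict_exists N J (a : J -> M) : NTP2 M -> small K N -> elementary_sub N -> sm K J ->
  exists q, strict N q a.
Proof.
move=> ntp sN eN sJ.
pose F (C : set (J -> M)) := exists chi th, [/\ def N chi, chi a, def N th,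
  sforks N (fun w : M -> M => th (cat_tup a w)) &
  C = (fun x => [/\ forall j, N (x j), chi x & ~ th (cat_tup x id)])].
have f0 : sforks N (fun _ : M -> M => False).
  by exists 0, (fun _ _ => False); split=> [[]|].
have dF V : def N (fun _ : V -> M => False).
  by apply: def_ext (defN (defT N V)) => v; tauto.
have [|||q [uq Fq]] := @ultra_exists _ F.
- exists (fun x => [/\ forall j, N (x j), True & ~ False]), (fun _ => True), (fun _ => False).
  by split=> //; apply: defT.
- move=> _ _ [chi [th [d1 c1 d2 f1 ->]]] [chi' [th' [d1' c1' d2' f1' ->]]].
  exists (fun x => [/\ forall j, N (x j), chi x /\ chi' x & ~ (th (cat_tup x id) \/ th' (cat_tup x id))]).
    exists (fun x => chi x /\ chi' x), (fun u => th u \/ th' u); split=> //; [exact: defI|exact: defU|exact: sforksU].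
  by move=> x [? [? ?] /not_orP[? ?]].
- move=> _ [chi [th [d1 c1 d2 f1 ->]]].
  have [m [g [ag gS]]] := forks_quasi ntp sN eN f1.
  have [h hP] := autB_invs ag.
  pose sw (s : J + M) : M + J := match s with inl x => inr x | inr x => inl x end.
  have swE (u : M -> M) (v : J -> M) : cat_tup u v \o sw = cat_tup v u by apply: funext => -[].
  pose S (w : 'I_m * J -> M) := (forall i, chi (fun j => w (i, j))) /\
    ~ exists u : M -> M, forall i, (fun s => th (s \o sw)) (cat_tup u (fun j => w (i, j))).
  have dS : def N S.
    apply: defI.
      apply: (@def_exall _ _ N _ m (fun i w => chi (fun j => w (i, j)))) => i.
      exact: (def_comp (fun j : J => (i, j)) d1).
    apply: defN; exact: (@def_exI _ _ N M ('I_m * J)%type m (fun _ => J) (fun _ s => th (s \o sw))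
      (fun i j => (i, j)) (fun _ => def_comp sw d2)).
  have [|w [w1 w2] wN] := tarski_vaught eN dS.
    exists (fun z => h z.1 (a z.2)); split.
      by move=> i; have [ah _ _] := hP i; apply/(def_aut a ah d1).
    move=> [u Hu]; apply: gS; exists u => i; have := Hu i; rewrite swE /= => Hi.
    have [ah gh hg] := hP i; apply/(def_sum_aut _ _ ah d2).
    move: Hi; congr (th (cat_tup _ _)); apply: funext => y /=; by rewrite gh.
  apply: contrapT => H; apply: w2; exists id => i; rewrite swE.
  by apply: contrapT => nth_; apply: H; exists (fun j => w (i, j)).
have qchi S : def N S -> S a -> q S.
  move=> dS Sa; apply: (ultraS uq _ (Fq (fun x => [/\ forall j, N (x j), S x & ~ False]) _)); first by move=> x [].
  by exists S, (fun _ => False).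
exists q; split=> //.
- apply: (ultraS uq _ (Fq (fun x => [/\ forall j, N (x j), True & ~ False]) _)); first by move=> x [].
  by exists (fun _ => True), (fun _ => False); split=> //; apply: defT.
- move=> S dS; split; first exact: qchi.
  by move=> qS; apply: contrapT => /(qchi _ (defN dS)) /(ultraN uq).
- move=> th dth qth dv; suff /(ultraN uq) : q (fun x => ~ th (cat_tup x id)) by [].
  apply: (ultraS uq _ (Fq (fun x => [/\ forall j, N (x j), True & ~ th (cat_tup x id)]) _)); first by move=> x [].
  exists (fun _ => True), th; split=> //; first exact: defT.
  exists 1, (fun _ w => th (cat_tup a w)); split=> [_|w]; last by exists ord0.
  split=> //.
  pose sw (s : J + M) : M + J := match s with inl x => inr x | inr x => inl x end.
  apply: (def_mono (@subsetT _ _)); apply: def_ext (def_unsplit (a) (def_comp sw dth)) => w.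
  by have -> : cat_tup w a \o sw = cat_tup a w by apply: funext => -[].
Qed.

Lemma strict_teq N J (q : set (set (J -> M))) (a a' : J -> M) : small K N -> sm K J ->
  teq N a' a -> strict N q a -> strict N q a'.
Proof.
move=> sN sJ aa [uq qN qa qs]; split=> //.
  by move=> S dS; rewrite -(qa S dS); apply: aa.
move=> th dth qth [k dv]; apply: (qs th dth qth); exists k.
have [g ag ga] := homog hM sN sJ aa; have [h [ah gh hg]] := autB_inv ag.
have := sdivk_aut ah dv.
suff -> : (fun x : M -> M => th (cat_tup a' (h \o x))) = (fun w => th (cat_tup a w)) by [].
apply: funext => w; apply/propext; rewrite -(def_sum_aut a' _ ag dth) ga.
by have -> : g \o (h \o w) = w by apply: funext => y /=; rewrite hg.
Qed.

Lemma pigeonhole_ord r m (f : 'I_(r * m).+1 -> 'I_r) :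
  exists l (s : 'I_m -> 'I_(r * m).+1), injective s /\ forall t, f (s t) = l.
Proof.
have [l hl] : exists l, (m <= #|[pred t | f t == l]|).
  apply: contrapT => /forallNP H.
  have : (\sum_(l : 'I_r) #|[pred t | f t == l]| <= \sum_(l : 'I_r) m).
    by apply: leq_sum => l _; have /negP := H l; rewrite -ltnNge => /ltnW.
  rewrite sum_nat_const card_ord.
  have -> : (\sum_(l : 'I_r) #|[pred t | f t == l]| = (r * m).+1).
    rewrite -[RHS]card_ord -[RHS]sum1_card (partition_big f xpredT) //=.
    by apply: eq_bigr => l _; rewrite -sum1_card.
  by rewrite ltnn.
exists l, (fun t => enum_val (widen_ord hl t)); split=> [i j /enum_val_inj /(congr1 val) /= E|t].
  exact: val_inj.
by have := enum_valP (widen_ord hl t); rewrite inE => /eqP.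
Qed.

(** All parameters form one tuple [c], whose strict Morley sequence is strictly independent. Each
    [T l] becomes inconsistent along it, since otherwise [strict_rows] gives TP2; hence so does
    [S]. *)
Lemma forks_divides N X (S : set (X -> M)) : NTP2 M -> small K N -> elementary_sub N ->
  def setT S -> sforks N S -> sdiv N S.
Proof.
move=> ntp sN eN dS [r [T [dT ST]]]; have [Klim sNat _ _ _] := hM.
(* Index 0 is reserved for [S], and the lifted indices carry the dividing sets. *)
have dT1 (i : 'I_r.+1) : def setT (if unlift ord0 i is Some j then T j else S).
  by case: unlift => [j|//]; have [] := dT j.
have [J [c [E [sJ dE0 TE]]]] := def_common dT1.
have dE i : def N (E i) by apply: def_set0.
have SE x : S x <-> E ord0 (cat_tup x c) by rewrite -TE unlift_none.
have TlE l x : T l x <-> E (lift ord0 l) (cat_tup x c) by rewrite -TE liftK.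
have [q sq] := strict_exists c ntp sN eN sJ.
have [uq qN qc _] := sq.
have sJ2 : sm K {i : nat & J} := sm_dep_prod hM (fun _ => tle_refl _) sNat sJ.
have [c' mc] := morley_exists hM (lt := ltn_nat) (J := fun _ => J)
  wo_nat sN sJ2 (fun _ => uq).
have cc k : teq N (c' k) c.
  move=> R dR; rewrite (qc R dR); apply: mc; apply: def_mono dR; by left.
have si : strictly_independent N c'.
  by apply: (strict_morley hM wo_nat sN sJ2 _ mc) => i; apply: strict_teq (cc i) sq.
have ic : ind N c' := morley_ind uq qN mc.
have incl (l : 'I_r) : exists m, forall s : 'I_m -> nat, injective s ->
    ~ exists x, forall t, E (lift ord0 l) (cat_tup x (c' (s t))).
  apply: contrapT => H; apply: ntp.
  have [_ [k dvk]] := dT l.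
  have Tl : T l = (fun x => E (lift ord0 l) (cat_tup x c)) by apply: funext => x; apply/propext.
  have dk' i : sdivk N k (fun x => E (lift ord0 l) (cat_tup x (c' i))).
    by apply: sdivk_teq (cc i) _ => //; rewrite -Tl.
  have [I [I0 mI Ik]] := strict_rows hM sN (fun _ => sJ) si (fun _ => dE (lift ord0 l)) dk'.
  apply: (TP2_finite hM (k := k) (dE (lift ord0 l))) => b; exists I; split.
    by move=> i s _ _; apply: Ik.
  move=> eta _.
  pose S1 (v : forall i : nat, nat * J -> M) := exists x, forall i : 'I_b, E (lift ord0 l) (cat_tup x (fun j => v i (0, j))).
  have dS1 : ddef (J := fun _ : nat => (nat * J)%type) N S1.
    exact: (@def_exI _ _ N X _ b (fun _ => J) (fun _ => E (lift ord0 l))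
      (fun i j => existT (fun _ : nat => (nat * J)%type) (val i) (0, j)) (fun _ => dE _)).
  have [x Hx] : S1 (fun i => unc (I i \o addn (eta i))).
    apply/(mI _ _ S1 dS1); first by move=> i x y; rewrite /ltn_nat ltn_add2l.
    pose S2 (v : nat * J -> M) := exists x, forall i : 'I_b, E (lift ord0 l) (cat_tup x (fun j => v (val i, j))).
    have dS2 : def N S2.
      exact: (@def_exI _ _ N X _ b (fun _ => J) (fun _ => E (lift ord0 l)) (fun i j => (val i, j)) (fun _ => dE _)).
    have [x Hx] : S2 (unc c').
      move/forallNP: H => /(_ b) /existsNP[s /not_implyP[sinj /contrapT[x Hx]]].
      have [r0 rh rE] := sort_inj sinj.
      apply/(ic r0 rh S2 dS2); exists x => i; have [t rt] := rE i.
      by rewrite /unc /= rt; apply: Hx.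
    by exists x => i; rewrite /unc /= I0; apply: Hx.
  by exists x => i ib; have := Hx (Ordinal ib); rewrite /unc /= addn0.
have /choice[m mP] := incl.
pose mm := \max_l m l.
have /choice[g gP] : forall i, exists g, autB N g /\ g \o c' i = c.
  by move=> i; have [g ag gE] := homog hM sN sJ (cc i); exists g.
(* Among [r * mm + 1] true instances of [S], some [T l] accounts for at least [mm], hence for [m l]
   of them. *)
exists (r * mm).+1, g; split=> [i|s sinj [x Hx]]; first by have [] := gP i.
have /choice[f fP] : forall t, exists l, E (lift ord0 l) (cat_tup x (c' (s t))).
  move=> t; have [ag gc] := gP (s t); have [l Tl] := ST _ (Hx t).
  by exists l; move/TlE: Tl; rewrite -gc => /(def_sum_aut _ _ ag (dE _)).
have [l [u [ui ul]]] := pigeonhole_ord f.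
have ml : (m l <= mm) := leq_bigmax l.
apply: (mP l (fun t => s (u (widen_ord ml t)))).
  by move=> i j /sinj/ui/(congr1 val)/=/val_inj.
by exists x => t; have := fP (u (widen_ord ml t)); rewrite ul.
Qed.

Lemma forks_sforks N X (psi : pformula M X) : small K N -> forks N psi <-> sforks N (holds psi).
Proof.
move=> sN; split=> [[r [th [dth H]]]|[r [T [dT H]]]].
  exists r, (fun i => holds (th i)); split=> // i; split; last exact/(dividesP hM _ sN).
  by exists (th i) => //; apply: free_inT => -[].
have /choice[th thP] : forall i, exists th : pformula M X, holds th = T i.
  move=> i; have [[th _ E] _] := dT i; exists th; apply: funext => v; apply/propext.
  exact: iff_sym (E v).
exists r, th; split=> [i|a /H[i Ti]]; last by exists i; rewrite thP.
by apply/(dividesP hM _ sN); rewrite thP; have [] := dT i.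
Qed.

Lemma ntp2_ind_f n (d : 'I_n -> M) N b : NTP2 M -> small K N -> elementary_sub N ->
  ~ ind_f M n d N b -> ~ ind_d M n d N b.
Proof.
move=> ntp sN eN /contrapT[psi pd fp]; apply; exists psi => //.
apply/(dividesP hM _ sN); apply: forks_divides => //; last exact/forks_sforks.
by exists psi => //; apply: free_inT => -[].
Qed.

(** A non-forking type extends to a global one avoiding all forking sets, and by [split_div] the
    formulas witnessing strong splitting are among these. *)
Lemma dependent_ind_i n (d : 'I_n -> M) N b : dependent M -> small K N ->
  ~ ind_i M n d N b -> ~ ind_f M n d N b.
Proof.
move=> dep sN ni nf; apply: ni.
pose F (C : set ('I_n -> M)) := exists psi S, [/\ tp (N `|` b) d psi, sforks N S &
  C = (fun x => holds psi x /\ ~ S x)].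
have f0 : sforks N (fun _ : 'I_n -> M => False).
  by exists 0, (fun _ _ => False); split=> [[]|].
have [tt0 o0 Htt] := defT (N `|` b) 'I_n.
have tt1 x : holds tt0 x by apply/Htt.
have [|||W [uW FW]] := @ultra_exists _ F.
- by exists (fun x => holds tt0 x /\ ~ False), tt0, (fun _ => False).
- move=> _ _ [p [S [[op pd] fS ->]]] [p' [S' [[op' pd'] fS' ->]]].
  exists (fun x => holds (And p p') x /\ ~ (S x \/ S' x)).
    by exists (And p p'), (fun x => S x \/ S' x); split=> //; apply: sforksU.
  by move=> x [[? ?] /not_orP[? ?]].
- move=> _ [p [S [pd [r [T [dT ST]]] ->]]]; apply: contrapT => H; apply: nf.
  exists p => //; apply/(forks_sforks _ sN); exists r, T; split=> // x px.
  by apply: ST; apply: contrapT => nS; apply: H; exists x.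
exists (fun psi => W (holds psi)); split.
- split.
  + by move=> psi _; apply: free_inT => -[].
  + move=> r theta Hth; have [a Ha] := ultra_ex uW (ultra_ord uW Hth).
    by exists a.
  + by move=> psi _; have [_ _ _ WN] := uW; apply: WN.
- move=> psi pd; apply: (ultraS uW _ (FW (fun x => holds psi x /\ ~ False) _)); first by move=> x [].
  by exists psi, (fun _ => False).
- move=> [m [r [phi [b0 [c1 [c2 [Bb _ pd [s [/indiscE si [i [j [si1 sj2]]]]]]]]]]]].
  have := split_div hM phi i j dep sN Bb si; rewrite si1 sj2 => dv.
  set psi := And _ _ in pd dv.
  suff /(ultraN uW) : W (fun x => ~ holds psi x) by [].
  apply: (ultraS uW _ (FW (fun x => holds tt0 x /\ ~ holds psi x) _)); first by move=> x [].
  exists tt0, (holds psi); split=> //; exists 1, (fun _ => holds psi); split=> [_|x Hx]; last by exists ord0.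
  by split=> //; exists psi => //; apply: free_inT => -[].
Qed.

End Forking.

(** * Strictly independent families witnessing large pre-weight *)

(** Terms with operations of countable arity, named by [Lab]. They describe a closure under
    infinitary Skolem functions in one step and bound its size. *)
Inductive sk (A Lab : Type) := SkBase of A | SkNode of Lab & (nat -> sk A Lab).

(** A term is determined by the labels at its finite positions, which embeds [sk] into a power
    set. *)
Fixpoint sk_pos A Lab (t : sk A Lab) (p : seq nat) (x : A + Lab) : Prop :=
  match t, p with
  | SkBase a, [::] => x = inl a
  | SkBase _, _ :: _ => False
  | SkNode l _, [::] => x = inr l
  | SkNode _ f, j :: p' => sk_pos (f j) p' x
  end.

Lemma sk_pos_inj A Lab (t t' : sk A Lab) :
  (forall p x, sk_pos t p x <-> sk_pos t' p x) -> t = t'.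
Proof.
elim: t t' => [a|l f IH] [a'|l' f'] H.
- by have /= [/(_ erefl) [->]] := H [::] (inl a).
- by have /= [/(_ erefl)] := H [::] (inl a).
- by have /= [/(_ erefl)] := H [::] (inr l).
- have /= [/(_ erefl) [->] _] := H [::] (inr l); congr SkNode; apply: funext => i.
  by apply: IH => p x; apply: (H (i :: p) x).
Qed.

Lemma sm_sk K A Lab : strong_limit K -> sm K nat -> sm K A -> sm K Lab -> sm K (sk A Lab).
Proof.
move=> Klim sN sA sLab.
have sS : sm K (seq nat) by apply: sm_le sN; exists pickle; apply: (pcan_inj pickleK).
apply: sm_le (sm_set Klim (sm_prod Klim sS (sm_sum Klim sA sLab))).
exists (fun t => [set z | sk_pos t z.1 z.2]) => t t' E; apply: sk_pos_inj => p x.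
by have := congr1 (fun S => S (p, x)) E => /= ->.
Qed.

Section Config.
Context {L : language} {K : Type} {M : structure L}.
Hypothesis hM : mon K M.
Implicit Types (B N D A : set M).

(** Parameters come as a sequence, the form that [closure] supplies; finite tuples are padded with
    [m0]. *)
Lemma closed_elementary N m0 : N m0 ->
  (forall (psi : formula L (nat + nat)) (x p : nat -> M), (forall i, N (p i)) ->
     sat psi (cat_tup x p) -> exists2 y, (forall i, N (y i)) & sat psi (cat_tup y p)) ->
  elementary_sub N.
Proof.
move=> Nm0 HN.
have fN (f : fsym L) (v : 'I_(far f) -> M) : (forall i, N (v i)) -> N (fint v).
  move=> Nv; pose p (n : nat) := if insub n is Some i then v i else m0.
  pose psi : formula L (nat + nat) := Eq (Var L (inl 0)) (@App L (nat + nat) f (fun i => Var L (inr (val i)))).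
  have vE : (fun i : 'I_(far f) => p (val i)) = v by apply: funext => i; rewrite /p valK.
  have [||y Ny /= E] := HN psi (fun _ => fint v) p.
  - by move=> i; rewrite /p; case: insub.
  - by rewrite /= vE.
  - by move: (Ny 0); rewrite E vE.
pose Ns := @Structure L {m | N m} (inhabits (exist _ m0 Nm0))
  (fun f v => exist _ _ (fN f (fun i => proj1_sig (v i)) (fun i => proj2_sig (v i))))
  (fun r v => rint (fun i => proj1_sig (v i))).
pose h (m : Ns) : M := proj1_sig m.
exists Ns, h; split; last first.
  apply/seteqP; split=> [_ [m _ <-]|m Nm]; first exact: (proj2_sig m).
  by exists (exist _ m Nm).
have hev V (t : term L V) (v : V -> Ns) : h (eval t v) = eval t (h \o v).
  by elim: t => [//|f ts IH] /=; congr (fint _); apply: funext => i; apply: IH.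
have hi : injective h.
  by move=> [x Nx] [y Ny] /= E; subst y; congr exist; apply: Prop_irrelevance.
suff H V (phi : formula L V) : forall v : V -> Ns, sat phi v <-> sat phi (h \o v).
  by move=> n phi v; apply: H.
elim: V / phi => [V s t|V r ts|V p IH|V p IHp q IHq|V p IH] v /=.
- by rewrite -!hev; split=> [->|/hi].
- suff -> : (fun i => eval (ts i) (h \o v)) = (fun i => proj1_sig (eval (ts i) v)) by [].
  by apply: funext => i; rewrite -hev.
- by rewrite IH.
- by rewrite IHp IHq.
have E (d : Ns) : h \o (fun o : option V => if o is Some x then v x else d) =
    (fun o => if o is Some x then (h \o v) x else h d) by apply: funext => -[].
split=> -[d Hd]; first by exists (h d); rewrite -E; apply/IH.
have [F HF] := free_in_finite p.
pose l := flatten [seq (if o is Some x then [:: h (v x)] else [::]) | o <- F].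
have /choice[g gP] : forall x : V, exists k, List.In (Some x) F -> nth m0 l k = h (v x).
  move=> x; have [xF|nF] := pselect (List.In (Some x) F); last by exists 0 => /nF.
  suff [k Hk] : exists k, nth m0 l k = h (v x) by exists k.
  rewrite /l; elim: (F) xF => //= o s IHs [->|/IHs[k Hk]] /=; first by exists 0.
  by case: o => [y|]; [exists k.+1|exists k].
have lN k : N (nth m0 l k).
  rewrite /l; elim: (F) k => [|[y|] s IHs] [|k] //=; try exact: IHs.
  exact: (proj2_sig (v y)).
pose r (o : option V) : nat + nat := if o is Some x then inr (g x) else inl 0.
have rE x : sat (frename r p) (cat_tup x (nth m0 l)) <-> sat p (fun o => if o is Some y then (h \o v) y else x 0).
  rewrite sat_frename; apply: sat_free HF _ => -[y|] //= yF; exact: gP.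
have [|y Ny /rE Hy] := HN (frename r p) (fun _ => d) (nth m0 l) lN; first exact/rE.
exists (exist _ _ (Ny 0)); apply/IH; rewrite E; exact: Hy.
Qed.

(** [pick] realizes a set of formulas over [A] and a countable tuple as a whole, and the label
    [(T, i)] extracts coordinate [i] of the solution; closing [A] under these operations puts all
    coordinates into [N]. *)
Lemma closure A m0 : small K A -> A m0 -> exists N, [/\ small K N, A `<=` N, elementary_sub N &
  forall x p : nat -> M, (forall i, N (p i)) ->
    exists2 y, (forall i, N (y i)) & teq A (cat_tup x p) (cat_tup y p)].
Proof.
move=> sA Am0; have [Klim sNat sF _ _] := hM.
pose A' := {m | A m}; pose a0 : A' := exist _ m0 Am0.
pose V := ((nat + nat) + A')%type.
pose real (T : set (formula L V)) (p x : nat -> M) :=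
  forall phi, T phi -> sat phi (cat_tup (cat_tup x p) (@proj1_sig _ _)).
have /choice[pick pickP] : forall Tp : set (formula L V) * (nat -> M), exists x, (exists y, real Tp.1 Tp.2 y) -> real Tp.1 Tp.2 x.
  move=> [T p]; have [[y Hy]|ny] := pselect (exists y, real T p y); first by exists y.
  by exists (fun _ => m0).
pose Lab := (set (formula L V) * nat)%type.
pose ev := fix ev (t : sk A' Lab) : M := match t with
  | SkBase a => proj1_sig a | SkNode l f => pick (l.1, fun i => ev (f i)) l.2 end.
have sA' : sm K A' by apply/smallE.
have sV : sm K V by apply: (sm_sum Klim) => //; apply: (sm_sum Klim).
have sLab : sm K Lab by apply: (sm_prod Klim) => //; apply: (sm_set Klim); apply: (sm_formula Klim sNat (inl (inl 0)) sF sV).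
pose N : set M := range ev.
have HN (x p : nat -> M) : (forall i, N (p i)) -> exists2 y : nat -> M, (forall i, N (y i)) & teq A (cat_tup x p) (cat_tup y p).
  move=> Np; have /choice[f fP] : forall i, exists t, ev t = p i by move=> i; have [t _ <-] := Np i; exists t.
  pose T : set (formula L V) := fun phi => sat phi (cat_tup (cat_tup x p) (@proj1_sig _ _)).
  have pE : (fun i => ev (f i)) = p by apply: funext.
  exists (pick (T, p)); first by move=> i; exists (SkNode (T, i) f) => //=; rewrite pE.
  have Hr : real T p (pick (T, p)) by apply: (pickP (T, p)); exists x.
  apply: teq_imp => S [psi o H] /H Sx; apply/H.
  have /choice[c cP] : forall m, exists a : A', A m -> proj1_sig a = m.
    move=> m; have [Am|nA] := pselect (A m); first by exists (exist _ m Am).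
    by exists a0.
  pose r (s : (nat + nat) + M) : V := match s with inl z => inl z | inr m => inr (c m) end.
  have rE y : sat (frename r psi) (cat_tup (cat_tup y p) (@proj1_sig _ _)) <-> holds psi (cat_tup y p).
    by rewrite sat_frename; apply: sat_free o _ => -[z|m] //= /cP.
  by apply/rE; apply: Hr; apply/rE.
have AN : A `<=` N by move=> m Am; exists (SkBase Lab (exist _ m Am)).
exists N; split=> //.
  apply: small_range; exact: sm_sk.
apply: (closed_elementary (AN _ Am0)) => psi x p Np Hx.
have [y Ny xy] := HN x p Np; exists y => //.
by apply/(xy _ (def_set0 A (def_sat psi))).
Qed.

(** A formula of [W] has finitely many parameters; those outside [N] have copies in [N] with the
    same type over [A] and the others. As [W] lives on [A], the formula with these copies is still
    in [W], so it holds of [a]. The copies are fixed by automorphisms over [N], which excludes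
    dividing. *)
Lemma strict_over A N m0 J (W : set (set (J -> M))) (a : J -> M) :
  A `<=` N -> N m0 ->
  (forall x p : nat -> M, (forall i, N (p i)) ->
    exists2 y, (forall i, N (y i)) & teq A (cat_tup x p) (cat_tup y p)) ->
  ultra W -> W (fun x => forall c, A (x c)) -> (forall S, def N S -> (S a <-> W S)) ->
  strict N W a.
Proof.
move=> AN Nm0 HN uW WA aW; split=> //; first by apply: (ultraS uW _ WA) => x Ax c; apply: AN.
move=> th dth Wth [k [g [ag gk]]].
have [psi o H] := dth.
pose as_ (s : (J + M) + M) : J + (M + M) := match s with
  | inl (inl x) => inl x | inl (inr j) => inr (inl j) | inr m => inr (inr m) end.
have o' : free_in (frename as_ psi) (fun s => if s is inr v then (if v is inr m then N m else True) else True).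
  by rewrite free_in_rename; apply: free_in_sub o => -[[]|].
have [r [phi [u [uN E2]]]] := @nf_right L J (M + M) (inr m0) _ (fun v => if v is inr m then N m else True) Nm0 o'.
have thE x w : th (cat_tup x w) <-> sat phi (cat_tup x (cat_tup w id \o u)).
  rewrite H /holds; have -> : cat_tup (cat_tup x w) id = cat_tup x (cat_tup w id) \o as_.
    by apply: funext => -[[]|].
  rewrite -sat_frename E2 sat_frename.
  suff -> : cat_tup x (cat_tup w id) \o cat_tup inl (inr \o u) = cat_tup x (cat_tup w id \o u) by [].
  by apply: funext => -[].
pose X0 (t : nat) : M := if insub t is Some i then (if u i is inl y then y else m0) else m0.
pose p (t : nat) : M := if insub t is Some i then (if u i is inr b then b else m0) else m0.
have pN t : N (p t).
  by rewrite /p; case: insub => // i; have := uN i; case: (u i).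
have [Y YN XY] := HN X0 p pN.
(* An element may occur several times in the finite tuple; its copies agree because equality is part
   of the type. *)
have Yeq i j y : u i = inl y -> u j = inl y -> Y (val i) = Y (val j).
  move=> ui uj.
  have dS : def A (fun v : nat + nat -> M => v (inl (val i)) = v (inl (val j))).
    by exists (Eq (Var L (inl (inl (val i)))) (Var L (inl (inl (val j))))).
  by have [H1 _] := XY _ dS; apply: H1; rewrite /= /X0 !valK ui uj.
have /choice[w0 w0P] : forall y, exists d, N d /\ forall i, u i = inl y -> d = Y (val i).
  move=> y; have [[i iy]|ni] := pselect (exists i, u i = inl y).
    by exists (Y (val i)); split=> // j jy; apply: Yeq iy jy.
  by exists m0; split=> // i iy; case: ni; exists i.
pose code (i : 'I_r) : nat + nat := match u i with inl _ => inl (val i) | inr _ => inr (val i) end.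
have codeX : cat_tup X0 p \o code = cat_tup id id \o u.
  by apply: funext => i; rewrite /= /code; case E: (u i) => [y|y] /=; rewrite /X0 /p valK E.
have codeY : cat_tup Y p \o code = cat_tup w0 id \o u.
  apply: funext => i; rewrite /= /code; case E: (u i) => [y|y] /=.
    by have [_ H1] := w0P y; rewrite (H1 i E).
  by rewrite /p valK E.
have Wth0 : W (fun x => th (cat_tup x w0)).
  apply: (ultraI2 uW Wth WA) => x /thE thx Ax; apply/thE.
  pose h (s : J + 'I_r) : J + (nat + nat) := match s with inl j => inl j | inr i => inr (code i) end.
  have dS := def_fixl Ax (def_comp h (def_set0 A (def_sat phi))).
  have hE z : cat_tup x z \o h = cat_tup x (z \o code) by apply: funext => -[].
  by have [H1 _] := XY _ dS; move: H1; rewrite !hE codeX codeY; apply.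
have dth0 : def N (fun x => th (cat_tup x w0)).
  pose f (s : J + M) : J + M := match s with inl i => inl i | inr y => inr (w0 y) end.
  have fN z m : f z = inr m -> N m by case: z => // y [<-]; have [] := w0P y.
  apply: def_ext (def_subst fN dth) => y.
  by suff -> : cat_tup y id \o f = cat_tup y w0 by []; apply: funext => -[].
apply: (gk val val_inj); exists w0 => t.
have -> : g (val t) \o w0 = w0.
  by apply: funext => y; have [_ gN] := ag (val t); have [Ny _] := w0P y; apply: gN.
exact/(aW _ dth0).
Qed.

(** The common core of the lower bounds. [R i] describes the tuples actually present in the array,
    for which finite consistency is known; it passes to the limits [a i]. *)
Lemma config Lam n (J : Lam -> Type) A (W : forall i, set (set (J i -> M)))
    (R : forall i, set (J i -> M)) (E : forall i, set ('I_n + J i -> M)) :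
  sm K {i & J i} -> small K A -> (forall i, ultra (W i)) ->
  (forall i, W i (fun x => forall c, A (x c))) -> (forall i, W i (R i)) ->
  (forall i, def set0 (E i)) ->
  (forall (F : seq Lam) v, (forall i, R i (v i)) -> exists x, forall i, List.In i F -> E i (cat_tup x (v i))) ->
  exists N (a : forall i, J i -> M) d,
    [/\ [/\ small K N, elementary_sub N & A `<=` N], strictly_independent N a,
      forall i S, def N S -> (S (a i) <-> W i S) & forall i, E i (cat_tup d (a i))].
Proof.
move=> sJ sA uW WA WR dE HF; have [Klim sNat _ _ _] := hM.
case: (carrier_nonempty M) => m0.
have [lt wolt] := wo_exists Lam.
have sA1 : small K (A `|` [set m0]).
  apply: (smallU Klim) => //.
  by apply: (@sm_cover _ _ _ _ (fun _ : nat => m0) _ sNat) => x ->; exists 0.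
have [N [sN AN eN HN]] := closure sA1 (or_intror erefl : (A `|` [set m0]) m0).
have AN' : A `<=` N by move=> x Ax; apply: AN; left.
have Nm0 : N m0 by apply: AN; right.
have WN i : W i (fun x : J i -> M => forall c, N (x c)).
  by apply: (ultraS (uW i) _ (WA i)) => x Ax c; apply: AN'.
have [a ma] := morley_exists hM wolt sN sJ uW.
have aW i S : def N S -> (S (a i) <-> W i S).
  by move=> dS; apply: ma; apply: def_mono dS; left.
have sta i : strict N (W i) (a i).
  apply: (strict_over AN Nm0 HN (uW i) _ (aW i)).
  by apply: (ultraS (uW i) _ (WA i)) => x Ax c; left.
have sia := strict_morley hM wolt sN sJ sta ma.
pose C (F : seq Lam) : set ('I_n -> M) := fun x => forall i, List.In i F -> E i (cat_tup x (a i)).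
have [|||W0 [uW0 FW0]] := @ultra_exists _ (fun S => exists F, S = C F).
- by exists (C [::]), [::].
- move=> _ _ [F ->] [F' ->]; exists (C (F ++ F')); first by eexists.
  by move=> x Cx; split=> i iF; apply: Cx; apply/List.in_app_iff; [left|right].
- move=> _ [F ->].
  pose S (v : forall i, J i -> M) := exists x, forall i, List.In i F -> E i (cat_tup x (v i)).
  have dS : ddef N S.
    pose h i (s : 'I_n + J i) : 'I_n + {i & J i} := match s with inl x => inl x | inr c => inr (existT _ i c) end.
    have d1 : def N (fun u : 'I_n + {i & J i} -> M => forall i, List.In i F -> E i (u \o h i)).
      apply: (@def_allseq _ _ N _ _ F (fun i u => E i (u \o h i))) => i.
      exact: (def_comp (h i) (def_set0 N (dE i))).
    apply: def_ext (def_ex d1) => w.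
    have Eh x i : cat_tup x w \o h i = cat_tup x (curry w i) by apply: funext => -[].
    by split=> -[x Hx]; exists x => i iF; have := Hx i iF; rewrite Eh.
  exact: (morley_all (S := S) wolt uW WN ma WR dS (HF F)).
have sNa : small K (N `|` range (tot a)) by apply: (smallU Klim) => //; apply: small_range.
have [d dP] := realize hM uW0 sNa (@sm_ord K sNat n).
exists N, a, d; split=> // i.
have dEa : def (N `|` range (tot a)) (fun x => E i (cat_tup x (a i))).
  apply: def_mono (def_unsplit (a i) (def_set0 N (dE i))) => y [|[c _ <-]]; first by left.
  by right; exists (existT _ i c).
apply/(dP _ dEa); apply: (ultraS uW0 _ (FW0 (C [:: i]) _)); last by eexists.
by move=> x; apply; left.
Qed.

Lemma tp_complete n (d : 'I_n -> M) N : complete_type N (tp N d).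
Proof.
split.
- by move=> psi [].
- by move=> r theta H; exists d => i; have [] := H i.
- by move=> psi o; have [h|h] := pselect (holds psi d); [left|right].
Qed.

Lemma injective_ultra (Lam : Type) : exists V : set (set (Lam -> nat)), ultra V /\
  forall F : seq Lam, V (fun h => forall i j, List.In i F -> List.In j F -> h i = h j -> i = j).
Proof.
pose P (F : seq Lam) (h : Lam -> nat) := forall i j, List.In i F -> List.In j F -> h i = h j -> i = j.
have [|||V [uV FV]] := @ultra_exists _ (fun S => exists F, S = P F).
- by exists (P [::]), [::].
- move=> _ _ [F ->] [F' ->]; exists (P (F ++ F')); first by eexists.
  by move=> h Ph; split=> i j iF jF; apply: Ph; apply/List.in_app_iff; auto.
- move=> _ [F ->].
  exists (fun i => index (i : {classic Lam}) (F : seq {classic Lam})) => i j iF jF.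
  elim: F iF jF => //= x F IH; case: eqP => [xi|nxi]; case: eqP => [xj|nxj] //.
    by rewrite -xi -xj.
  by move=> [/nxi//|iF] [/nxj//|jF] [] /(IH iF jF).
by exists V; split=> // F; apply: FV; exists F.
Qed.

(** Countably many rows are spread over [Lam]: row [i] is the limit of the rows [h i], and on each
    finite set almost every [h] is injective, so distinct new rows behave like distinct old ones. *)
Lemma array_ext Lam m (b : nat -> nat -> 'I_m -> M) : sm K Lam ->
  exists (V : set (set (Lam -> nat))) (b' : Lam -> nat -> 'I_m -> M),
  [/\ ultra V, forall F : seq Lam, V (fun h => forall i j, List.In i F -> List.In j F -> h i = h j -> i = j) &
    forall S : set (Lam * nat * 'I_m -> M), def set0 S ->
      (S (fun z => b' z.1.1 z.1.2 z.2) <-> V (fun h => S (fun z => b (h z.1.1) z.1.2 z.2)))].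
Proof.
move=> sL; have [Klim sNat _ _ _] := hM; case: (carrier_nonempty M) => m0.
have [V [uV VF]] := injective_ultra Lam.
have s0 : small K (@set0 M) by apply: (@sm_cover _ _ _ _ (fun _ : nat => m0) _ sNat).
have sX : sm K (Lam * nat * 'I_m).
  by apply: (sm_prod Klim (sm_prod Klim sL sNat)); apply: (@sm_ord K sNat m).
have [v vP] := realize hM (ultra_push uV (fun (h : Lam -> nat) (z : Lam * nat * 'I_m) => b (h z.1.1) z.1.2 z.2)) s0 sX.
exists V, (fun i j c => v (i, j, c)); split=> // S dS.
have -> : (fun z : Lam * nat * 'I_m => v (z.1.1, z.1.2, z.2)) = v by apply: funext => -[[]].
exact: vP.
Qed.

Lemma in_tnth (T : Type) (F : seq T) : exists f : 'I_(size F) -> T,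
  (forall t, List.In (f t) F) /\ forall x, List.In x F -> exists t, f t = x.
Proof.
elim: F => [|x F [f [f1 f2]]].
  by exists (fun t : 'I_0 => match t with Ordinal _ h => False_rect _ (notF h) end); split=> [[]|].
exists (fun t => if unlift ord0 t is Some s then f s else x); split.
  by move=> t; case: unliftP => [s _|_]; [right; apply: f1|left].
move=> y [<-|/f2[s <-]]; first by exists ord0; rewrite unlift_none.
by exists (lift ord0 s); rewrite liftK.
Qed.

Lemma sm_sigconst Lam (J : Type) : sm K Lam -> sm K J -> sm K {i : Lam & J}.
Proof. by apply: (sm_dep_prod hM) => i; apply: tle_refl. Qed.

Lemma TP2_config Lam : sm K Lam -> TP2 M ->
  exists n m (E : set ('I_n + 'I_m -> M)) k N (a : Lam -> 'I_m -> M) d,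
    [/\ def set0 E, small K N, elementary_sub N, strictly_independent N a &
      forall i, E (cat_tup d (a i)) /\ sdivk N k (fun x => E (cat_tup x (a i)))].
Proof.
move=> sL [n [m [phi [k [b [bk bc]]]]]]; have [Klim sNat _ _ _] := hM.
have [V [b' [uV VF b'P]]] := array_ext b sL.
have [U [uU nU]] := nonprincipal.
pose E (u : 'I_n + 'I_m -> M) := sat phi u.
have dE : def set0 E := def_sat phi.
pose A : set M := range (fun z : Lam * nat * 'I_m => b' z.1.1 z.1.2 z.2).
have sm_m := @sm_ord K sNat m.
have sA : small K A by apply: small_range; apply: (sm_prod Klim (sm_prod Klim sL sNat) sm_m).
have bA i j c : A (b' i j c) by exists (i, j, c).
have b'k i : kinc E k (b' i).
  move=> s si; pose S (w : Lam * nat * 'I_m -> M) := ~ exists x, forall t, E (cat_tup x (fun c => w (i, s t, c))).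
  have dS : def set0 S.
    apply: defN; exact: (@def_exI _ _ set0 'I_n _ k (fun _ => 'I_m) (fun _ => E) (fun t c => (i, s t, c)) (fun _ => dE)).
  apply/(b'P S dS); apply: (ultraT uV) => h [x Hx]; apply: (bk (h i) s si); exists x => t.
  by apply/holds_inst; apply: Hx.
have [|||||N [a [d [[sN eN AN] sia aW dE']]]] := @config Lam n (fun _ => 'I_m) A (fun i => push U (b' i))
  (fun i x => exists j, x = b' i j) (fun _ => E) (sm_sigconst sL sm_m) sA.
- by move=> i; apply: ultra_push.
- by move=> i; apply: (ultraT uU) => j c; apply: bA.
- by move=> i; apply: (ultraT uU) => j; exists j.
- by [].
- move=> F v /choice[eta vE].
  have [f [f1 f2]] := in_tnth F.
  pose S (w : Lam * nat * 'I_m -> M) := exists x, forall t, E (cat_tup x (fun c => w (f t, eta (f t), c))).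
  have dS : def set0 S.
    exact: (@def_exI _ _ set0 'I_n _ _ (fun _ => 'I_m) (fun _ => E) (fun t c => (f t, eta (f t), c)) (fun _ => dE)).
  have [x Hx] : S (fun z => b' z.1.1 z.1.2 z.2).
    apply/(b'P S dS); apply: (ultraS uV _ (VF F)) => h hF.
    (* As [h] is injective on [F], the chosen entries of the rows [h i] lie on one path. *)
    have /choice[eta' eP] : forall j, exists e, forall i, List.In i F -> h i = j -> e = eta i.
      move=> j; have [[i [iF ij]]|ni] := pselect (exists i, List.In i F /\ h i = j).
        by exists (eta i) => i' iF' ij'; congr eta; apply: hF; rewrite // ij ij'.
      by exists 0 => i iF ij; case: ni; exists i.
    have [|x Hx] := bc eta' _ (fun t => inst phi (b (h (f t)) (eta' (h (f t))))).
      by move=> t; exists (h (f t)).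
    by exists x => t; have /holds_inst := Hx t; rewrite (eP _ (f t)).
  by exists x => i /f2[t <-]; rewrite vE; apply: Hx.
exists n, m, E, k, N, a, d; split=> // i; split=> //.
have bN j c : N (b' i j c) by apply: AN.
have WN : push U (b' i) (fun x => forall c, N (x c)) by apply: (ultraT uU).
(* Dividing at [a i] is witnessed by a Morley sequence of the limit of row [i], whose entries have
   the type of [a i] over [N]. *)
have [e me] := morley_exists hM (lt := ltn_nat) (J := fun _ => 'I_m)
  wo_nat sN (sm_sigconst sNat sm_m) (fun _ => ultra_push uU (b' i)).
have ea j : teq N (e j) (a i).
  by move=> S dS; rewrite (aW i S dS); apply: me; apply: def_mono dS; left.
have ek := morley_kinc uU nU bN me (def_set0 N dE) (b'k i).
have /choice[g gP] : forall j, exists g, autB N g /\ g \o e j = a i.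
  by move=> j; have [g ag gE] := homog hM sN sm_m (ea j); exists g.
exists g; split=> [j|s si [x Hx]]; first by have [] := gP j.
apply: (ek s si); exists x => t; have [ag ge] := gP (s t).
by have := Hx t; rewrite -ge => /(def_sum_aut _ _ ag (def_set0 N dE)).
Qed.

Lemma def_alternate n m (phi : formula L ('I_n + 'I_m)) :
  exists E : set ('I_n + ('I_m + 'I_m) -> M), def set0 E /\
    forall x y z, E (cat_tup x (cat_tup y z)) <-> sat phi (cat_tup x y) /\ ~ sat phi (cat_tup x z).
Proof.
pose f1 (s : 'I_n + 'I_m) : 'I_n + ('I_m + 'I_m) := match s with inl x => inl x | inr c => inr (inl c) end.
pose f2 (s : 'I_n + 'I_m) : 'I_n + ('I_m + 'I_m) := match s with inl x => inl x | inr c => inr (inr c) end.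
exists (fun u => sat phi (u \o f1) /\ ~ sat phi (u \o f2)); split=> [|x y z].
  by apply: defI; [|apply: defN]; apply: (def_comp _ (def_sat phi)).
have -> : cat_tup x (cat_tup y z) \o f1 = cat_tup x y by apply: funext => -[].
by have -> : cat_tup x (cat_tup y z) \o f2 = cat_tup x z by apply: funext => -[].
Qed.

(** The tuple [a i] is a pair of consecutive terms of an [N]-indiscernible sequence with opposite
    truth values of [phi i] at [d], which is an instance of strong splitting. *)
Lemma pairs_config Lam n (m : Lam -> nat) (phi : forall i, formula L ('I_n + 'I_(m i)))
    (b : forall i, nat -> 'I_(m i) -> M) : sm K Lam ->
  (forall (F : seq Lam) (j0 j1 : Lam -> nat), (forall i, j0 i <> j1 i) ->
     exists x, forall i, List.In i F -> sat (phi i) (cat_tup x (b i (j0 i))) /\ ~ sat (phi i) (cat_tup x (b i (j1 i)))) ->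
  ~ model_types_preweight_lt K (ind_s M) Lam.
Proof.
move=> sL Hb; have [Klim sNat _ _ _] := hM.
have [U [uU nU]] := nonprincipal.
pose J i := ('I_(m i) + 'I_(m i))%type.
have sord k : sm K 'I_k := @sm_ord K sNat k.
have sJ : sm K {i & J i}.
  apply: (sm_dep_prod hM (X := (nat + nat)%type)) => // [i|]; last exact: (sm_sum Klim).
  exists (fun s => match s with inl c => inl (val c) | inr c => inr (val c) end).
  by move=> [c|c] [c'|c'] // [] /val_inj ->.
pose A : set M := range (fun z : {i & (nat * 'I_(m i))%type} => b (projT1 z) (projT2 z).1 (projT2 z).2).
have sA : small K A.
  apply: small_range; apply: (sm_dep_prod hM (X := (nat * nat)%type)) => // [i|]; last exact: (sm_prod Klim).
  by exists (fun z => (z.1, val z.2)) => -[x c] [y c'] [-> /val_inj ->].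
have bA i j c : A (b i j c) by exists (existT _ i (j, c)).
(* The second entry is resolved first, as in [ulim], so that [W i] is the type of the first two
   terms of a Morley sequence of the limit of [b i]. *)
pose W i : set (set (J i -> M)) := fun S => U (fun j1 => U (fun j0 => S (cat_tup (b i j0) (b i j1)))).
have uW i : ultra (W i).
  split=> [S S' WS WS'|S S' SS|H|S]; rewrite /W.
  - by apply: (ultraI2 uU WS WS') => j1 H H'; apply/ultraI.
  - by apply: (ultraS uU) => j1; apply: (ultraS uU) => j0; apply: SS.
  - by have [j1 /(ultra_ex uU)[]] := ultra_ex uU H.
  - have [H|nH] := pselect (W i S); [by left|right].
    move/(ultraN uU): nH; apply: (ultraS uU) => j1 H; exact/(ultraN uU).
pose E i := projT1 (cid (def_alternate (phi i))).
have [dE EE] : (forall i, def set0 (E i)) /\ forall i x y z, E i (cat_tup x (cat_tup y z)) <->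
    sat (phi i) (cat_tup x y) /\ ~ sat (phi i) (cat_tup x z).
  by split=> i; rewrite /E; case: cid => E' /= [].
have [||||N [a [d [[sN eN AN] sia aW dEa]]]] := @config Lam n J A W
  (fun i x => exists j0 j1, j0 <> j1 /\ x = cat_tup (b i j0) (b i j1)) E sJ sA uW.
- by move=> i; apply: (ultraT uU) => j1; apply: (ultraT uU) => j0 [c|c]; apply: bA.
- move=> i; apply: (ultraT uU) => j1; apply: (ultraS uU _ (nU j1)) => j0 j10.
  by exists j0, j1; split=> // E'; rewrite E' ltnn in j10.
- exact: dE.
- move=> F v /choice[j0 /choice[j1 jP]].
  have [i|x Hx] := Hb F j0 j1; first by have [] := jP i.
  by exists x => i iF; have [_ ->] := jP i; apply/EE; apply: Hx.
move=> /(_ n N (tp N d) sN eN (tp_complete d N)); apply.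
exists J, a; split=> //.
  by move=> i; apply/smallT; apply: (sm_sum Klim).
exists d; first by move=> psi [].
move=> i; apply.
pose c1 : 'I_(m i) -> M := a i \o inl; pose c2 : 'I_(m i) -> M := a i \o inr.
have ai : a i = cat_tup c1 c2 by apply: funext => -[].
pose h (s : 'I_n + 'I_(m i)) : 'I_n + ('I_(m i) + 'I_0) := match s with inl x => inl x | inr c => inr (inl c) end.
pose b0 (c : 'I_0) : M := match c with Ordinal _ hc => False_rect _ (notF hc) end.
have hE x y : holds (inst (frename h (phi i)) (cat_tup y b0)) x <-> sat (phi i) (cat_tup x y).
  rewrite holds_inst sat_frename; have -> // : cat_tup x (cat_tup y b0) \o h = cat_tup x y.
  by apply: funext => -[].
have bN j c : N (b i j c) by apply: AN.
have [e me] := morley_exists hM (lt := ltn_nat) (J := fun _ => 'I_(m i))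
  wo_nat sN (sm_sigconst sNat (sord (m i))) (fun _ => ultra_push uU (b i)).
have WN : push U (b i) (fun x => forall c, N (x c)) by apply: (ultraT uU).
have ie := morley_ind (ultra_push uU (b i)) WN me.
have e01 : teq N (cat_tup (e 0) (e 1)) (a i).
  move=> S dS; rewrite (aW i S dS).
  pose S' (v : nat -> 'I_(m i) -> M) := S (cat_tup (v 0) (v 1)).
  have dS' : ddef (J := fun _ : nat => 'I_(m i)) N S'.
    pose r (s : J i) : {_ : nat & 'I_(m i)} := match s with inl c => existT _ 0 c | inr c => existT _ 1 c end.
    apply: def_ext (def_comp r dS) => w; rewrite /S'.
    by have -> : w \o r = cat_tup (curry w 0) (curry w 1) by apply: funext => -[].
  have sS' : isupp (downto 2) S'.
    by move=> v w vw; rewrite /S' !vw //=; auto.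
  have Q := morley_limE wo_nat (fun _ : nat => ultra_push uU (b i)) e (fun _ => WN) me (dec_downto 2) sS' dS'.
  apply: (iff_trans Q); apply: (ultra_ext uU) => j1 /=; apply: (ultra_ext uU) => j0.
  by rewrite /S' updd_eq updd_neq // updd_eq.
have [g ag gE] := homog hM sN (sm_sum Klim (sord (m i)) (sord (m i))) e01.
exists (m i), 0, (frename h (phi i)), b0, c1, c2; split.
- by case.
- by split=> c; right; [exists (inl c)|exists (inr c)].
- split; last first.
    by have := dEa i; rewrite ai => /EE[H1 H2]; split; [apply/hE|move=> /hE].
  have fo y : (forall c, range (a i) (y c)) -> over (N `|` range (a i)) (inst (frename h (phi i)) (cat_tup y b0) : pformula M 'I_n).
    move=> ry; rewrite /over /inst free_in_rename; apply: free_inT => -[x|[c|[]]] //=.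
    by right; apply: ry.
  by split; apply: fo => c; [exists (inl c)|exists (inr c)].
- exists (fun j => g \o e j); split; first by apply/indiscE; apply: ind_aut.
  exists 0, 1; split; apply: funext => c.
    by have := congr1 (fun f => f (inl c)) gE.
  by have := congr1 (fun f => f (inr c)) gE.
Qed.

Lemma TP2_preweight Lam : sm K Lam -> TP2 M -> ~ model_types_preweight_lt K (ind_d M) Lam.
Proof.
move=> sL /(TP2_config sL)[n [m [E [k [N [a [d [dE sN eN sia H]]]]]]]].
have [Klim sNat _ _ _] := hM.
move=> /(_ n N (tp N d) sN eN (tp_complete d N)); apply.
exists (fun _ => 'I_m), a; split=> //.
  by move=> i; apply/smallT; apply: (@sm_ord K sNat m).
exists d; first by move=> psi [].
move=> i; apply; have [Ed dv] := H i.
have [psi o EE] := def_unsplit (a i) (def_set0 N dE).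
exists psi; first by split=> //; apply/EE.
apply/(dividesP hM _ sN); exists k.
by have <- : (fun x => E (cat_tup x (a i))) = holds psi by apply: funext => x; apply/propext.
Qed.

(** TP2 gives a strictly independent family at which one formula divides while [d] satisfies all the
    instances; [rows_IP] then applies. *)
Lemma dependent_NTP2 : dependent M -> NTP2 M.
Proof.
have [Klim sNat _ _ _] := hM.
move=> dep /(TP2_config sNat)[n [m [E [k [N [a [d [dE sN eN sia H]]]]]]]].
have dEN : nat -> def N E by move=> _; apply: def_set0.
have [I [I0 mI Ik]] := strict_rows hM (k := fun _ => k) sN (fun _ => @sm_ord K sNat m) sia dEN (fun i => proj2 (H i)).
apply: (rows_IP hM (dEN 0) mI Ik (d := d) _) dep => i.
by rewrite I0; have [] := H i.
Qed.

Lemma IP_preweight Lam : sm K Lam -> ~ dependent M -> ~ model_types_preweight_lt K (ind_s M) Lam.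
Proof.
move=> sL /existsNP[n /existsNP[m /existsNP[phi /contrapT[a [b ab]]]]].
(* Any set of entries of this array can be cut out by an instance of [phi]; its rows are then spread
   over [Lam]. *)
have [V [b' [uV VF b'P]]] := array_ext (fun i j => a (pickle (i, j))) sL.
apply: (pairs_config (phi := fun _ => phi) (b := b') sL) => F j0 j1 j01.
have [f [f1 f2]] := in_tnth F.
have [E2 [dE2 EE]] := def_alternate phi.
pose r t (s : 'I_m + 'I_m) : Lam * nat * 'I_m := match s with inl c => (f t, j0 (f t), c) | inr c => (f t, j1 (f t), c) end.
pose S (w : Lam * nat * 'I_m -> M) := exists x, forall t, E2 (cat_tup x (w \o r t)).
have dS : def set0 S.
  exact: (@def_exI _ _ set0 'I_n _ _ (fun _ => ('I_m + 'I_m)%type) (fun _ => E2) r (fun _ => dE2)).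
have rE t (w : Lam -> nat -> 'I_m -> M) : (fun z : Lam * nat * 'I_m => w z.1.1 z.1.2 z.2) \o r t =
   cat_tup (w (f t) (j0 (f t))) (w (f t) (j1 (f t))) by apply: funext => -[].
have [x Hx] : S (fun z => b' z.1.1 z.1.2 z.2).
  apply/(b'P S dS); apply: (ultraS uV _ (VF F)) => h hF.
  exists (b (fun q => exists t, q = pickle (h (f t), j0 (f t)))) => t.
  rewrite (rE t (fun i j => a (pickle (h i, j)))); apply/EE; split.
    by apply/holds_inst/ab; exists t.
  move=> /holds_inst/ab[t' /(pcan_inj pickleK)[E1 E3]].
  have E4 := hF _ _ (f1 t) (f1 t') E1.
  by apply: (j01 (f t)); rewrite E3 E4.
by exists x => i /f2[t <-]; have := Hx t; rewrite (rE t b') => /EE.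
Qed.

Lemma not_sd_preweight : ~ strongly_dependent M -> ~ model_types_preweight_lt K (ind_s M) nat.
Proof.
have [Klim sNat _ _ _] := hM.
move=> /contrapT[n [m [phi [a H]]]].
apply: (pairs_config (phi := phi) (b := a) sNat) => F j0 j1 j01.
have [f [f1 f2]] := in_tnth F.
(* The pattern of the path [j0] already negates the entries on [j1], since the two differ in every
   row. *)
have [|x Hx] := H j0 _ (fun s : 'I_(size F + size F) => match fintype.split s with
  | inl t => inst (phi (f t)) (a (f t) (j0 (f t)))
  | inr t => Neg (inst (phi (f t)) (a (f t) (j1 (f t)))) end).
  move=> s; case: fintype.split => t.
    by exists (f t, j0 (f t)); rewrite //= eqxx.
  by exists (f t, j1 (f t)); rewrite //=; case: eqP => // /j01.
exists x => i /f2[t <-].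
have := Hx (lshift _ t); rewrite (unsplitK (inl _ t : 'I_(size F) + 'I_(size F))) => /holds_inst h1.
have := Hx (rshift _ t); rewrite (unsplitK (inr _ t : 'I_(size F) + 'I_(size F))) /= => h2.
by split=> // /holds_inst.
Qed.

End Config.

Lemma cantor X : ~ tle (set X) X.
Proof.
move=> [f fi]; pose D x := exists A : set X, f A = x /\ ~ A x.
have nD : ~ D (f D) by move=> Df; have [A [/fi AD nA]] := Df; apply: nA; rewrite AD.
by case: (nD); exists D.
Qed.

(** * The theorem *)

(** If [K] embedded into [Tplus], the power set of [F], being below [K], would be below [Tplus] and
    hence embed into [F], against Cantor's theorem. *)
Lemma sm_succ K F Tplus : strong_limit K -> card_lt [set: F] [set: K] ->
  succ_card F Tplus -> sm K Tplus.
Proof.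
move=> Klim FK [_ succ] KT.
have [sFK nKsF] := Klim _ FK.
have : card_lt [set: set F] [set: Tplus].
  split; first by apply/card_leT_tle; apply: tle_trans KT; apply/card_leT_tle.
  by move=> /card_leT_tle TsF; apply: nKsF; apply/card_leT_tle; apply: tle_trans KT TsF.
by move=> /succ /card_leT_tle /cantor.
Qed.

Lemma tle_nat_formula L : tle nat (formula L nat).
Proof. by exists (fun i => Eq (Var L i) (Var L i)) => i j []. Qed.

Section Preweight.
Context {L : language} {M : structure L}.
Variable K : Type.

Lemma types_model_types (ind : indep_notion M) Lam :
  types_preweight_lt K ind Lam -> model_types_preweight_lt K ind Lam.
Proof. by move=> H n B p sB _; apply: H. Qed.

Lemma types_preweight_sub (ind ind' : indep_notion M) Lam :
  (forall n d B b, small K B -> ~ ind' n d B b -> ~ ind n d B b) ->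
  types_preweight_lt K ind Lam -> types_preweight_lt K ind' Lam.
Proof.
move=> sub H n B p sB cp [J [a [sJ sa [d dp nd]]]]; apply: (H n B p sB cp).
by exists J, a; split=> //; exists d => // i; apply: sub.
Qed.

Lemma model_types_preweight_sub (ind ind' : indep_notion M) Lam :
  (forall n d B b, small K B -> elementary_sub B -> ~ ind' n d B b -> ~ ind n d B b) ->
  model_types_preweight_lt K ind Lam -> model_types_preweight_lt K ind' Lam.
Proof.
move=> sub H n B p sB eB cp [J [a [sJ sa [d dp nd]]]]; apply: (H n B p sB eB cp).
by exists J, a; split=> //; exists d => // i; apply: sub.
Qed.

Lemma divides_forks X B (psi : pformula M X) : divides B psi -> forks B psi.
Proof. by move=> dv; exists 1, (fun _ => psi); split=> // a; exists ord0. Qed.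

Lemma ind_d_ind_f n (d : 'I_n -> M) B b : ~ ind_d M n d B b -> ~ ind_f M n d B b.
Proof. by move=> /contrapT[psi tpsi /divides_forks f]; apply; exists psi. Qed.

Lemma ind_s_ind_i n (d : 'I_n -> M) B b : ~ ind_s M n d B b -> ~ ind_i M n d B b.
Proof.
move=> /contrapT[m [r [phi [b0 [c1 [c2 [Bb _ pd S]]]]]]] [q [_ tq nq]]; apply: nq.
by exists m, r, phi, b0, c1, c2; split=> //; apply: tq.
Qed.

End Preweight.

Unset Implicit Arguments.

Theorem theorem6p6 (L : language) (T : set (sentence L)) (hT : complete_theory T)
    (K : Type) (M : structure L) (hM : monster T K M)
    (Tplus : Type) (hTplus : succ_card (formula L nat) Tplus) :
  ((NTP2 M <-> types_preweight_lt K (ind_d M) Tplus) /\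
   (NTP2 M <-> model_types_preweight_lt K (ind_f M) Tplus) /\
   (NTP2 M <-> model_types_preweight_lt K (ind_d M) Tplus)) /\
  ((dependent M <-> types_preweight_lt K (ind_s M) Tplus) /\
   (dependent M <-> model_types_preweight_lt K (ind_i M) Tplus) /\
   (dependent M <-> model_types_preweight_lt K (ind_s M) Tplus)) /\
  ((strongly_dependent M <-> types_preweight_lt K (ind_s M) nat) /\
   (strongly_dependent M <-> model_types_preweight_lt K (ind_i M) nat) /\
   (strongly_dependent M <-> model_types_preweight_lt K (ind_s M) nat)).
Proof.
have [_ [Klim FK] sat_M hom_M] := hM.
have sF : sm K (formula L nat) by apply/smallT.
have sN : sm K nat := sm_le (tle_nat_formula L) sF.
have mM : mon K M by [].
have sT := sm_succ Klim FK hTplus.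
have dN := dependent_NTP2 mM.
have sdD := @sd_dependent L M.
have NTd := ntp2_preweight mM hTplus.
(* Bounds are transferred against failures: when failure of one notion implies failure of another, a
   bound for the second gives one for the first. *)
have df Lam : model_types_preweight_lt K (ind_f M) Lam -> model_types_preweight_lt K (ind_d M) Lam.
  by apply: model_types_preweight_sub => *; apply: ind_d_ind_f.
have si Lam : model_types_preweight_lt K (ind_i M) Lam -> model_types_preweight_lt K (ind_s M) Lam.
  by apply: model_types_preweight_sub => *; apply: ind_s_ind_i.
have fd Lam : NTP2 M -> model_types_preweight_lt K (ind_d M) Lam ->
    model_types_preweight_lt K (ind_f M) Lam.
  by move=> ntp; apply: model_types_preweight_sub => n d B b; apply: ntp2_ind_f.
have sd Lam : dependent M -> types_preweight_lt K (ind_d M) Lam -> types_preweight_lt K (ind_s M) Lam.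
  by move=> dep; apply: types_preweight_sub => n d B b; apply: dependent_split.
have fi Lam : dependent M -> model_types_preweight_lt K (ind_f M) Lam ->
    model_types_preweight_lt K (ind_i M) Lam.
  by move=> dep; apply: model_types_preweight_sub => n d B b sB _; exact: (dependent_ind_i mM dep sB).
have c1 : model_types_preweight_lt K (ind_d M) Tplus -> NTP2 M.
  by move=> H tp2; have := TP2_preweight mM sT tp2; apply.
have c2 : model_types_preweight_lt K (ind_s M) Tplus -> dependent M.
  by move=> H; apply: contrapT => nd; have := IP_preweight mM sT nd; apply.
have c3 : model_types_preweight_lt K (ind_s M) nat -> strongly_dependent M.
  by move=> H; apply: contrapT => nd; have := not_sd_preweight mM nd; apply.
have SDd := sd_preweight mM.
have sdT := fun Lam => @types_model_types L M K (ind_d M) Lam.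
have ssT := fun Lam => @types_model_types L M K (ind_s M) Lam.
split; [|split].
- split; [split|split; split].
  + exact: NTd.
  + by move=> /sdT.
  + by move=> ntp; apply: (fd _ ntp); apply/sdT/NTd.
  + by move=> /df.
  + by move=> /NTd/sdT.
  + exact: c1.
- split; [split|split; split].
  + by move=> dep; apply: (sd _ dep); apply/NTd/dN.
  + by move=> /ssT.
  + by move=> dep; apply: (fi _ dep); apply: (fd _ (dN dep)); apply/sdT/NTd/dN.
  + by move=> /si.
  + by move=> dep; apply: ssT; apply: (sd _ dep); apply/NTd/dN.
  + exact: c2.
- split; [split|split; split].
  + by move=> H; apply: (sd _ (sdD H)); apply: SDd.
  + by move=> /ssT.
  + by move=> H; apply: (fi _ (sdD H)); apply: (fd _ (dN (sdD H))); apply: sdT; apply: SDd.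
  + by move=> /si.
  + by move=> H; apply: ssT; apply: (sd _ (sdD H)); apply: SDd.
  + exact: c3.
Qed.
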